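(* Let $K\subset\mathbb{C}\setminus(-\infty,0]$ be a compact set with connected complement. Then there exists $\alpha_K\in(0,\infty]$ such that, for every real $\alpha>0$: (i) if $0<\alpha<\alpha_K$, then there exists a simply connected bounded domain $G\subset\mathbb{C}\setminus(-\infty,0]$ that contains $K$ such that $(G,z^{\alpha})$ is a pair of approximation; (ii) if $\alpha\geq\alpha_K$, then there exists no simply connected bounded domain $G\subset\mathbb{C}\setminus(-\infty,0]$ that contains $K$ such that $(G,z^{\alpha})$ is a pair of approximation.
   Context: For a bounded domain $G\subset\mathbb{C}\setminus(-\infty,0]$ and $\alpha>0$, $z^{\alpha}$ is defined with the principal branch of the logarithm, and $(G,z^{\alpha})$ is called a pair of approximation if for every function $f$ holomorphic in $G$ there is a sequence of polynomials $(P_n)_n$ with $\deg(P_n)\le n$ such that $z^{\alpha n}P_n\to f$ locally uniformly on $G$. *)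

(* Defs.v *)
From HB Require Import structures.
From mathcomp Require Import all_boot all_order all_algebra.
From mathcomp Require Import complex.
From mathcomp Require Import all_classical all_reals all_analysis.

Set Implicit Arguments.
Unset Strict Implicit.
Unset Printing Implicit Defensive.

Import Order.TTheory GRing.Theory Num.Theory.
Import numFieldNormedType.Exports.

Local Open Scope classical_set_scope.
Local Open Scope ring_scope.
Local Open Scope complex_scope.

(* R[i] is a numFieldType, but its topology is only found by inference on the
   alias R[i]^o; this makes the usual (modulus) topology available on R[i]. *)
HB.instance Definition _ (R : realType) := NormedModule.copy R[i] R[i]^o.

Section Power.
Context {R : realType}.
Implicit Types z : R[i].

Definition expC z : R[i] :=
  (expR (complex.Re z))%:C * (cos (complex.Im z) +i* sin (complex.Im z)).

(* ComplexField.normc is the modulus as an element of R: `|z| = (normc z)%:C *)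
Definition argC z : R :=
  let t := acos (complex.Re z / ComplexField.Normc.normc z) in
  if 0 <= complex.Im z then t else - t.

Definition logC z : R[i] := ln (ComplexField.Normc.normc z) +i* argC z.

Definition powC z (a : R) : R[i] := expC (a%:C * logC z).

Lemma acos_arg_itv (x y : R) : x +i* y != 0 ->
  -1 <= x / Num.sqrt (x ^+ 2 + y ^+ 2) <= 1.
Proof.
move=> z0; set r := Num.sqrt _.
have r2 : r ^+ 2 = x ^+ 2 + y ^+ 2 by rewrite sqr_sqrtr ?addr_ge0 ?sqr_ge0.
have r0 : 0 < r.
  rewrite lt_def sqrtr_ge0 andbT; apply: contra z0 => /eqP r0.
  exact/eqP/ComplexField.Normc.eq0_normc.
have : `|x| <= r.
  rewrite -(ler_pXn2r (n := 2)) ?nnegrE ?normr_ge0 ?sqrtr_ge0//.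
  by rewrite real_normK ?num_real// r2 lerDl sqr_ge0.
by rewrite ler_norml ler_pdivrMr// mul1r ler_pdivlMr// mulN1r.
Qed.

Lemma expC_logC z : z != 0 -> expC (logC z) = z.
Proof.
case: z => x y z0; have := acos_arg_itv z0.
rewrite /expC /logC /argC /=; set r := Num.sqrt _ => xr.
have r2 : r ^+ 2 = x ^+ 2 + y ^+ 2 by rewrite sqr_sqrtr ?addr_ge0 ?sqr_ge0.
have rge0 : 0 <= r by rewrite sqrtr_ge0.
have r0 : 0 < r.
  rewrite lt_def rge0 andbT; apply: contra z0 => /eqP r0.
  exact/eqP/ComplexField.Normc.eq0_normc.
have rs : r * Num.sqrt (1 - (x / r) ^+ 2) = `|y|.
  rewrite -[X in X * _](ger0_norm rge0) -(sqrtr_sqr r) -sqrtrM ?sqr_ge0//.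
  rewrite mulrBr mulr1 expr_div_n mulrCA divff ?mulr1 ?r2; last first.
    by rewrite -r2 expf_neq0 ?gt_eqF.
  by rewrite addrAC subrr add0r sqrtr_sqr.
rewrite lnK// /real_complex_def; simpc; case: ifPn => y0.
  rewrite acosK ?in_itv//= sin_acos// rs ger0_norm//.
  by congr (_ +i* _); rewrite mulrCA divff ?mulr1 ?gt_eqF.
rewrite cosN sinN acosK ?in_itv//= sin_acos// mulrN rs.
rewrite ltr0_norm ?opprK ?ltNge//.
by congr (_ +i* _); rewrite mulrCA divff ?mulr1 ?gt_eqF.
Qed.

Lemma argC_itv z : z != 0 -> - pi < argC z <= pi.
Proof.
case: z => x y z0; have := acos_arg_itv z0.
rewrite /argC /=; set r := Num.sqrt _ => xr.
case: ifPn => y0.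
  by rewrite acos_lepi// (lt_le_trans _ (acos_ge0 xr))// oppr_lt0 pi_gt0.
rewrite ltrN2 acos_ltpi/= ?(le_trans _ (pi_ge0 R)) ?oppr_le0 ?acos_ge0//.
case/andP: xr => + ->; rewrite andbT le_eqVlt => /predU1P[xr|//].
have r2 : r ^+ 2 = x ^+ 2 + y ^+ 2 by rewrite sqr_sqrtr ?addr_ge0 ?sqr_ge0.
have r0 : r != 0.
  by apply/eqP => r0; move: xr; rewrite r0 invr0 mulr0 => /eqP; rewrite oppr_eq0 oner_eq0.
have xE : x = - r by rewrite -[LHS](divfK r0) -xr mulN1r.
move/eqP: r2; rewrite xE sqrrN -subr_eq0 opprD addrA subrr add0r oppr_eq0.
by rewrite sqrf_eq0 => /eqP y00; move: y0; rewrite y00 lexx.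
Qed.

End Power.

Section Regions.
Context {R : realType}.
Implicit Types (G : set R[i]) (f : R[i] -> R[i]).

Definition slit_plane : set R[i] := ~` [set x%:C | x in `]-oo, (0 : R)]].

Definition domain G := [/\ open G, connected G & G !=set0].

Definition loop_in G (gamma : R -> R[i]) :=
  [/\ {within `[0, 1], continuous gamma}, gamma @` `[0, 1] `<=` G
    & gamma 0 = gamma 1].

(* Every loop is homotopic to a point through loops with a fixed base point;
   the first argument of H is the homotopy parameter.  Path-connectedness is
   part of [domain]: a connected open subset of R[i] is path-connected. *)
Definition simply_connected G := forall gamma, loop_in G gamma ->
  exists H : R * R -> R[i],
    [/\ {within `[0, 1] `*` `[0, 1], continuous H},
        H @` (`[0, 1] `*` `[0, 1]) `<=` G,
        {in `[0, 1], forall t, H (0, t) = gamma t /\ H (1, t) = gamma 0}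
      & {in `[0, 1], forall s, H (s, 0) = gamma 0 /\ H (s, 1) = gamma 0}].

Definition holomorphic_on G f := forall z, G z -> derivable f z 1.

Definition locally_uniform_cvg G (F : nat -> R[i] -> R[i]) f :=
  forall z, G z -> exists2 U, nbhs z U & {uniform U `&` G, F @ \oo --> f}.

Definition pair_of_approximation G (a : R) :=
  forall f, holomorphic_on G f ->
  exists P : nat -> {poly R[i]},
    (forall n, (size (P n) <= n.+1)%N) /\
    locally_uniform_cvg G (fun n z => powC z (a * n%:R) * (P n).[z]) f.

End Regions.

Arguments slit_plane {R}.

(* Main.v *)
Require Import Defs.
From mathcomp Require Import all_boot all_order all_algebra.
From mathcomp Require Import complex.
From mathcomp Require Import all_classical all_reals all_analysis.
From mathcomp Require Import zify ring lra.

(** The admitted exponents form a nonempty, open and downward closed set of positive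
    reals, and [alphaK] is its supremum.

    Call A nice if it is open, bounded and every 1/(z - p), p outside A, is roughly
    approximable by polynomials on the compact parts of A.  Cauchy's formula on the
    boundary of a union of grid squares then yields a quantitative Runge theorem:
    holomorphic functions bounded by B are approximated up to C B (3/4)^k by
    polynomials of degree at most M k.  Consequently, if z^s Q is sufficiently close
    to 1 on a compact L in A for a single polynomial Q, then z^(an) P_n with
    deg P_n <= n approximates every polynomial on a neighbourhood of K as soon as
    a (deg Q + 1) <= s: take for P_n a power of Q times a correction.  Conversely a
    pair of approximation (G, z^a) makes G nice, because it approximates 1/(z - p),
    and provides such a Q with s > a (deg Q + 1), because it approximates z^(-2a).

    The new domain is a component of the interior of a union of grid squares inside G.
    It is simply connected: a maximal row of contiguous squares forming a gate ends
    at boundary points p and q, and 1/(z - p) - 1/(z - q) is a limit of polynomials,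
    so a closed walk crosses the gate with total sign 0 and can be shortened. *)

Set Implicit Arguments.
Unset Strict Implicit.
Unset Printing Implicit Defensive.

Import Order.TTheory GRing.Theory Num.Theory.
Import numFieldNormedType.Exports.

Local Open Scope classical_set_scope.
Local Open Scope ring_scope.
Local Open Scope complex_scope.

(** The obstacle is that approximation in a domain gives uniform information only on its compact
    subsets, so a smaller domain around [K] has to be built for each new exponent. A grid region
    serves because it lies in a compact union of squares inside the old domain, and because niceness
    passes to it: a pole outside the region can be pushed, inside one unselected square, to a point
    outside the old domain. The price is that simple connectedness must be proved for an arbitrary
    grid region; there, polynomial primitives of 1/(z - p) - 1/(z - q) take the place of winding
    numbers and of the Jordan curve theorem.

    The condition [a * size Q <= s] is a degree count: a factor [z^s Q] uses [size Q - 1] degrees of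
    [Q], and the one degree left over per factor pays for the correcting polynomial. The correction
    has to approximate a function growing like [(1 - eps)^-k], so [eps] only has to be small against
    the geometric rate of the Runge theorem. It is the openness of the set of exponents that puts
    the endpoint [alphaK] on the negative side. *)

Notation N := ComplexField.Normc.normc.

Ltac ceq := apply/eqP; rewrite eq_complex /=; apply/andP; split; apply/eqP.

(** * The real modulus and neighbourhoods in the complex plane *)

Section Modulus.
Context {R : realType}.
Implicit Types (z w : R[i]) (x y d : R).

Lemma ReD z w : complex.Re (z + w) = complex.Re z + complex.Re w.
Proof. by case: z w => [? ?] []. Qed.

Lemma ImD z w : complex.Im (z + w) = complex.Im z + complex.Im w.
Proof. by case: z w => [? ?] []. Qed.

Lemma ReB z w : complex.Re (z - w) = complex.Re z - complex.Re w.
Proof. by case: z w => [? ?] []. Qed.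

Lemma ImB z w : complex.Im (z - w) = complex.Im z - complex.Im w.
Proof. by case: z w => [? ?] []. Qed.

Lemma N_ge0 z : 0 <= N z.
Proof. by case: z => x y; rewrite /= sqrtr_ge0. Qed.

Lemma N0 : N (0 : R[i]) = 0.
Proof. exact: ComplexField.Normc.normc0. Qed.

Lemma N1 : N (1 : R[i]) = 1.
Proof. exact: ComplexField.Normc.normc1. Qed.

Lemma NM z w : N (z * w) = N z * N w.
Proof. exact: ComplexField.Normc.normcM. Qed.

Lemma NV z : N z^-1 = (N z)^-1.
Proof. exact: ComplexField.Normc.normcV. Qed.

Lemma NX z n : N (z ^+ n) = N z ^+ n.
Proof. by elim: n => [|n IH]; rewrite ?N1// !exprS NM IH. Qed.

Lemma NN z : N (- z) = N z.
Proof. exact: normcN. Qed.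

Lemma ND z w : N (z + w) <= N z + N w.
Proof. exact: le_normcD. Qed.

Lemma NB z w : N (z - w) <= N z + N w.
Proof. by rewrite -(NN w) ND. Qed.

Lemma distNC z w : N (z - w) = N (w - z).
Proof. by rewrite -NN opprB. Qed.

Lemma NBB z w : N z - N w <= N (z - w).
Proof. by rewrite lerBlDr; apply: le_trans (ND _ _); rewrite subrK. Qed.

Lemma N_eq0 z : (N z == 0) = (z == 0).
Proof. by apply/eqP/eqP => [/ComplexField.Normc.eq0_normc//|->]; rewrite N0. Qed.

Lemma N_gt0 z : (0 < N z) = (z != 0).
Proof. by rewrite lt_def N_ge0 andbT N_eq0. Qed.

Lemma N_Re z : `|complex.Re z| <= N z.
Proof.
case: z => x y /=; rewrite -sqrtr_sqr ler_wsqrtr//.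
by rewrite lerDl sqr_ge0.
Qed.

Lemma N_Im z : `|complex.Im z| <= N z.
Proof.
case: z => x y /=; rewrite -sqrtr_sqr ler_wsqrtr//.
by rewrite lerDr sqr_ge0.
Qed.

Lemma N_real x : N (x%:C) = `|x|.
Proof. by rewrite /= expr0n /= addr0 sqrtr_sqr. Qed.

Lemma N_imag x : N (0 +i* x) = `|x|.
Proof. by rewrite /= expr0n /= add0r sqrtr_sqr. Qed.

Lemma complex_split z : z = (complex.Re z)%:C + (0 +i* complex.Im z).
Proof. by case: z => x y; apply/eqP; rewrite eq_complex /= addr0 add0r !eqxx. Qed.

Lemma N_ReIm z : N z <= `|complex.Re z| + `|complex.Im z|.
Proof.
by rewrite {1}[z]complex_split (le_trans (ND _ _))// N_real N_imag.
Qed.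

Lemma normE z : `|z| = (N z)%:C.
Proof. by []. Qed.

Lemma N_lt_norm z x : (`|z| < x%:C) = (N z < x).
Proof. by rewrite normE ltcR. Qed.

Lemma NP z : N z ^+ 2 = complex.Re z ^+ 2 + complex.Im z ^+ 2.
Proof. by case: z => x y /=; rewrite sqr_sqrtr// addr_ge0 ?sqr_ge0. Qed.

Lemma nbhsN z (U : set R[i]) :
  nbhs z U <-> exists2 d : R, 0 < d & forall w, N (w - z) < d -> U w.
Proof.
split=> [|[d d0 dU]].
  move=> /nbhs_ballP[e e0 eU]; exists (complex.Re e).
    by move: e0; rewrite /= ltcE => /andP[].
  move=> w wz; apply: eU; rewrite -ball_normE /ball_/=.
  (* Positivity in [R[i]] forces a number to be real, so complex radii reduce to real ones. *)
  have -> : e = (complex.Re e)%:C.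
    by move: e0; rewrite /= ltcE => /andP[/= /eqP e0 _]; case: e e0 wz => ? ? /= ->.
  by rewrite N_lt_norm distNC.
apply/nbhs_ballP; exists d%:C; first by rewrite /= ltcR.
move=> w; rewrite -ball_normE /ball_/= N_lt_norm distNC; exact: dU.
Qed.

Lemma openN (U : set R[i]) :
  open U <-> forall z, U z -> exists2 d : R, 0 < d & forall w, N (w - z) < d -> U w.
Proof.
rewrite openE; split=> [oU z /oU/nbhsN//|H z /H ?].
exact/nbhsN.
Qed.

(** Compactness in the form of an induction over finite subcovers. The discs in the local hypothesis
    may leave [K], so the properties it is applied to often carry membership in [K] as an extra
    premise. *)
Lemma compact_ind (K : set R[i]) (P : set R[i] -> Prop) : compact K ->
  P set0 -> (forall A B, P A -> P B -> P (A `|` B)) ->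
  (forall A B, A `<=` B -> P B -> P A) ->
  (forall z, K z -> exists2 d : R, 0 < d & P [set w | N (w - z) < d]) ->
  P K.
Proof.
rewrite compact_cover => Kc P0 PU PS Ploc.
pose r z := if pselect (K z) is left Kz then
  projT1 (cid2 (Ploc z Kz)) else 1.
pose B z := [set w | N (w - z) < r z].
have r0 z : 0 < r z by rewrite /r; case: pselect => // Kz; case: cid2.
have PB z : K z -> P (B z).
  by rewrite /B /r; case: pselect => // Kz _; case: cid2.
have oB z : K z -> open (B z).
  move=> Kz; apply/openN => w /= wz; exists (r z - N (w - z)); first by rewrite subr_gt0.
  move=> v vw; rewrite /B /=; have := ND (v - w) (w - z).
  by rewrite addrA subrK; lra.
have [|D DK KD] := Kc R[i] K B oB.
  by move=> z Kz; exists z => //; rewrite /B /= subrr N0.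
apply: (PS _ _ KD).
suff : P (\bigcup_(i in [set x | x \in (finmap.enum_fset D)]) B i) by [].
have : forall z, z \in (finmap.enum_fset D) -> K z by move=> z /DK; rewrite inE.
elim: (finmap.enum_fset D) => [|z s IH] Ks.
  by apply: (PS _ _ _ P0) => ?[].
apply: (PS _ _ _ (PU _ _ (PB z (Ks z (mem_head _ _))) (IH _))).
  by move=> w [v] /=; rewrite inE => /orP[/eqP->|vs] Bv; [left|right; exists v].
by move=> v vs; apply: Ks; rewrite inE vs orbT.
Qed.

End Modulus.

(** * Complex derivatives *)

Section ComplexDerivative.
Context {R : realType}.
Implicit Types (f g : R[i] -> R[i]) (z w c : R[i]) (d e : R).

Definition ccont f z := forall e, 0 < e -> exists2 d, 0 < d &
  forall w, N (w - z) < d -> N (f w - f z) < e.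

(** The division-free form needs no exclusion of [w = z] and turns the rules of calculus into plain
    estimates. *)
Definition cder f z c := forall e, 0 < e -> exists2 d, 0 < d &
  forall w, N (w - z) < d -> N (f w - f z - c * (w - z)) <= e * N (w - z).

Lemma cder_cont f z c : cder f z c -> ccont f z.
Proof.
move=> df e e0; have [d d0 H] := df 1 ltr01.
have c1 : 0 < 1 + N c by rewrite ltr_pwDl// N_ge0.
exists (Num.min d (e / (1 + N c))).
  by rewrite lt_min d0 divr_gt0.
move=> w; rewrite lt_min => /andP[/H wd]; rewrite ltr_pdivlMr// => we.
rewrite -[f w - f z](subrK (c * (w - z))).
apply: le_lt_trans (ND _ _) _; apply: le_lt_trans we.
by rewrite NM; rewrite mul1r in wd; lra.
Qed.

Lemma cder_near f g z c d : 0 < d -> (forall w, N (w - z) < d -> f w = g w) ->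
  cder f z c -> cder g z c.
Proof.
move=> d0 fg df e /df[d' d'0 H]; exists (Num.min d d'); first by rewrite lt_min d0.
move=> w; rewrite lt_min => /andP[wd wd'].
by rewrite -!fg ?subrr ?N0//; exact: H.
Qed.

Lemma cder_ext f g z c : f =1 g -> cder f z c -> cder g z c.
Proof. by move=> fg; apply: (@cder_near _ _ _ _ 1). Qed.

Lemma cder_cst a z : cder (fun=> a) z 0.
Proof.
move=> e e0; exists 1 => // w _.
by rewrite subrr mul0r subrr N0 mulr_ge0// ?N_ge0// ltW.
Qed.

Lemma cder_id z : cder id z 1.
Proof.
move=> e e0; exists 1 => // w _.
by rewrite mul1r subrr N0 mulr_ge0// ?N_ge0// ltW.
Qed.

Lemma cderD f g z a b : cder f z a -> cder g z b ->
  cder (fun w => f w + g w) z (a + b).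
Proof.
move=> df dg e e0.
have e2 : 0 < e / 2 by rewrite divr_gt0.
have [d d0 H] := df _ e2; have [d' d'0 H'] := dg _ e2.
exists (Num.min d d'); first by rewrite lt_min d0.
move=> w; rewrite lt_min => /andP[/H h /H' h'].
have -> : f w + g w - (f z + g z) - (a + b) * (w - z) =
  (f w - f z - a * (w - z)) + (g w - g z - b * (w - z)) by ring.
by apply: le_trans (ND _ _) _; lra.
Qed.

Lemma cderM f g z a b : cder f z a -> cder g z b ->
  cder (fun w => f w * g w) z (a * g z + f z * b).
Proof.
move=> df dg e e0.
have [d1 d10 H1] := cder_cont df ltr01.
pose B := 1 + N (f z) + N (g z) + N b.
have B0 : 0 < B by rewrite /B; have := (N_ge0 (f z), N_ge0 (g z), N_ge0 b) => -[[]]; lra.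
have eB : 0 < e / (3 * B) by rewrite divr_gt0// mulr_gt0.
have [d2 d20 H2] := df _ eB.
have [d3 d30 H3] := dg _ eB.
have [d4 d40 H4] := cder_cont df eB.
exists (Num.min (Num.min d1 d2) (Num.min d3 d4)); first by rewrite !lt_min d10 d20 d30.
move=> w; rewrite !lt_min => /andP[/andP[/H1 h1 /H2 h2] /andP[/H3 h3 /H4 h4]].
have -> : f w * g w - f z * g z - (a * g z + f z * b) * (w - z) =
  (f w - f z - a * (w - z)) * g z + f w * (g w - g z - b * (w - z))
   + (f w - f z) * (b * (w - z)) by ring.
have fw : N (f w) <= B.
  have := ND (f w - f z) (f z); rewrite subrK /B.
  by have := (N_ge0 (f z), N_ge0 (g z), N_ge0 b) => -[[]]; lra.
have gz : N (g z) <= B.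
  by rewrite /B; have := (N_ge0 (f z), N_ge0 b) => -[]; lra.
have bB : N b <= B.
  by rewrite /B; have := (N_ge0 (f z), N_ge0 (g z)) => -[]; lra.
have K : e / (3 * B) * B * 3 = e by field; rewrite gt_eqF.
have dwz := N_ge0 (w - z).
apply: le_trans (ND _ _) _; apply: le_trans (lerD (ND _ _) (lexx _)) _.
rewrite !NM.
have t1 := ler_pM (N_ge0 _) (N_ge0 _) h2 gz.
have t2 := ler_pM (N_ge0 _) (N_ge0 _) fw h3.
have t3 : N (f w - f z) * (N b * N (w - z)) <= e / (3 * B) * (B * N (w - z)).
  apply: ler_pM (ltW h4) _; rewrite ?mulr_ge0 ?N_ge0//.
  by apply: ler_wpM2r.
rewrite -[X in _ <= X * _]K; lra.
Qed.

Lemma cderN f z a : cder f z a -> cder (fun w => - f w) z (- a).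
Proof.
move=> df e /df[d d0 H]; exists d => // w /H.
by rewrite -NN; congr (N _ <= _); ring.
Qed.

Lemma cderB f g z a b : cder f z a -> cder g z b ->
  cder (fun w => f w - g w) z (a - b).
Proof. by move=> df /cderN; apply: cderD. Qed.

Lemma cder_comp f g z a b : cder f z a -> cder g (f z) b ->
  cder (fun w => g (f w)) z (b * a).
Proof.
move=> df dg e e0.
have a1 : 0 < 1 + N a by have := N_ge0 a; lra.
have b1 : 0 < 1 + N b by have := N_ge0 b; lra.
have [d1 d10 H1] := df 1 ltr01.
have [d2 d20 H2] := dg (e / (2 * (1 + N a))) (divr_gt0 e0 (mulr_gt0 (ltr0Sn _ 1) a1)).
have [d3 d30 H3] := cder_cont df d20.
have [d4 d40 H4] := df (e / (2 * (1 + N b))) (divr_gt0 e0 (mulr_gt0 (ltr0Sn _ 1) b1)).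
exists (Num.min d1 (Num.min d3 d4)); first by rewrite !lt_min d10 d30.
move=> w; rewrite !lt_min => /andP[/H1 h1 /andP[/H3/H2 h2 /H4 h4]].
have -> : g (f w) - g (f z) - b * a * (w - z) =
  (g (f w) - g (f z) - b * (f w - f z)) + b * (f w - f z - a * (w - z)) by ring.
apply: le_trans (ND _ _) _; rewrite NM.
have dwz := N_ge0 (w - z).
have fwz : N (f w - f z) <= (1 + N a) * N (w - z).
  rewrite -[f w - f z](subrK (a * (w - z))).
  by apply: le_trans (ND _ _) _; rewrite NM; lra.
have K1 : e / (2 * (1 + N a)) * (1 + N a) = e / 2 by field; rewrite gt_eqF.
have K2 : e / (2 * (1 + N b)) * (1 + N b) = e / 2 by field; rewrite gt_eqF.
have t1 : N (g (f w) - g (f z) - b * (f w - f z)) <= e / 2 * N (w - z).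
  apply: le_trans h2 _; rewrite -K1 -[X in _ <= X]mulrA; apply: ler_wpM2l => //.
  by rewrite divr_ge0 ?ltW// mulr_gt0.
have t2 : N b * N (f w - f z - a * (w - z)) <= e / 2 * N (w - z).
  rewrite -K2 [X in _ <= X * _]mulrC -[X in _ <= X]mulrA; apply: ler_pM h4; rewrite ?N_ge0//.
  by rewrite lerDr.
lra.
Qed.

Lemma cder_inv z : z != 0 -> cder (fun w => w^-1) z (- z ^- 2).
Proof.
move=> z0 e e0; have Nz : 0 < N z by rewrite N_gt0.
exists (Num.min (N z / 2) (e * N z ^+ 3 / 2)).
  by rewrite lt_min !divr_gt0// mulr_gt0// exprn_gt0.
move=> w; rewrite lt_min => /andP[w1 w2].
have Nw : N z / 2 <= N w by have := NBB z (z - w); rewrite subKr distNC; lra.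
have w0 : w != 0 by rewrite -N_gt0; lra.
have -> : w^-1 - z^-1 - - z ^- 2 * (w - z) = (w - z) ^+ 2 / (w * z ^+ 2).
  by field; rewrite w0 z0.
have Nwp : 0 < N w by rewrite N_gt0.
rewrite !NM NV NM !NX ler_pdivrMr ?mulr_gt0 ?exprn_gt0//.
have dwz := N_ge0 (w - z).
rewrite expr2 [X in _ <= X]mulrAC ler_wpM2r//.
apply: le_trans (ltW w2) _.
have -> : e * N z ^+ 3 / 2 = e * (N z / 2 * N z * N z) by field.
apply: ler_wpM2l; first exact: ltW.
rewrite ?mulrA; do 2!(apply: ler_wpM2r; first exact: ltW).
by [].
Qed.

Lemma cderV f z a : cder f z a -> f z != 0 ->
  cder (fun w => (f w)^-1) z (- f z ^- 2 * a).
Proof. by move=> df f0; exact: cder_comp df (cder_inv f0). Qed.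

Lemma cderX f z a n : cder f z a -> exists b, cder (fun w => f w ^+ n) z b.
Proof.
move=> df; elim: n => [|n [b IH]]; first by exists 0; exact: cder_cst.
exists (a * f z ^+ n + f z * b).
by apply: cder_ext (cderM df IH) => w; rewrite exprS.
Qed.

Lemma cder_horner (p : {poly R[i]}) z : cder (fun w => p.[w]) z (p^`()).[z].
Proof.
elim/poly_ind: p => [|p c IH].
  by rewrite deriv0 horner0; apply: cder_ext (cder_cst 0 z) => w; rewrite horner0.
have H := cderD (cderM IH (cder_id z)) (cder_cst c z).
have -> : ((p * 'X + c%:P)^`()).[z] = p^`().[z] * z + p.[z] * 1 + 0.
  by rewrite derivMXaddC !hornerE addrC.
by apply: cder_ext H => w; rewrite !hornerE.
Qed.

Lemma derivableP f z : derivable f z 1 <-> exists c, cder f z c.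
Proof.
split=> [|[c dfc]].
  rewrite /derivable => /cvg_ex[c fc]; exists c => e e0.
  have : nbhs c [set w | N (w - c) < e] by apply/nbhsN; exists e.
  move=> /fc; rewrite /nbhs /= /dnbhs /within /= => /nbhsN[d d0 H].
  exists d => // w wd; have [->|wz] := eqVneq w z.
    by rewrite !subrr mulr0 subrr N0 mulr0.
  have wz0 : w - z != 0 by rewrite subr_eq0.
  have := H (w - z); rewrite subr0 => /(_ wd wz0).
  rewrite /= [(w - z) *: 1]mulr1 subrK => /ltW h.
  have -> : f w - f z - c * (w - z) =
     ((w - z)^-1 * (f w - f z) - c) * (w - z) by field.
  by rewrite NM ler_wpM2r ?N_ge0.
rewrite /derivable; apply/cvg_ex; exists c => U /nbhsN[e e0 eU].
have e2 : 0 < e / 2 by rewrite divr_gt0.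
have [d d0 H] := dfc _ e2.
rewrite /nbhs /= /dnbhs /within /=; apply/nbhsN; exists d => // h.
rewrite subr0 => hd h0; apply: eU; rewrite [h *: 1]mulr1.
have := H (h + z); rewrite addrK => /(_ hd) h1.
have -> : h^-1 *: (f (h + z) - f z) - c = (f (h + z) - f z - c * h) / h.
  by rewrite mulrBl mulfK// mulrC.
rewrite NM NV ltr_pdivrMr ?N_gt0//; apply: le_lt_trans h1 _.
by rewrite ltr_pM2r ?N_gt0//; lra.
Qed.

End ComplexDerivative.

(** * Nested squares *)

Section Bisection.
Context {R : realType}.

Let half (s s' : R * R * R) := [/\ s'.2 = s.2 / 2,
  s'.1.1 = s.1.1 \/ s'.1.1 = s.1.1 + s.2 / 2 &
  s'.1.2 = s.1.2 \/ s'.1.2 = s.1.2 + s.2 / 2].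

(** If [P] failed, some quarter would fail at every scale, and the nested bad squares would shrink
    to a point contradicting the local hypothesis. That hypothesis concerns small squares containing
    the point, not only those centred at it. One-dimensional arguments use a dummy second
    coordinate. *)
Lemma bisection (P : R -> R -> R -> Prop) (x0 y0 d0 : R) : 0 < d0 ->
  (forall x y d, 0 < d -> P x y (d / 2) -> P (x + d / 2) y (d / 2) ->
    P x (y + d / 2) (d / 2) -> P (x + d / 2) (y + d / 2) (d / 2) -> P x y d) ->
  (forall x1 y1, x0 <= x1 <= x0 + d0 -> y0 <= y1 <= y0 + d0 ->
    exists2 e, 0 < e & forall x y d, 0 < d < e ->
      x <= x1 <= x + d -> y <= y1 <= y + d ->
      x0 <= x -> x + d <= x0 + d0 -> y0 <= y -> y + d <= y0 + d0 -> P x y d) ->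
  P x0 y0 d0.
Proof.
move=> d00 Psub Ploc; apply: contrapT => nP.
have [f Hf] : {f : R * R * R -> R * R * R & forall s,
    0 < s.2 -> ~ P s.1.1 s.1.2 s.2 -> half s (f s) /\ ~ P (f s).1.1 (f s).1.2 (f s).2}.
  apply: (@choice _ _ (fun s s' => 0 < s.2 -> ~ P s.1.1 s.1.2 s.2 ->
     half s s' /\ ~ P s'.1.1 s'.1.2 s'.2)) => -[[x y] d] /=.
  have [d_gt0|] := boolP (0 < d); last by exists (x, y, d).
  have [|nPs] := pselect (P x y d); first by exists (x, y, d).
  have [p1|] := pselect (P x y (d / 2)); last first.
    by exists (x, y, d / 2); split => //; split; rewrite /=; auto.
  have [p2|] := pselect (P (x + d / 2) y (d / 2)); last first.
    by exists (x + d / 2, y, d / 2); split => //; split; rewrite /=; auto.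
  have [p3|] := pselect (P x (y + d / 2) (d / 2)); last first.
    by exists (x, y + d / 2, d / 2); split => //; split; rewrite /=; auto.
  have [p4|] := pselect (P (x + d / 2) (y + d / 2) (d / 2)); last first.
    by exists (x + d / 2, y + d / 2, d / 2); split => //; split; rewrite /=; auto.
  by exfalso; apply/nPs/Psub.
pose s n := iter n f (x0, y0, d0).
have sP n : 0 < (s n).2 /\ ~ P (s n).1.1 (s n).1.2 (s n).2.
  elim: n => [//|n [p1 p2]]; have [[h1 _ _] h2] := Hf _ p1 p2.
  by split; rewrite /s iterS// h1 divr_gt0.
have sH n : half (s n) (s n.+1).
  by have [p1 p2] := sP n; have [h _] := Hf _ p1 p2; rewrite /s iterS.
have sd n : (s n).2 = d0 / 2 ^+ n.
  elim: n => [|n IH]; first by rewrite expr0 divr1.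
  by have [-> _ _] := sH n; rewrite IH exprS; field; rewrite expf_neq0.
pose c1 n := (s n).1.1; pose c2 n := (s n).1.2.
have mono (c : nat -> R) : (forall n, c n.+1 = c n \/ c n.+1 = c n + (s n).2 / 2) ->
    forall m n, (m <= n)%N -> c m <= c n /\ c n + (s n).2 <= c m + (s m).2.
  move=> Hc m n; elim: n => [|n IH]; first by rewrite leqn0 => /eqP ->.
  rewrite leq_eqVlt => /predU1P[<-//|]; rewrite ltnS => /IH[h1 h2].
  by have [p1 _] := sP n; have [-> _ _] := sH n; case: (Hc n) => ->; lra.
have lim (c : nat -> R) : (forall n, c n.+1 = c n \/ c n.+1 = c n + (s n).2 / 2) ->
    exists l, forall n, c n <= l <= c n + (s n).2.
  move=> Hc; have M := mono _ Hc.
  have ub n k : c k <= c n + (s n).2.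
    have [p1 _] := sP (maxn n k).
    have [_ h1] := M n (maxn n k) (leq_maxl _ _).
    by have [h2 _] := M k (maxn n k) (leq_maxr _ _); lra.
  exists (sup (range c)) => n; apply/andP; split.
    apply: ub_le_sup; last by exists n.
    by exists (c 0 + (s 0).2)%R => _ [k _ <-]; exact: ub.
  by apply: ge_sup => [|_ [k _ <-]]; [exists (c 0); exists 0|exact: ub].
have H1 n : c1 n.+1 = c1 n \/ c1 n.+1 = c1 n + (s n).2 / 2 by have [] := sH n.
have H2 n : c2 n.+1 = c2 n \/ c2 n.+1 = c2 n + (s n).2 / 2 by have [] := sH n.
have [l1 L1] := lim _ H1; have [l2 L2] := lim _ H2.
have [e e0 He] := Ploc l1 l2 (L1 0) (L2 0).
have [n Hn] : exists n, d0 / 2 ^+ n < e.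
  have := @cvg_geometric R d0 (2^-1).
  rewrite ger0_norm ?invr_ge0// invf_lt1// ltr1n => /(_ isT).
  move=> /cvgrPdist_lt /(_ _ e0)[n _ /(_ n (leqnn n))] /=.
  rewrite sub0r normrN ger0_norm /geometric/= ?exprVn => [h|]; first by exists n.
  by rewrite mulr_ge0 ?invr_ge0 ?exprn_ge0// ltW.
have [p1 p2] := sP n; apply: p2; apply: He.
- by rewrite p1 sd.
- exact: L1.
- exact: L2.
- by have [] := mono _ H1 0 n (leq0n _).
- by have [] := mono _ H1 0 n (leq0n _).
- by have [] := mono _ H2 0 n (leq0n _).
- by have [] := mono _ H2 0 n (leq0n _).
Qed.

End Bisection.

(** * Midpoint sums along segments and squares *)

Section RiemannSums.
Context {R : realType}.
Implicit Types (f g : R[i] -> R[i]) (z w a v c h k : R[i]) (d e B t : R).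

(* Midpoint sums with 2^n nodes on the segment from [a] to [a + v] replace contour
   integrals: they are exact on affine functions. *)
Fixpoint rsum n g a v : R[i] := if n is n.+1
  then rsum n g a (v / 2) + rsum n g (a + v / 2) (v / 2)
  else g (a + v / 2) * v.

Lemma rsum_affine n (b c a v : R[i]) :
  rsum n (fun z => b + c * z) a v = (b + c * (a + v / 2)) * v.
Proof. by elim: n a v => [//|n IH] a v /=; rewrite !IH; field. Qed.

Lemma rsumZ n c g a v : rsum n (fun z => c * g z) a v = c * rsum n g a v.
Proof. by elim: n a v => [|n IH] a v /=; rewrite ?mulrA// !IH; ring. Qed.

Lemma rsumB n f g a v : rsum n (fun z => f z - g z) a v = rsum n f a v - rsum n g a v.
Proof. by elim: n a v => [|n IH] a v /=; rewrite ?mulrBl// !IH; ring. Qed.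

Lemma rsum_rev n g a v : rsum n g (a + v) (- v) = - rsum n g a v.
Proof.
elim: n a v => [|n IH] a v /=.
  by rewrite mulrN; congr (- (g _ * _)); field.
have -> : - v / 2 = - (v / 2) by rewrite mulNr.
have -> : a + v = a + v / 2 + v / 2 by field.
by rewrite IH addrK IH opprD addrC.
Qed.

Lemma rsum_shift n g c a v : rsum n (fun z => g (z - c)) a v = rsum n g (a - c) v.
Proof.
elim: n a v => [|n IH] a v /=; first by congr (g _ * _); ring.
by rewrite !IH; congr (_ + rsum n g _ _); ring.
Qed.

(** The form dz/z is invariant under dilation and rotation, here exactly and before any limit, so
    the sides of a square centred at 0 can be compared with one another. *)
Lemma rsum_inv_scale n c a v : c != 0 ->
  rsum n (fun z => z^-1) (c * a) (c * v) = rsum n (fun z => z^-1) a v.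
Proof.
move=> c0; elim: n a v => [|n IH] a v /=.
  have -> : c * a + c * v / 2 = c * (a + v / 2) by rewrite mulrDr mulrA.
  by rewrite invfM mulrACA mulVf// mul1r.
by rewrite -!mulrA -mulrDr !IH.
Qed.

Lemma rsum_bound n g a v B :
  (forall t, 0 <= t <= 1 -> N (g (a + t%:C * v)) <= B) ->
  N (rsum n g a v) <= B * N v.
Proof.
elim: n a v => [|n IH] a v H /=.
  rewrite NM ler_wpM2r ?N_ge0//.
  have := H (2^-1); rewrite fmorphV rmorph_nat mulrC; apply.
  by rewrite invr_ge0 ler0n invf_le1// ler1n.
have -> : B * N v = B * N (v / 2) + B * N (v / 2).
  rewrite NM NV.
  have -> : N (2%:R : R[i]) = 2 by rewrite -[2%:R](rmorph_nat (real_complex R)) N_real ger0_norm.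
  by field.
apply: le_trans (ND _ _) _; apply: lerD; apply: IH => t /andP[t0 t1].
  have -> : t%:C * (v / 2) = (t / 2)%:C * v by rewrite rmorphM fmorphV rmorph_nat; ring.
  by apply: H; lra.
have -> : a + v / 2 + t%:C * (v / 2) = a + ((1 + t) / 2)%:C * v.
  by rewrite rmorphM fmorphV rmorph_nat rmorphD rmorph1; ring.
by apply: H; lra.
Qed.

Lemma eq_rsum n f g a v :
  (forall t, 0 <= t <= 1 -> f (a + t%:C * v) = g (a + t%:C * v)) ->
  rsum n f a v = rsum n g a v.
Proof.
move=> fg; apply/eqP; rewrite -subr_eq0 -N_eq0 -rsumB eq_le N_ge0 andbT.
rewrite -[X in _ <= X](mul0r (N v)); apply: rsum_bound => t /fg ->.
by rewrite subrr N0.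
Qed.

Definition sqsum n g a h k :=
  rsum n g a h + rsum n g (a + h) k - rsum n g (a + k) h - rsum n g a k.

(** The inner edges of the four quarters carry the same nodes with opposite signs and cancel
    exactly. *)
Lemma sqsumS n g a h k : sqsum n.+1 g a h k =
  sqsum n g a (h / 2) (k / 2) + sqsum n g (a + h / 2) (h / 2) (k / 2) +
  sqsum n g (a + k / 2) (h / 2) (k / 2) + sqsum n g (a + h / 2 + k / 2) (h / 2) (k / 2).
Proof.
rewrite /sqsum /=.
have -> : a + h / 2 + h / 2 = a + h by field.
have -> : a + k / 2 + k / 2 = a + k by field.
have -> : a + h + k / 2 = a + h / 2 + k / 2 + h / 2 by field.
have -> : a + k + h / 2 = a + h / 2 + k / 2 + k / 2 by field.
have -> : a + k / 2 + h / 2 = a + h / 2 + k / 2 by field.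
by ring.
Qed.

Lemma sqsum_affine n b c a h k : sqsum n (fun z => b + c * z) a h k = 0.
Proof. by rewrite /sqsum !rsum_affine; field. Qed.

Lemma sqsumB n f g a h k :
  sqsum n (fun z => f z - g z) a h k = sqsum n f a h k - sqsum n g a h k.
Proof. by rewrite /sqsum !rsumB; ring. Qed.

Definition cell x y d : set R[i] :=
  [set z | x <= complex.Re z <= x + d /\ y <= complex.Im z <= y + d].

Definition cellsum n g x y d := sqsum n g (x +i* y) d%:C (0 +i* d).

Lemma cell_edges x y d t : 0 <= d -> 0 <= t <= 1 ->
  [/\ cell x y d ((x +i* y) + t%:C * d%:C),
      cell x y d ((x +i* y) + d%:C + t%:C * (0 +i* d)),
      cell x y d ((x +i* y) + (0 +i* d) + t%:C * d%:C) &
      cell x y d ((x +i* y) + t%:C * (0 +i* d))].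
Proof. by move=> d0 /andP[t0 t1]; split; rewrite /cell /=; split; nra. Qed.

Lemma cellsum_bound n g x y d B : 0 <= d ->
  (forall z, cell x y d z -> N (g z) <= B) ->
  N (cellsum n g x y d) <= 4 * B * d.
Proof.
move=> d0 H; rewrite /cellsum /sqsum.
have E t : 0 <= t <= 1 -> _ := cell_edges x y d0.
have b1 : N (rsum n g (x +i* y) d%:C) <= B * N d%:C.
  by apply: rsum_bound => t /E[/H].
have b2 : N (rsum n g (x +i* y + d%:C) (0 +i* d)) <= B * N (0 +i* d).
  by apply: rsum_bound => t /E[_ /H].
have b3 : N (rsum n g (x +i* y + (0 +i* d)) d%:C) <= B * N d%:C.
  by apply: rsum_bound => t /E[_ _ /H].
have b4 : N (rsum n g (x +i* y) (0 +i* d)) <= B * N (0 +i* d).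
  by apply: rsum_bound => t /E[_ _ _ /H].
rewrite N_real in b1 b3; rewrite N_imag in b2 b4; rewrite !ger0_norm// in b1 b2 b3 b4.
apply: le_trans (NB _ _) _; apply: le_trans (lerD (NB _ _) (lexx _)) _.
apply: le_trans (lerD (lerD (ND _ _) (lexx _)) (lexx _)) _; lra.
Qed.

Lemma cellsumS n g x y d : cellsum n.+1 g x y d =
  cellsum n g x y (d / 2) + cellsum n g (x + d / 2) y (d / 2) +
  cellsum n g x (y + d / 2) (d / 2) + cellsum n g (x + d / 2) (y + d / 2) (d / 2).
Proof.
rewrite /cellsum sqsumS.
have -> : d%:C / 2 = (d / 2)%:C :> R[i] by rewrite rmorphM fmorphV rmorph_nat.
have -> : (0 +i* d) / 2 = (0 +i* (d / 2)) :> R[i].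
  have -> : (0 +i* d) = d%:C * 'i :> R[i] by ceq; ring.
  have -> : (0 +i* (d / 2)) = (d / 2)%:C * 'i :> R[i].
    by ceq; ring.
  by rewrite rmorphM fmorphV rmorph_nat; ring.
have e1 (b b' e e' : R) : (b +i* b') + (e +i* e') = (b + e) +i* (b' + e') by [].
by rewrite /real_complex_def !e1 !addr0.
Qed.

Lemma cell_diam x y d z w : 0 <= d -> cell x y d z -> cell x y d w -> N (z - w) <= 2 * d.
Proof.
move=> d0 [/andP[a1 a2] /andP[a3 a4]] [/andP[b1 b2] /andP[b3 b4]].
apply: le_trans (N_ReIm _) _; rewrite ReB ImB.
have n1 : `|complex.Re z - complex.Re w| <= d by rewrite ler_norml; apply/andP; split; lra.
have n2 : `|complex.Im z - complex.Im w| <= d by rewrite ler_norml; apply/andP; split; lra.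
lra.
Qed.

End RiemannSums.

(** * Goursat's lemma and the fundamental theorem of calculus *)

Section Goursat.
Context {R : realType}.
Implicit Types (f g : R[i] -> R[i]) (z w a v c : R[i]) (x y d e t : R).

(** [Num.sqrt] vanishes on negative arguments, so this is the signed square root of [t - t0]:
    nondecreasing, and steep exactly at [t0]. *)
Let psi (t0 t : R) := Num.sqrt (t - t0) - Num.sqrt (t0 - t).

Let psi_homo t0 : {homo psi t0 : x y / x <= y}.
Proof. by move=> x y xy; rewrite /psi lerB// ler_wsqrtr//; lra. Qed.

Let psi_at t0 x d : x <= t0 <= x + d -> Num.sqrt d <= psi t0 (x + d) - psi t0 x.
Proof.
move=> /andP[h1 h2]; rewrite /psi.
have -> : Num.sqrt (t0 - (x + d)) = 0 by apply: ler0_sqrtr; lra.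
have -> : Num.sqrt (x - t0) = 0 by apply: ler0_sqrtr; lra.
rewrite subr0 sub0r opprK.
rewrite -(@ler_pXn2r _ 2)// ?nnegrE ?addr_ge0 ?sqrtr_ge0// sqrrD !sqr_sqrtr; [|lra..].
have : 0 <= Num.sqrt (x + d - t0) * Num.sqrt (t0 - x) by rewrite mulr_ge0 ?sqrtr_ge0.
rewrite mulr2n; lra.
Qed.

(* The exceptional point only has to be a point of continuity: the weight
   [Dpsi_x * Dpsi_y] is additive under subdivision but at least [d] on every
   square of side [d] containing it, which absorbs a bound of order [d]. *)
Lemma cellsum_cvg0 g z0 x0 y0 d0 : 0 < d0 ->
  (forall z, cell x0 y0 d0 z -> z <> z0 -> exists c, cder g z c) ->
  (cell x0 y0 d0 z0 -> ccont g z0) ->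
  forall e, 0 < e -> exists n0, forall n, (n0 <= n)%N -> N (cellsum n g x0 y0 d0) <= e.
Proof.
move=> d00 dg cg e e0.
pose q1 := psi (complex.Re z0); pose q2 := psi (complex.Im z0).
pose b x y d := (q1 (x + d) - q1 x) * (q2 (y + d) - q2 y).
have b0 x y d : 0 <= d -> 0 <= b x y d.
  by move=> d_ge0; rewrite /b mulr_ge0// subr_ge0 psi_homo// lerDl.
have B0 : 0 < d0 ^+ 2 + b x0 y0 d0 by have := b0 x0 y0 d0 (ltW d00); nra.
pose eta := e / (d0 ^+ 2 + b x0 y0 d0).
have eta0 : 0 < eta by rewrite divr_gt0.
have eE : e = eta * (d0 ^+ 2 + b x0 y0 d0) by rewrite /eta divfK// gt_eqF.
rewrite eE.
(* The bound is [eta] times area plus weight. It is additive under quartering and equals [e] on the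
   whole square, so it only has to be checked on small squares. *)
apply: (@bisection _ (fun x y d => exists n0, forall n, (n0 <= n)%N ->
  N (cellsum n g x y d) <= eta * (d ^+ 2 + b x y d))) => //.
  move=> x y d d_gt0 [n1 H1] [n2 H2] [n3 H3] [n4 H4].
  exists (maxn (maxn n1 n2) (maxn n3 n4)).+1 => -[//|n].
  rewrite ltnS !geq_max => /andP[/andP[/H1 h1 /H2 h2] /andP[/H3 h3 /H4 h4]].
  rewrite cellsumS; apply: le_trans (ND _ _) _.
  apply: le_trans (lerD (ND _ _) (lexx _)) _.
  apply: le_trans (lerD (lerD (ND _ _) (lexx _)) (lexx _)) _.
  have E t : t + d / 2 + d / 2 = t + d by lra.
  apply: le_trans (lerD (lerD (lerD h1 h2) h3) h4) _.
  by rewrite /b !E; lra.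
move=> x1 y1 /andP[X1 X2] /andP[Y1 Y2].
have [ze|ze] := eqVneq (x1 +i* y1) z0.
  have /cg/(_ (eta / 4) (divr_gt0 eta0 _)) : cell x0 y0 d0 z0.
    by rewrite -ze; split; rewrite /= ?X1 ?X2 ?Y1 ?Y2.
  move=> /(_ (ltr0Sn _ 3))[d d_gt0 H]; exists (d / 2); first by rewrite divr_gt0.
  move=> x y r /andP[r0 rd] x1r y1r _ _ _ _; exists 0 => n _.
  have z0c : cell x y r z0 by rewrite -ze; split.
  have -> : cellsum n g x y r = cellsum n (fun z => g z - (g z0 + 0 * z)) x y r.
    by rewrite [RHS]/cellsum sqsumB sqsum_affine subr0.
  have : N (cellsum n (fun z => g z - (g z0 + 0 * z)) x y r) <= 4 * (eta / 4) * r.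
    apply: cellsum_bound; first exact: ltW.
    move=> z /(@cell_diam _ _ _ _ _ _ (ltW r0)) /(_ z0c) zz0.
    by rewrite mul0r addr0 ltW// H//; lra.
  move=> /le_trans; apply.
  have -> : 4 * (eta / 4) * r = eta * r by field.
  rewrite ler_pM2l//.
  have : r <= b x y r; last by nra.
  rewrite -[X in X <= _](@sqr_sqrtr _ r (ltW r0)) expr2 /b.
  have p1 : Num.sqrt r <= q1 (x + r) - q1 x by apply: psi_at; rewrite -ze.
  have p2 : Num.sqrt r <= q2 (y + r) - q2 y by apply: psi_at; rewrite -ze.
  by have := ler_pM (sqrtr_ge0 r) (sqrtr_ge0 r) p1 p2.
have [|c dgc] := dg (x1 +i* y1) _ (elimN eqP ze).
  by split; rewrite /= ?X1 ?X2 ?Y1 ?Y2.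
have eta8 : 0 < eta / 8 by rewrite divr_gt0.
have [d d_gt0 H] := dgc _ eta8.
exists (d / 2); first by rewrite divr_gt0.
move=> x y r /andP[r0 rd] x1r y1r _ _ _ _; exists 0 => n _.
set z1 := x1 +i* y1.
have z1c : cell x y r z1 by split.
(* Away from [z0] the affine part of [g] at [z1] drops out. The remainder is at most
   [eta / 8 * (2 * r)] on the square, which gives [eta * r ^+ 2] in total and is paid for by the
   area term. *)
have -> : cellsum n g x y r =
    cellsum n (fun z => g z - ((g z1 - c * z1) + c * z)) x y r.
  by rewrite [RHS]/cellsum sqsumB sqsum_affine subr0.
have : N (cellsum n (fun z => g z - ((g z1 - c * z1) + c * z)) x y r)
    <= 4 * (eta / 8 * (2 * r)) * r.
  apply: cellsum_bound; first exact: ltW.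
  move=> z /(@cell_diam _ _ _ _ _ _ (ltW r0)) /(_ z1c) zz1.
  have -> : g z - (g z1 - c * z1 + c * z) = g z - g z1 - c * (z - z1) by ring.
  apply: le_trans (H _ _) _; first lra.
  by rewrite ler_pM2l.
move=> /le_trans; apply.
have := b0 x y r (ltW r0); nra.
Qed.

(** The error bound [e * d] is additive along the segment, so bisection reduces the claim to short
    pieces, on which [f] is compared with its affine approximation at one point. *)
Lemma rsum_cvg f g a v :
  (forall t, 0 <= t <= 1 -> cder f (a + t%:C * v) (g (a + t%:C * v))) ->
  (forall t, 0 <= t <= 1 -> ccont g (a + t%:C * v)) ->
  forall e, 0 < e -> exists n0, forall n, (n0 <= n)%N ->
    N (f (a + v) - f a - rsum n g a v) <= e.
Proof.
move=> df cg e e0.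
suff : exists n0, forall n, (n0 <= n)%N ->
    N (f (a + (0 + 1)%:C * v) - f (a + 0%:C * v) - rsum n g (a + 0%:C * v) (1%:C * v)) <= e * 1.
  by rewrite add0r rmorph1 rmorph0 mul0r mul1r addr0 mulr1.
apply: (@bisection _ (fun x _ d => exists n0, forall n, (n0 <= n)%N ->
    N (f (a + (x + d)%:C * v) - f (a + x%:C * v) - rsum n g (a + x%:C * v) (d%:C * v))
      <= e * d) 0 0 1) => //.
  move=> x y d d0 [n1 H1] [n2 H2] _ _.
  exists (maxn n1 n2).+1 => -[//|n]; rewrite ltnS geq_max => /andP[/H1 h1 /H2 h2] /=.
  have -> : d%:C * v / 2 = (d / 2)%:C * v by rewrite rmorphM fmorphV rmorph_nat; ring.
  have -> : a + x%:C * v + (d / 2)%:C * v = a + (x + d / 2)%:C * v.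
    by rewrite rmorphD; ring.
  have E : x + d / 2 + d / 2 = x + d by lra.
  rewrite E in h2.
  have e2 : e * d = e * (d / 2) + e * (d / 2) by field.
  rewrite e2; apply: le_trans (lerD h1 h2); apply: le_trans (ND _ _).
  by rewrite le_eqVlt; apply/orP; left; apply/eqP; congr (N _); ring.
move=> t y1 t01 _; set z1 := a + t%:C * v.
have v0 : 0 < N v + 1 by have := N_ge0 v; lra.
have eta0 : 0 < e / 2 / (N v + 1) by rewrite !divr_gt0.
have t01' : 0 <= t <= 1 by rewrite add0r in t01.
have [d1 d10 H1] := df t t01' _ eta0.
have [d2 d20 H2] := cg t t01' _ eta0.
exists (Num.min d1 d2 / (N v + 1)); first by rewrite divr_gt0// lt_min d10.
move=> x y d /andP[d0]; rewrite ltr_pdivlMr// lt_min => /andP[dd1 dd2] /andP[xt td] _ _ _ _ _.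
exists 0 => n _.
have Z s : x <= s <= x + d -> N (a + s%:C * v - z1) <= d * N v.
  move=> /andP[xs sd]; rewrite /z1.
  have -> : a + s%:C * v - (a + t%:C * v) = (s - t)%:C * v by rewrite rmorphB; ring.
  by rewrite NM N_real ler_wpM2r ?N_ge0// ler_norml; lra.
have dv : d * N v < d * (N v + 1) by rewrite ltr_pM2l// ltrDl.
have Z1 s : x <= s <= x + d -> N (a + s%:C * v - z1) < d1.
  by move=> /Z h; apply: le_lt_trans h _; lra.
have Z2 s : x <= s <= x + d -> N (a + s%:C * v - z1) < d2.
  by move=> /Z h; apply: le_lt_trans h _; lra.
have x1 : x <= x + d <= x + d by lra.
have x2 : x <= x <= x + d by lra.
have a1 := H1 _ (Z1 _ x1); have a2 := H1 _ (Z1 _ x2).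
rewrite -/z1 in a1 a2.
have a3 : N (rsum n (fun z => g z - (g z1 + 0 * z)) (a + x%:C * v) (d%:C * v))
    <= e / 2 / (N v + 1) * N (d%:C * v).
  apply: rsum_bound => s /andP[s0 s1].
  have -> : a + x%:C * v + s%:C * (d%:C * v) = a + (x + s * d)%:C * v.
    by rewrite rmorphD rmorphM; ring.
  rewrite mul0r addr0 ltW//; apply: H2; apply: Z2; nra.
rewrite rsumB rsum_affine in a3.
have K : e / 2 / (N v + 1) * (d * N v) <= e / 2 * d.
  rewrite -mulrA ler_pM2l ?divr_gt0// mulrC ler_pdivrMr//; lra.
have [z1' z2'] := (Z _ x1, Z _ x2).
(* the affine approximation at z1, exact for the midpoint sum *)
have -> : f (a + (x + d)%:C * v) - f (a + x%:C * v) - rsum n g (a + x%:C * v) (d%:C * v) =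
  (f (a + (x + d)%:C * v) - f z1 - g z1 * (a + (x + d)%:C * v - z1))
  - (f (a + x%:C * v) - f z1 - g z1 * (a + x%:C * v - z1))
  - (rsum n g (a + x%:C * v) (d%:C * v) -
     (g z1 + 0 * (a + x%:C * v + d%:C * v / 2)) * (d%:C * v)).
  by rewrite rmorphD; ring.
apply: le_trans (NB _ _) _; apply: le_trans (lerD (NB _ _) (lexx _)) _.
rewrite NM N_real (ger0_norm (ltW d0)) in a3.
have a1' : N (a + (x + d)%:C * v - z1) = (x + d - t) * N v.
  have -> : a + (x + d)%:C * v - z1 = (x + d - t)%:C * v by rewrite /z1 !(rmorphB, rmorphD); ring.
  by rewrite NM N_real ger0_norm//; lra.
have a2' : N (a + x%:C * v - z1) = (t - x) * N v.
  have -> : a + x%:C * v - z1 = - ((t - x)%:C * v) by rewrite /z1 !(rmorphB, rmorphD); ring.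
  by rewrite NN NM N_real ger0_norm//; lra.
rewrite a1' in a1; rewrite a2' in a2; lra.
Qed.

Lemma mean_value_le f g a v B :
  (forall t, 0 <= t <= 1 -> cder f (a + t%:C * v) (g (a + t%:C * v))) ->
  (forall t, 0 <= t <= 1 -> ccont g (a + t%:C * v)) ->
  (forall t, 0 <= t <= 1 -> N (g (a + t%:C * v)) <= B) ->
  N (f (a + v) - f a) <= B * N v.
Proof.
move=> df cg gB; apply/ler_addgt0Pr => e e0.
have [n /(_ n (leqnn n)) H] := rsum_cvg df cg e0.
rewrite -[f (a + v) - f a](subrK (rsum n g a v)).
apply: le_trans (ND _ _) _; rewrite addrC lerD//; exact: rsum_bound.
Qed.

End Goursat.

(** * The principal logarithm and complex powers *)

Section Logarithm.
Context {R : realType}.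
Implicit Types (z w : R[i]) (x y d e t : R).

Lemma slit_planeE z : slit_plane z <-> complex.Im z != 0 \/ 0 < complex.Re z.
Proof.
split=> [sz|[iz [x] _ xz|rz [x]]].
- have [iz|] := eqVneq (complex.Im z) 0; last by left.
  right; rewrite ltNge; apply/negP => rz; apply: sz; exists (complex.Re z).
    by rewrite /= in_itv.
  by rewrite [z in RHS]complex_split iz; ceq; rewrite /= ?addr0.
- by move: iz; rewrite -xz /= eqxx.
- by rewrite /= in_itv /= => x0 xz; move: rz; rewrite -xz /=; lra.
Qed.

Lemma slit_neq0 z : slit_plane z -> z != 0.
Proof.
move=> /slit_planeE h; apply/eqP => z0; move: h; rewrite z0 /= eqxx ltxx.
by case.
Qed.

Lemma Re_div_N z : z != 0 -> -1 <= complex.Re z / N z <= 1.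
Proof. by case: z => x y; exact: acos_arg_itv. Qed.

Let near_fun (f : R -> R) x : {for x, continuous f} ->
  forall e, 0 < e -> exists2 d, 0 < d & forall y, `|y - x| < d -> `|f y - f x| < e.
Proof.
move=> /cvgrPdist_lt H e e0; have /nbhs_ballP[d d0 D] := H e e0.
exists d => // y yx; rewrite distrC; apply: D.
by rewrite -ball_normE /ball_/= distrC.
Qed.

Let near_deriv (f : R -> R) x l : is_derive x 1 f l ->
  forall e, 0 < e -> exists2 d, 0 < d &
    forall h, `|h| < d -> `|f (x + h) - f x - l * h| <= e * `|h|.
Proof.
move=> [df dl] e e0; move: df; rewrite /derivable => df.
have : (fun h : R => h^-1 *: (f (h *: 1 + x) - f x)) @ 0^' --> l.
  by rewrite -dl.
move=> /cvgrPdist_lt /(_ e e0); rewrite /= /dnbhs /within /= near_withinE.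
move=> /nbhs_ballP[d d0 D]; exists d => // h hd.
have [->|h0] := eqVneq h 0; first by rewrite addr0 mulr0 subrr subr0 normr0 mulr0.
have := D h; rewrite -ball_normE /ball_/= sub0r normrN => /(_ hd h0).
rewrite [h *: 1]mulr1 [h + x]addrC distrC => /ltW.
have -> : f (x + h) - f x - l * h = (h^-1 * (f (x + h) - f x) - l) * h by field.
by rewrite normrM; apply: ler_wpM2r.
Qed.

Let N_cont z : forall e, 0 < e -> forall w, N (w - z) < e -> `|N w - N z| < e.
Proof.
move=> e e0 w; apply: le_lt_trans; rewrite ler_norml; apply/andP; split.
  by have := NBB z w; rewrite distNC; lra.
exact: NBB.
Qed.

Let quot_cont z : z != 0 -> forall e, 0 < e -> exists2 d, 0 < d &
  forall w, N (w - z) < d -> w != 0 /\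
    `|complex.Re w / N w - complex.Re z / N z| < e.
Proof.
move=> z0 e e0; have Nz : 0 < N z by rewrite N_gt0.
exists (Num.min (N z / 2) (e * N z / 4)).
  by rewrite lt_min !divr_gt0// mulr_gt0.
move=> w; rewrite lt_min => /andP[w1 w2].
have Nw : 0 < N w by have := NBB z w; rewrite distNC; lra.
split; first by rewrite -N_gt0.
have -> : complex.Re w / N w - complex.Re z / N z =
   (complex.Re (w - z) + complex.Re w / N w * (N z - N w)) / N z.
  by rewrite ReB; field; rewrite !gt_eqF.
rewrite normrM normfV [`|N z|]ger0_norm ?N_ge0// ltr_pdivrMr//.
apply: le_lt_trans (ler_normD _ _) _; rewrite normrM.
have h1 := N_Re (w - z).
have h2 : `|complex.Re w / N w| <= 1.
  by rewrite ler_norml Re_div_N// -N_gt0.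
have h3 : `|N z - N w| <= N (w - z).
  by rewrite ler_norml; apply/andP; split; [have := NBB w z|have := NBB z w; rewrite distNC]; lra.
have := ler_pM (normr_ge0 _) (normr_ge0 _) h2 h3; nra.
Qed.

Let acos1_near e : 0 < e -> exists2 d, 0 < d &
  forall t, -1 <= t <= 1 -> 1 - d < t -> acos t < e.
Proof.
move=> e0; have [epi|epi] := ltP e pi; last first.
  exists 2 => // t /andP[t1 t2] tt; apply: lt_le_trans (epi).
  by apply: acos_ltpi; apply/andP; split => //; lra.
have ei : e \in `[0, pi] by rewrite in_itv /= (ltW e0) ltW.
exists (1 - cos e).
  rewrite subr_gt0 -(cos0 R) ltr_cos ?in_itv//= ?lexx ?pi_ge0//.
move=> t t1 tt; rewrite ltNge; apply/negP => et.
have [/andP[a1 a2] a3] := acos_def t1.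
have : cos e < cos (acos t) by rewrite a3; move: tt; rewrite subKr.
rewrite ltr_cos ?in_itv/= ?a1 ?a2// => /lt_le_trans/(_ et).
by rewrite ltxx.
Qed.

(** On the positive axis the two branches of [argC] meet at [acos 1 = 0]. Elsewhere the sign of the
    imaginary part is locally constant, and the quotient stays in the open interval on which [acos]
    is continuous. *)
Lemma argC_cont z : slit_plane z -> forall e, 0 < e -> exists2 d, 0 < d &
  forall w, N (w - z) < d -> `|argC w - argC z| < e.
Proof.
move=> sz e e0; have z0 := slit_neq0 sz.
have Nz : 0 < N z by rewrite N_gt0.
have [iz|iz] := eqVneq (complex.Im z) 0.
  have rz : 0 < complex.Re z by move/slit_planeE : sz; rewrite iz eqxx; case.
  have Nzz : N z = complex.Re z.
    apply/eqP; rewrite -(@eqrXn2 _ 2)// ?N_ge0 ?ltW// NP iz; apply/eqP; ring.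
  have q1 : complex.Re z / N z = 1 by rewrite Nzz divff// gt_eqF.
  have az : argC z = 0 by rewrite /argC q1 iz lexx acos1.
  have [d d0 H] := acos1_near e0.
  have [d' d'0 H'] := quot_cont z0 d0.
  exists d' => // w /H'[w0]; rewrite q1 => wd; rewrite az subr0.
  have a1 := Re_div_N w0.
  have : acos (complex.Re w / N w) < e.
    by apply: H => //; move: wd; rewrite ltr_norml; lra.
  have := acos_ge0 a1; rewrite /argC; case: ifP => _ a2 a3; rewrite ?normrN ger0_norm//.
have q1 : -1 < complex.Re z / N z < 1.
  have h : `|complex.Re z| < N z.
    rewrite -(@ltr_pXn2r _ 2)// ?nnegrE ?N_ge0 ?normr_ge0// real_normK ?num_real// NP.
    by rewrite ltrDl exprn_even_gt0.
  by rewrite ltr_pdivlMr// ltr_pdivrMr// mul1r mulN1r -ltr_norml.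
have [d1 d10 H1] := near_fun (continuous_acos q1) e0.
have [d2 d20 H2] := quot_cont z0 d10.
have iz0 : 0 < `|complex.Im z| by rewrite normr_gt0.
exists (Num.min d2 `|complex.Im z|); first by rewrite lt_min d20.
move=> w; rewrite lt_min => /andP[/H2[_ /H1 h1] h2].
have : `|complex.Im w - complex.Im z| < `|complex.Im z|.
  by rewrite -ImB; apply: le_lt_trans (N_Im _) h2.
rewrite /argC; have [zi|zi] := leP 0 (complex.Im z).
  rewrite (ger0_norm zi) ltr_norml => /andP[w1 w2].
  have -> : 0 <= complex.Im w by lra.
  by [].
rewrite (ltr0_norm zi) ltr_norml => /andP[w1 w2].
have -> : 0 <= complex.Im w = false by apply/negbTE; rewrite -ltNge; lra.
by rewrite -opprD normrN.
Qed.

Lemma logC_cont z : slit_plane z -> ccont logC z.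
Proof.
move=> sz e e0; have z0 : 0 < N z by rewrite N_gt0 slit_neq0.
have e2 : 0 < e / 2 by rewrite divr_gt0.
have [d1 d10 H1] := argC_cont sz e2.
have [d2 d20 H2] := near_fun (continuous_ln z0) e2.
exists (Num.min d1 d2); first by rewrite lt_min d10.
move=> w; rewrite lt_min => /andP[/H1 h1 /(N_cont d20)/H2 h2].
by apply: le_lt_trans (N_ReIm _) _; rewrite ReB ImB /=; lra.
Qed.

Lemma expCD z w : expC (z + w) = expC z * expC w.
Proof.
rewrite /expC ReD ImD expRD cosD sinD; ceq => /=; ring.
Qed.

Lemma expC0 : expC (0 : R[i]) = 1.
Proof. by rewrite /expC /= expR0 cos0 sin0; ceq => /=; ring. Qed.

Lemma expC_neq0 z : expC z != 0.
Proof.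
apply/eqP => z0; have := expCD z (- z); rewrite subrr z0 mul0r expC0.
by move/eqP; rewrite oner_eq0.
Qed.

Lemma cder_expC0 : cder (@expC R) 0 1.
Proof.
move=> e e0; pose n := Num.min 1 (e / 6).
have n0 : 0 < n by rewrite lt_min ltr01 divr_gt0.
have n1 : n <= 1 by rewrite ge_min lexx.
have n2 : n <= e / 6 by rewrite ge_min lexx orbT.
have [d1 d10 H1] := near_deriv (is_derive_expR 0) n0.
have [d2 d20 H2] := near_deriv (is_derive_cos 0) n0.
have [d3 d30 H3] := near_deriv (is_derive_sin 0) n0.
exists (Num.min (Num.min d1 d2) (Num.min d3 (n / 2))); first by rewrite !lt_min d10 d20 d30 divr_gt0.
move=> w; rewrite subr0 !lt_min => /andP[/andP[w1 w2] /andP[w3 w4]].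
have := H1 _ (le_lt_trans (N_Re w) w1); have := H2 _ (le_lt_trans (N_Im w) w2).
have := H3 _ (le_lt_trans (N_Im w) w3).
rewrite !add0r expR0 cos0 sin0 subr0 !mul1r oppr0 mul0r subr0.
have rw := N_Re w; have iw := N_Im w; move: rw iw.
set x := complex.Re w; set y := complex.Im w => rw iw s1 s2 s3.
have ex1 : `|expR x - 1| <= n.
  have := ler_normD (expR x - 1 - x) x; rewrite subrK.
  have : n * `|x| <= 1 * `|x| by rewrite ler_wpM2r.
  lra.
have ex2 : `|expR x| <= 2.
  by have := ler_normD (expR x - 1) 1; rewrite subrK normr1; lra.
apply: le_trans (N_ReIm _) _; rewrite expC0 !ReB !ImB /expC /= -/x -/y.
have -> : expR x * cos y - 0 * sin y - 1 - x = expR x * (cos y - 1) + (expR x - 1 - x) by ring.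
have -> : expR x * sin y + 0 * cos y - 0 - y = expR x * (sin y - y) + (expR x - 1) * y by ring.
have t1 := ler_normD (expR x * (cos y - 1)) (expR x - 1 - x).
have t2 := ler_normD (expR x * (sin y - y)) ((expR x - 1) * y).
rewrite !normrM in t1 t2.
have t3 := ler_pM (normr_ge0 _) (normr_ge0 _) ex2 s2.
have t4 := ler_pM (normr_ge0 _) (normr_ge0 _) ex2 s1.
have t5 := ler_pM (normr_ge0 _) (normr_ge0 _) ex1 (lexx `|y|).
have t6 : n * `|x| <= n * N w by rewrite ler_pM2l.
have t7 : n * `|y| <= n * N w by rewrite ler_pM2l.
have t8 : n * N w <= e / 6 * N w by rewrite ler_wpM2r ?N_ge0.
lra.
Qed.

(** With [k = logC w - logC z] one has [w / z = expC k], so the derivative of [expC] at 0 controls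
    [(w - z) / z - k]. Taking [n] at most 1/2 lets [N k] be absorbed and bounded by twice
    [N (w - z) / N z]. *)
Lemma cder_logC z : slit_plane z -> cder logC z z^-1.
Proof.
move=> sz e e0; have z0 := slit_neq0 sz; have Nz : 0 < N z by rewrite N_gt0.
pose n := Num.min 2^-1 (e * N z / 2).
have n0 : 0 < n by rewrite lt_min invr_gt0 ltr0Sn divr_gt0// mulr_gt0.
have n1 : n <= 2^-1 by rewrite ge_min lexx.
have n2 : n <= e * N z / 2 by rewrite ge_min lexx orbT.
have [d1 d10 H1] := cder_expC0 n0.
have [d2 d20 H2] := logC_cont sz d10.
exists (Num.min d2 (N z)); first by rewrite lt_min d20.
move=> w; rewrite lt_min => /andP[/H2 h1 wz].
have w0 : w != 0 by rewrite -N_gt0; have := NBB z w; rewrite distNC; lra.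
set k := logC w - logC z in h1 *.
have := H1 k; rewrite subr0 => /(_ h1); rewrite expC0 mul1r => h2.
have wk : w = z * expC k by rewrite -{1}(expC_logC z0) -expCD addrC subrK expC_logC.
have wzk : (w - z) / z = expC k - 1 by rewrite wk; field.
have -> : k - z^-1 * (w - z) = - (expC k - 1 - k) by rewrite -wzk; ring.
rewrite NN; apply: (le_trans h2).
have : N k <= 2 * (N (w - z) / N z).
  have := NBB k (k - (expC k - 1)); rewrite subKr [N (k - (_ - _))]distNC.
  have -> : N (expC k - 1) = N (w - z) / N z by rewrite -wzk NM NV.
  have : n * N k <= 2^-1 * N k by rewrite ler_wpM2r ?N_ge0.
  lra.
move=> hk; apply: le_trans (ler_pM (ltW n0) (N_ge0 _) n2 hk) _.
by rewrite le_eqVlt; apply/orP; left; apply/eqP; field; rewrite gt_eqF.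
Qed.

(** Compares the branches of the logarithm cut along the two half axes. Their difference jumps by a
    full turn from one half plane to the other, and this jump is what counts gate crossings. *)
Lemma logCN z : complex.Im z != 0 ->
  logC (- z) = logC z - (0 +i* (if 0 < complex.Im z then pi else - pi)).
Proof.
move=> iz; have z0 : z != 0 by apply: contra iz => /eqP ->.
rewrite /logC /argC NN.
have -> : complex.Re (- z) = - complex.Re z by case: (z).
have -> : complex.Im (- z) = - complex.Im z by case: (z).
rewrite mulNr acosN ?Re_div_N// oppr_ge0.
by case: (ltgtP 0 (complex.Im z)) iz => // h _; ceq => /=; ring.
Qed.

Lemma powCD z (a b : R) : powC z (a + b) = powC z a * powC z b.
Proof. by rewrite /powC rmorphD mulrDl expCD. Qed.

Lemma powC0 z : powC z 0 = 1.
Proof. by rewrite /powC rmorph0 mul0r expC0. Qed.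

Lemma powC1 z : z != 0 -> powC z 1 = z.
Proof. by move=> z0; rewrite /powC rmorph1 mul1r expC_logC. Qed.

Lemma powCN z (a : R) : powC z (- a) = (powC z a)^-1.
Proof.
apply: (mulIf (expC_neq0 _ : powC z a != 0)).
by rewrite -powCD addNr powC0 mulVf// expC_neq0.
Qed.

Lemma powCX z (a : R) n : powC z a ^+ n = powC z (a * n%:R).
Proof.
elim: n => [|n IH]; first by rewrite mulr0 powC0 expr0.
by rewrite exprS IH -powCD mulrS mulrDr mulr1.
Qed.

Lemma powC_neq0 z (a : R) : powC z a != 0.
Proof. exact: expC_neq0. Qed.

Lemma N_expC z : N (expC z) = expR (complex.Re z).
Proof.
apply/eqP; rewrite -(@eqrXn2 _ 2)// ?N_ge0 ?expR_ge0// NP /expC /=.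
apply/eqP; have := cos2Dsin2 (complex.Im z).
set c := cos _; set s := sin _; set x := expR _ => cs.
transitivity (x ^+ 2 * (c ^+ 2 + s ^+ 2)); first ring.
by rewrite cs mulr1.
Qed.

Lemma N_powC z (a : R) : N (powC z a) = expR (a * ln (N z)).
Proof. by rewrite /powC N_expC /=; congr expR; ring. Qed.

Lemma cder_expC z : cder expC z (expC z).
Proof.
have h := cder_comp (f := fun w => w - z) (g := expC) (z := z).
have := @cderB _ id (fun=> z) z 1 0 (cder_id z) (cder_cst z z).
rewrite subr0 => /h; rewrite subrr => /(_ _ cder_expC0); rewrite mulr1 => h1.
have := cderM (cder_cst (expC z) z) h1; rewrite mul0r add0r mulr1.
by apply: cder_ext => w; rewrite -expCD addrC subrK.
Qed.

Lemma cder_powC z (a : R) : slit_plane z -> exists c, cder (fun w => powC w a) z c.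
Proof.
move=> sz; eexists; rewrite /powC.
exact: cder_comp (cderM (cder_cst _ z) (cder_logC sz)) (cder_expC _).
Qed.

End Logarithm.

(** * Grid regions and sums over their boundary *)

Record grid (R : realType) := Grid {
  ox : R; oy : R; mesh : R; dim : nat; sel : nat -> nat -> bool;
  mesh_gt0 : 0 < mesh;
  sel_inside : forall i j, sel i j -> [/\ 0 < i, i.+1 < dim, 0 < j & j.+1 < dim]%N }.

Section Grid.
Context {R : realType} (G : grid R).
Implicit Types (z w v c : R[i]) (x y d e t : R) (i j : nat).

Definition px i := ox G + i%:R * mesh G.
Definition py j := oy G + j%:R * mesh G.
Definition pt i j := px i +i* py j.
Definition gcell i j := cell (px i) (py j) (mesh G).

Definition box := [set z | px 0 < complex.Re z < px (dim G) /\
                           py 0 < complex.Im z < py (dim G)].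

(** The interior of [outer], expressed by finitely many conditions: a point on a grid line needs all
    the closed cells that meet there to be selected. *)
Definition inner := [set z | box z /\
  forall i j, (i < dim G)%N -> (j < dim G)%N -> gcell i j z -> sel G i j].

Definition outer := [set z | exists i j, sel G i j /\ gcell i j z].

Let dl := mesh G.
Let dl0 : 0 < dl := mesh_gt0 G.
Let m := dim G.

Lemma pxS i : px i.+1 = px i + dl.
Proof. by rewrite /px -/dl mulrS mulrDl mul1r; ring. Qed.

Lemma pyS j : py j.+1 = py j + dl.
Proof. by rewrite /py -/dl mulrS mulrDl mul1r; ring. Qed.

Let real_cell (o x : R) n : o < x < o + n%:R * dl ->
  exists2 i, (i < n)%N & o + i%:R * dl <= x <= o + i%:R * dl + dl.
Proof.
move=> /andP[ox]; elim: n => [|n IH]; first by rewrite mul0r; lra.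
rewrite mulrS mulrDl mul1r => xo.
have [xn|xn] := ltP x (o + n%:R * dl).
  by have [i i_n H] := IH xn; exists i => //; apply: ltn_trans i_n _.
by exists n => //; rewrite xn; lra.
Qed.

Lemma box_cell z : box z -> exists i j, [/\ (i < m)%N, (j < m)%N & gcell i j z].
Proof.
rewrite /box /px /py !mul0r !addr0 => -[/real_cell[i im ci] /real_cell[j jm cj]].
by exists i, j.
Qed.

Lemma inner_outer : inner `<=` outer.
Proof. by move=> z [/box_cell[i [j [im jm c]]]] /(_ i j im jm c) s; exists i, j. Qed.

Lemma open_box : open box.
Proof.
apply/openN => z [/andP[x1 x2] /andP[y1 y2]].
pose d := Num.min (Num.min (complex.Re z - px 0) (px (dim G) - complex.Re z))
                  (Num.min (complex.Im z - py 0) (py (dim G) - complex.Im z)).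
exists d; first by rewrite /d !lt_min !subr_gt0 x1 x2 y1.
move=> w; rewrite /d !lt_min => /andP[/andP[h1 h2] /andP[h3 h4]].
have := N_Re (w - z); have := N_Im (w - z); rewrite !ler_norml ReB ImB.
by move=> /andP[? ?] /andP[? ?]; split; lra.
Qed.

Lemma open_cell_compl x y d z : ~ cell x y d z ->
  exists2 e, 0 < e & forall w, N (w - z) < e -> ~ cell x y d w.
Proof.
have [|nx] := boolP (x <= complex.Re z <= x + d).
  have [|ny] := boolP (y <= complex.Im z <= y + d).
    by move=> hx hy []; split.
  move=> _ _; have : complex.Im z < y \/ y + d < complex.Im z.
    by move: ny; rewrite negb_and -!ltNge => /orP.
  move=> [h|h]; [exists (y - complex.Im z)|exists (complex.Im z - (y + d))]; rewrite ?subr_gt0//.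
    move=> w wz [_]; have := N_Im (w - z); rewrite ImB ler_norml => /andP[? ?]; lra.
  move=> w wz [_]; have := N_Im (w - z); rewrite ImB ler_norml => /andP[? ?]; lra.
move=> _; have : complex.Re z < x \/ x + d < complex.Re z.
  by move: nx; rewrite negb_and -!ltNge => /orP.
move=> [h|h]; [exists (x - complex.Re z)|exists (complex.Re z - (x + d))]; rewrite ?subr_gt0//.
  move=> w wz []; have := N_Re (w - z); rewrite ReB ler_norml => /andP[? ?]; lra.
move=> w wz []; have := N_Re (w - z); rewrite ReB ler_norml => /andP[? ?]; lra.
Qed.

Let all_cells (P : nat -> nat -> R -> Prop) :
  (forall i j d e, e <= d -> P i j d -> P i j e) ->
  (forall i j, exists2 e, 0 < e & P i j e) ->
  forall n p, exists2 e, 0 < e & forall i j, (i < n)%N -> (j < p)%N -> P i j e.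
Proof.
move=> Pm Pe n p.
have row i q : exists2 e, 0 < e & forall j, (j < q)%N -> P i j e.
  elim: q => [|q [e e0 H]]; first by exists 1.
  have [d d0 Hd] := Pe i q; exists (Num.min e d); first by rewrite lt_min e0.
  move=> j; rewrite ltnS leq_eqVlt => /predU1P[->|jq].
    by apply: Pm Hd; rewrite ge_min lexx orbT.
  by apply: Pm (H _ jq); rewrite ge_min lexx.
elim: n => [|n [e e0 H]]; first by exists 1.
have [d d0 Hd] := row n p; exists (Num.min e d); first by rewrite lt_min e0.
move=> i j; rewrite ltnS leq_eqVlt => /predU1P[->|iq] jp.
  by apply: Pm (Hd _ jp); rewrite ge_min lexx orbT.
by apply: Pm (H _ _ iq jp); rewrite ge_min lexx.
Qed.

Lemma open_inner : open inner.
Proof.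
apply/openN => z [zb zs].
have [d d0 Hd] := (openN _).1 open_box z zb.
pose P i j e := ~ gcell i j z -> forall w, N (w - z) < e -> ~ gcell i j w.
have [i j d' e de H|i j|e e0 He] := @all_cells P _ _ m m.
- by move: H; rewrite /P => H nz w we; apply: H nz w (lt_le_trans we de).
- have [c|nc] := pselect (gcell i j z); first by exists 1 => // /(_ c).
  by have [e e0 H] := open_cell_compl nc; exists e => // _.
exists (Num.min d e); first by rewrite lt_min d0.
move=> w; rewrite lt_min => /andP[wd we]; split; first exact: Hd.
move=> i j im jm cw; apply: zs => //; apply: contrapT => nz.
exact: (He i j im jm nz w we).
Qed.

Lemma open_outer_compl z : ~ outer z ->
  exists2 e, 0 < e & forall w, N (w - z) < e -> ~ outer w.
Proof.
move=> nz; pose P i j e := sel G i j -> forall w, N (w - z) < e -> ~ gcell i j w.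
have [i j d' e de H|i j|e e0 He] := @all_cells P _ _ m m.
- by move: H; rewrite /P => H s w we; apply: H s w (lt_le_trans we de).
- have [s|ns] := boolP (sel G i j); last by exists 1 => // s; rewrite s in ns.
  have nc : ~ gcell i j z by move=> c; apply: nz; exists i, j.
  by have [e e0 H] := open_cell_compl nc; exists e => // _.
exists e => // w we [i [j [s cw]]].
by have [_ h1 _ h2] := sel_inside s; apply: (He i j (ltn_trans (ltnSn _) h1)
  (ltn_trans (ltnSn _) h2) s w we cw).
Qed.

Lemma sel_dim i j : sel G i j -> (i < m)%N /\ (j < m)%N.
Proof. by move=> /sel_inside[_ h1 _ h2]; split; apply: ltn_trans (ltnSn _) _. Qed.

(* [hedge i j], [vedge i j] are the edges above and to the right of cell
   [(i, j)]; the coefficients vanish unless exactly one neighbour is selected. *)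
Definition hcoef (T : comPzRingType) i j : T := (sel G i j.+1)%:R - (sel G i j)%:R.
Definition vcoef (T : comPzRingType) i j : T := (sel G i j)%:R - (sel G i.+1 j)%:R.

Definition bsum (T : comPzRingType) (h v : nat -> nat -> T) :=
  \sum_(0 <= i < m) \sum_(0 <= j < m) (hcoef T i j * h i j.+1 + vcoef T i j * v i.+1 j).

Let sel0 i : sel G i 0 = false.
Proof. by apply/negbTE/negP => /sel_inside[]. Qed.
Let sel0l j : sel G 0 j = false.
Proof. by apply/negbTE/negP => /sel_inside[]. Qed.
Let selm i : sel G i m = false.
Proof. by apply/negbTE/negP => /sel_inside[_ _ _]; rewrite ltnNge leqnSn. Qed.
Let selml j : sel G m j = false.
Proof. by apply/negbTE/negP => /sel_inside[_]; rewrite ltnNge leqnSn. Qed.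

(** Summation by parts from cells to edges. The end terms vanish because [sel_inside] keeps selected
    cells off the border of the array. The ring is arbitrary since the same sums are later formed
    with polynomials. *)
Lemma bsumE (T : comPzRingType) (h v : nat -> nat -> T) :
  \sum_(0 <= i < m) \sum_(0 <= j < m)
    (sel G i j)%:R * (h i j + v i.+1 j - h i j.+1 - v i j) = bsum h v.
Proof.
apply/eqP; rewrite -subr_eq0 /bsum -sumrB; apply/eqP.
transitivity (\sum_(0 <= i < m) \sum_(0 <= j < m)
   (((sel G i j)%:R * h i j - (sel G i j.+1)%:R * h i j.+1) +
    ((sel G i.+1 j)%:R * v i.+1 j - (sel G i j)%:R * v i j))).
  apply: eq_bigr => i _; rewrite -sumrB; apply: eq_bigr => j _.
  by rewrite /hcoef /vcoef; ring.
under eq_bigr do rewrite big_split /=.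
rewrite big_split /=.
rewrite [X in X + _]big1 ?add0r; last first.
  move=> i _; under eq_bigr do rewrite -opprB.
  by rewrite sumrN telescope_sumr// sel0 selm !mul0r subrr oppr0.
rewrite exchange_big big1 //= => j _.
by rewrite telescope_sumr// sel0l selml !mul0r subrr.
Qed.

Lemma gcell_notinner i j z : (i < m)%N -> (j < m)%N -> gcell i j z -> ~~ sel G i j -> ~ inner z.
Proof. by move=> im jm c /negP s [_ /(_ i j im jm c)]. Qed.

(** A nonzero coefficient means that exactly one of the two cells sharing the edge is selected; the
    other cell witnesses that the edge is not inner. *)
Lemma hedge_notinner (T : comPzRingType) i j t : hcoef T i j != 0 -> 0 <= t <= 1 ->
  ~ inner (pt i j.+1 + t%:C * dl%:C) /\ outer (pt i j.+1 + t%:C * dl%:C).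
Proof.
move=> k0 t01.
have [c1 _ _ _] := cell_edges (px i) (py j.+1) (ltW dl0) t01.
have [_ _ c2 _] := cell_edges (px i) (py j) (ltW dl0) t01.
have E : (px i +i* py j) + (0 +i* dl) = pt i j.+1 :> R[i].
  by rewrite /pt pyS; ceq => /=; ring.
rewrite E in c2; rewrite -/(pt i j.+1) in c1.
case s1: (sel G i j.+1); case s2: (sel G i j); move: k0; rewrite /hcoef s1 s2 ?subrr ?eqxx// => _.
  have [i1 j1] := sel_dim s1; split; last by exists i, j.+1.
  by apply: (gcell_notinner i1 (ltn_trans (ltnSn _) j1) c2); rewrite s2.
have [i1 j1] := sel_dim s2; split; last by exists i, j.
have [_ _ _ j2] := sel_inside s2.
by apply: (gcell_notinner i1 j2 c1); rewrite s1.
Qed.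

Lemma vedge_notinner (T : comPzRingType) i j t : vcoef T i j != 0 -> 0 <= t <= 1 ->
  ~ inner (pt i.+1 j + t%:C * (0 +i* dl)) /\ outer (pt i.+1 j + t%:C * (0 +i* dl)).
Proof.
move=> k0 t01.
have [_ _ _ c1] := cell_edges (px i.+1) (py j) (ltW dl0) t01.
have [_ c2 _ _] := cell_edges (px i) (py j) (ltW dl0) t01.
have E : (px i +i* py j) + dl%:C = pt i.+1 j :> R[i].
  by rewrite /pt pxS; ceq => /=; ring.
rewrite E in c2; rewrite -/(pt i.+1 j) in c1.
case s1: (sel G i.+1 j); case s2: (sel G i j); move: k0; rewrite /vcoef s1 s2 ?subrr ?eqxx// => _.
  have [i1 j1] := sel_dim s1; split; last by exists i.+1, j.
  by apply: (gcell_notinner (ltn_trans (ltnSn _) i1) j1 c2); rewrite s2.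
have [i1 j1] := sel_dim s2; split; last by exists i, j.
have [_ i2 _ _] := sel_inside s2.
by apply: (gcell_notinner i2 j1 c1); rewrite s1.
Qed.

Definition bint n (g : R[i] -> R[i]) : R[i] :=
  bsum (fun i j => rsum n g (pt i j) dl%:C) (fun i j => rsum n g (pt i j) (0 +i* dl)).

Lemma eq_bsum (T : comPzRingType) (h v h' v' : nat -> nat -> T) :
  (forall i j, hcoef T i j != 0 -> h i j.+1 = h' i j.+1) ->
  (forall i j, vcoef T i j != 0 -> v i.+1 j = v' i.+1 j) -> bsum h v = bsum h' v'.
Proof.
move=> hh vv; apply: eq_bigr => i _; apply: eq_bigr => j _; congr (_ + _).
  by have [->|/hh ->//] := eqVneq (hcoef T i j) 0; rewrite !mul0r.
by have [->|/vv ->//] := eqVneq (vcoef T i j) 0; rewrite !mul0r.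
Qed.

Lemma bsum_bound (h v : nat -> nat -> R[i]) B : 0 <= B ->
  (forall i j, hcoef _ i j != 0 :> R[i] -> N (h i j.+1) <= B) ->
  (forall i j, vcoef _ i j != 0 :> R[i] -> N (v i.+1 j) <= B) ->
  N (bsum h v) <= (2 * m * m)%N%:R * B.
Proof.
move=> B0 hB vB.
have Nsum (F : nat -> R[i]) K n : (forall i, N (F i) <= K) ->
    N (\sum_(0 <= i < n) F i) <= n%:R * K.
  move=> FK; elim: n => [|n IH]; first by rewrite big_geq// N0 mul0r.
  rewrite big_nat_recr//=; apply: le_trans (ND _ _) _.
  by rewrite mulrSr mulrDl mul1r lerD.
have Nb (b b' : bool) z : (b%:R - b'%:R != 0 :> R[i] -> N z <= B) ->
    N ((b%:R - b'%:R) * z) <= B.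
  case: b b' => -[]; rewrite ?subrr ?mul0r ?N0// ?sub0r ?subr0 NM ?NN N1 mul1r; apply.
    by rewrite oner_eq0.
  by rewrite oppr_eq0 oner_eq0.
have -> : (2 * m * m)%N%:R * B = m%:R * (m%:R * (B + B)) by rewrite !natrM; ring.
apply: (Nsum) => i; apply: (Nsum) => j; apply: le_trans (ND _ _) _.
by apply: lerD; apply: (Nb); [exact: hB|exact: vB].
Qed.

Lemma bintE n g : bint n g = \sum_(0 <= i < m) \sum_(0 <= j < m)
    (sel G i j)%:R * cellsum n g (px i) (py j) dl.
Proof.
rewrite /bint -bsumE; apply: eq_bigr => i _; apply: eq_bigr => j _; congr (_ * _).
rewrite /cellsum /sqsum -/(pt i j).
have -> : pt i j + dl%:C = pt i.+1 j by rewrite /pt pxS; ceq => /=; ring.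
by have -> : pt i j + (0 +i* dl) = pt i j.+1 by rewrite /pt pyS; ceq => /=; ring.
Qed.

End Grid.

Definition tend0 {R : realType} (u : nat -> R[i]) := forall e : R, 0 < e ->
  exists n0, forall n, (n0 <= n)%N -> N (u n) <= e.

Section Tend0.
Context {R : realType}.
Implicit Types (u v : nat -> R[i]).

Lemma eq_tend0 u v : u =1 v -> tend0 u -> tend0 v.
Proof. by move=> uv tu e /tu[n H]; exists n => k /H; rewrite uv. Qed.

Lemma tend0_0 : tend0 (fun=> 0 : R[i]).
Proof. by move=> e e0; exists 0 => n _; rewrite N0 ltW. Qed.

Lemma tend0D u v : tend0 u -> tend0 v -> tend0 (fun n => u n + v n).
Proof.
move=> tu tv e e0; have e2 : 0 < e / 2 by rewrite divr_gt0.
have [n H] := tu _ e2; have [n' H'] := tv _ e2.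
exists (maxn n n') => k; rewrite geq_max => /andP[/H h /H' h'].
by apply: le_trans (ND _ _) _; lra.
Qed.

Lemma tend0Z c u : tend0 u -> tend0 (fun n => c * u n).
Proof.
move=> tu e e0; have c0 : 0 < 1 + N c by have := N_ge0 c; lra.
have [n H] := tu (e / (1 + N c)) (divr_gt0 e0 c0).
exists n => k /H h; rewrite NM.
have := ler_pM (N_ge0 c) (N_ge0 _) (ler_wpDl ler01 (lexx (N c))) h.
by rewrite [X in _ <= X]mulrC divfK// gt_eqF.
Qed.

Lemma tend0N u : tend0 u -> tend0 (fun n => - u n).
Proof. by move=> /(tend0Z (-1)); apply: eq_tend0 => n; rewrite mulN1r. Qed.

Lemma tend0_sum (u : nat -> nat -> R[i]) m : (forall i, tend0 (u i)) ->
  tend0 (fun n => \sum_(0 <= i < m) u i n).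
Proof.
move=> tu; elim: m => [|m IH].
  by apply: eq_tend0 tend0_0 => n; rewrite big_geq.
by apply: eq_tend0 (tend0D IH (tu m)) => n; rewrite big_nat_recr.
Qed.

End Tend0.

(** * Cauchy's formula on a grid region *)

Section CauchyFormula.
Context {R : realType}.
Implicit Types (F g : R[i] -> R[i]) (z w v c : R[i]).

(* plays the role of 2 pi i; only a lower bound for its modulus is needed *)
Definition omega n : R[i] := cellsum n (fun z => z^-1) (-1) (-1) 2.

Let half_imag (h : R) : (0 +i* h) / 2 = (0 +i* (h / 2)) :> R[i].
Proof.
apply: (mulIf (_ : (2 : R[i]) != 0)); rewrite ?pnatr_eq0// divfK ?pnatr_eq0//.
by rewrite mulr_natr mulr2n; ceq => /=; field.
Qed.

(** At a node [1 + i s] with [|s| <= 1] the imaginary part of the term is [h / (1 + s^2)], hence at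
    least [h / 2]. No limit is involved. *)
Let rsum_inv_ge n (y h : R) : 0 <= h -> -1 <= y -> y + h <= 1 ->
  h / 2 <= complex.Im (rsum n (fun z => z^-1) (1 +i* y) (0 +i* h)).
Proof.
elim: n y h => [|n IH] y h h0 y1 yh; last first.
  have -> : rsum n.+1 (fun z => z^-1) (1 +i* y) (0 +i* h) =
    rsum n (fun z => z^-1) (1 +i* y) (0 +i* (h / 2)) +
    rsum n (fun z => z^-1) (1 +i* (y + h / 2)) (0 +i* (h / 2)).
    by rewrite -half_imag /=; congr (_ + rsum n _ _ _); rewrite half_imag; ceq => /=; ring.
  have h1 : 0 <= h / 2 by rewrite divr_ge0.
  have h2 : y + h / 2 <= 1 by lra.
  have h3 : -1 <= y + h / 2 by lra.
  have h4 : y + h / 2 + h / 2 <= 1 by lra.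
  have := IH y (h / 2) h1 y1 h2; have := IH (y + h / 2) (h / 2) h1 h3 h4.
  by rewrite ImD; lra.
have -> : rsum 0 (fun z => z^-1) (1 +i* y) (0 +i* h) = (1 +i* (y + h / 2))^-1 * (0 +i* h).
  by rewrite [LHS]/(rsum _ _ _ _) half_imag; congr (_^-1 * _); ceq => /=; ring.
set s := y + h / 2.
have s2 : 0 < 1 + s ^+ 2 by rewrite ltr_pwDl// sqr_ge0.
have -> : (1 +i* s)^-1 = ((1 + s ^+ 2)^-1 +i* (- s / (1 + s ^+ 2))) :> R[i].
  have s0 : (1 +i* s) != 0 :> R[i] by rewrite eq_complex /= oner_eq0.
  apply: (mulIf s0); rewrite mulVf//; ceq => /=; field; exact: lt0r_neq0.
have imE (a b : R) : complex.Im ((a +i* b) * (0 +i* h)) = h * a by rewrite /=; ring.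
rewrite imE ler_wpM2l// lef_pV2 ?posrE//.
have : s ^+ 2 <= 1; last lra.
by rewrite /s expr2; nra.
Qed.

(** Rotation invariance makes the contributions of the four sides equal to one number [r], whose
    imaginary part is at least 1. *)
Lemma omega_ge1 n : 1 <= N (omega n).
Proof.
set r := rsum n (fun z => z^-1) (1 +i* (-1)) (0 +i* 2).
have rE (c a v : R[i]) : c != 0 -> c * (1 +i* (-1)) = a -> c * (0 +i* 2) = v ->
    rsum n (fun z => z^-1) a v = r.
  by move=> c0 <- <-; rewrite rsum_inv_scale.
have i0 : (0 +i* 1) != 0 :> R[i] by rewrite eq_complex /= oner_eq0 andbF.
have ni0 : (0 +i* (-1)) != 0 :> R[i] by rewrite eq_complex /= oppr_eq0 oner_eq0 andbF.
have n10 : (-1) != 0 :> R[i] by rewrite oppr_eq0 oner_eq0.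
have -> : omega n = 4 * r.
  rewrite /omega /cellsum /sqsum.
  have -> : rsum n (fun z => z^-1) (-1 +i* -1) (2 : R)%:C = r.
    by apply: (rE _ _ _ ni0); ceq => /=; ring.
  have -> : rsum n (fun z => z^-1) ((-1 +i* -1) + (2 : R)%:C) (0 +i* 2) = r.
    by rewrite /r; congr rsum; ceq => /=; ring.
  have -> : rsum n (fun z => z^-1) ((-1 +i* -1) + (0 +i* 2)) (2 : R)%:C = - r.
    by rewrite -[LHS]opprK -rsum_rev; congr (- _); apply: (rE _ _ _ i0); ceq => /=; ring.
  have -> : rsum n (fun z => z^-1) (-1 +i* -1) (0 +i* (2 : R)) = - r.
    by rewrite -[LHS]opprK -rsum_rev; congr (- _); apply: (rE _ _ _ n10); ceq => /=; ring.
  by ring.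
have := @rsum_inv_ge n (-1) 2 (ler0n _ _) (lexx _).
have -> : (-1 + 2 : R) <= 1 by lra.
move=> /(_ isT); rewrite -/r divff ?pnatr_eq0// => r1.
rewrite NM; have n4 : N (4 : R[i]) = 4.
  by rewrite -[4 : R[i]](rmorph_nat (real_complex R)) N_real ger0_norm.
have := N_Im r; have := ler_norm (complex.Im r); rewrite n4; lra.
Qed.

Context (G : grid R).
Let dl := mesh G.
Let dl0 : 0 < dl := mesh_gt0 G.
Let m := dim G.

Lemma bintB n f g : bint G n (fun z => f z - g z) = bint G n f - bint G n g.
Proof.
rewrite /bint /bsum -sumrB; apply: eq_bigr => i _; rewrite -sumrB.
by apply: eq_bigr => j _; rewrite !rsumB; ring.
Qed.

Lemma bintZ n c g : bint G n (fun z => c * g z) = c * bint G n g.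
Proof.
rewrite /bint /bsum mulr_sumr; apply: eq_bigr => i _; rewrite mulr_sumr.
by apply: eq_bigr => j _; rewrite !rsumZ; ring.
Qed.

Lemma eq_bint n f g : (forall z, ~ inner G z -> outer G z -> f z = g z) ->
  bint G n f = bint G n g.
Proof.
move=> fg; apply: eq_bsum => i j k0; apply: eq_rsum => t t01.
  by have [h1 h2] := hedge_notinner k0 t01; apply: fg.
by have [h1 h2] := vedge_notinner k0 t01; apply: fg.
Qed.

Lemma bint_tend0 g : (forall i j, sel G i j ->
    tend0 (fun n => cellsum n g (px G i) (py G j) dl)) ->
  tend0 (fun n => bint G n g).
Proof.
move=> H; apply: (@eq_tend0 _ (fun n => \sum_(0 <= i < m) \sum_(0 <= j < m)
    (sel G i j)%:R * cellsum n g (px G i) (py G j) dl)) => [n|]; first by rewrite bintE.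
apply: tend0_sum => i; apply: tend0_sum => j.
have [/H h|_] := boolP (sel G i j); first exact: tend0Z.
by apply: eq_tend0 tend0_0 => n; rewrite mul0r.
Qed.

Lemma strict_cell i j i' j' z :
  px G i < complex.Re z < px G i + dl -> py G j < complex.Im z < py G j + dl ->
  gcell G i' j' z -> i = i' /\ j = j'.
Proof.
have coord (o x : R) k k' : o + k%:R * dl < x < o + k%:R * dl + dl ->
    o + k'%:R * dl <= x <= o + k'%:R * dl + dl -> k = k'.
  move=> /andP[h1 h2] /andP[h3 h4].
  have K p q : (p < q)%N -> p%:R * dl + dl <= q%:R * dl.
    move=> pq; have : (p.+1)%:R * dl <= q%:R * dl by rewrite ler_pM2r// ler_nat.
    by rewrite mulrS; lra.
  by case: (ltngtP k k') => // /K ?; exfalso; lra.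
by move=> hx hy [cx cy]; split; [exact: coord hx cx|exact: coord hy cy].
Qed.

Lemma strict_inner i j z : sel G i j ->
  px G i < complex.Re z < px G i + dl -> py G j < complex.Im z < py G j + dl -> inner G z.
Proof.
move=> s hx hy; have [i1 i2 j1 j2] := sel_inside s.
split; last by move=> i' j' _ _ /(strict_cell hx hy)[<- <-].
move: hx hy => /andP[x1 x2] /andP[y1 y2].
have mono (o : R) p q : (p <= q)%N -> o + p%:R * dl <= o + q%:R * dl.
  by move=> pq; rewrite lerD2l ler_pM2r// ler_nat.
have a1 := mono (ox G) _ _ (ltnW i1); have a2 := mono (ox G) _ _ (ltnW i2).
have a3 := mono (oy G) _ _ (ltnW j1); have a4 := mono (oy G) _ _ (ltnW j2).
rewrite -/(px G _) in a1 a2; rewrite -/(py G _) in a3 a4.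
rewrite /box; split; apply/andP; split.
- by apply: le_lt_trans x1; exact: a1.
- by apply: lt_le_trans x2 _; rewrite -pxS; exact: a2.
- by apply: le_lt_trans y1; exact: a3.
- by apply: lt_le_trans y2 _; rewrite -pyS; exact: a4.
Qed.

Let center i j : R[i] := (px G i + dl / 2) +i* (py G j + dl / 2).

Let center_strict i j :
  px G i < complex.Re (center i j) < px G i + dl /\
  py G j < complex.Im (center i j) < py G j + dl.
Proof. by have := dl0 => d; split; apply/andP; split => /=; lra. Qed.

Let inner_center i j : sel G i j -> inner G (center i j).
Proof.
by move=> s; have [h1 h2] := center_strict i j; exact: strict_inner s h1 h2.
Qed.

(** The integrand has the primitive [logC ((w - z) / (w - z'))], whose cut is the segment from [z]
    to the centre of its cell. This segment does not meet the boundary, so the boundary sums tend to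
    a sum of increments, which vanishes. *)
Let bint_inv_shift i0 j0 z : sel G i0 j0 -> gcell G i0 j0 z -> inner G z ->
  tend0 (fun n => bint G n (fun w => (w - z)^-1 - (w - center i0 j0)^-1)).
Proof.
move=> s0 cz iz; set z' := center i0 j0; have iz' : inner G z' := inner_center s0.
pose g w := (w - z)^-1 - (w - z')^-1.
pose f w := logC ((w - z) / (w - z')).
have neq w : ~ inner G w -> w - z != 0 /\ w - z' != 0.
  by move=> nw; rewrite !subr_eq0; split; apply: contra_notN nw => /eqP ->.
have df w : ~ inner G w -> cder f w (g w).
  move=> nw; have [wz wz'] := neq w nw.
  have sl : slit_plane ((w - z) / (w - z')).
    (* A negative quotient puts [w] strictly between [z] and the centre [z'], hence strictly inside
       a selected cell, so [w] would be inner. *)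
    apply/slit_planeE; have [/eqP q1|] := boolP (complex.Im ((w - z) / (w - z')) == 0); last by left.
    right; rewrite ltNge; apply/negP => q2; apply: nw.
    have e1 : (w - z) = (complex.Re ((w - z) / (w - z')))%:C * (w - z').
      rewrite -[LHS](divfK wz'); congr (_ * _).
      by rewrite [LHS]complex_split q1; ceq; rewrite /= ?addr0.
    set r := complex.Re _ in e1 q2.
    have [r0|r0] := eqVneq r 0.
      by move: wz; rewrite e1 r0 mul0r eqxx.
    have r1 : 0 < - r by rewrite oppr_gt0 lt_neqAle r0.
    have e2 : complex.Re (w - z) = r * complex.Re (w - z').
      by rewrite e1; case: (w - z') => ? ? /=; ring.
    have e3 : complex.Im (w - z) = r * complex.Im (w - z').
      by rewrite e1; case: (w - z') => ? ? /=; ring.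
    rewrite !ReB /= in e2; rewrite !ImB /= in e3.
    move: cz => [/andP[c1 c2] /andP[c3 c4]]; rewrite -/dl in c2 c4.
    have d2 : 0 < dl / 2 by rewrite divr_gt0.
    by apply: (strict_inner s0); apply/andP; split; nra.
  have dq := cderM (cderB (cder_id w) (cder_cst z w))
     (cderV (cderB (cder_id w) (cder_cst z' w)) wz').
  have := cder_comp dq (cder_logC sl).
  congr cder; rewrite /g; field; by rewrite wz wz'.
have cg w : ~ inner G w -> ccont g w.
  move=> nw; have [wz wz'] := neq w nw.
  apply: cder_cont (cderB (cderV (cderB (cder_id w) (cder_cst z w)) wz)
     (cderV (cderB (cder_id w) (cder_cst z' w)) wz')).
pose h i j := f (pt G i.+1 j) - f (pt G i j).
pose v i j := f (pt G i j.+1) - f (pt G i j).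
(* The increments of [f] around a single cell cancel algebraically, whatever [f] does inside. Only
   on boundary edges are they compared with the sums of [g]. *)
have hv0 : bsum G h v = 0.
  rewrite -bsumE big1// => i _; rewrite big1// => j _.
  by rewrite /h /v; ring.
have ptx i j : pt G i.+1 j = pt G i j + dl%:C by rewrite /pt pxS -/dl; ceq => /=; ring.
have pty i j : pt G i j.+1 = pt G i j + (0 +i* dl) by rewrite /pt pyS -/dl; ceq => /=; ring.
apply: (@eq_tend0 _ (fun n => \sum_(0 <= i < m) \sum_(0 <= j < m)
   (hcoef G _ i j * (rsum n g (pt G i j.+1) dl%:C - h i j.+1) +
    vcoef G _ i j * (rsum n g (pt G i.+1 j) (0 +i* dl) - v i.+1 j)))) => [n|].
  rewrite -[RHS]subr0 -[X in _ = _ - X]hv0 /bint /bsum -sumrB. cbv beta; apply: eq_bigr => i _; rewrite -sumrB.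
  apply: eq_bigr => j _; rewrite -/dl; ring.
apply: tend0_sum => i; apply: tend0_sum => j; apply: tend0D.
  have [->|k0] := eqVneq (hcoef G R[i] i j) 0.
    by apply: eq_tend0 tend0_0 => n; rewrite mul0r.
  apply: tend0Z; have E t t01 := (hedge_notinner k0 (t := t) t01).1.
  have := rsum_cvg (fun t t01 => df _ (E t t01)) (fun t t01 => cg _ (E t t01)).
  by move=> H e /H[n0 Hn]; exists n0 => n /Hn; rewrite distNC /h ptx.
have [->|k0] := eqVneq (vcoef G R[i] i j) 0.
  by apply: eq_tend0 tend0_0 => n; rewrite mul0r.
apply: tend0Z; have E t t01 := (vedge_notinner k0 (t := t) t01).1.
have := rsum_cvg (fun t t01 => df _ (E t t01)) (fun t t01 => cg _ (E t t01)).
by move=> H e /H[n0 Hn]; exists n0 => n /Hn; rewrite distNC /v pty.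
Qed.

(** Dilation about the centre carries the cell [(i0, j0)] node by node onto the square defining
    [omega], so its term is exactly [omega n]. On every other selected cell the integrand is
    holomorphic and Goursat's lemma applies. *)
Let bint_inv_center i0 j0 : sel G i0 j0 ->
  tend0 (fun n => bint G n (fun w => (w - center i0 j0)^-1) - omega n).
Proof.
move=> s0; set z' := center i0 j0; have [i0m j0m] := sel_dim s0.
have d2 : 0 < dl / 2 by rewrite divr_gt0.
pose u n i j : R[i] := (sel G i j)%:R * cellsum n (fun w => (w - z')^-1) (px G i) (py G j) dl -
  (if i == i0 then if j == j0 then omega n else 0 else 0).
apply: (@eq_tend0 _ (fun n => \sum_(0 <= i < m) \sum_(0 <= j < m) u n i j)) => [n|].
  rewrite bintE.
  have E : omega n = \sum_(0 <= i < m) \sum_(0 <= j < m)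
      (if i == i0 then if j == j0 then omega n else 0 else 0).
    transitivity (\sum_(0 <= i < m) if i == i0 then omega n else 0).
      by rewrite -big_mkcond big_nat1_eq i0m.
    apply: eq_bigr => i _; case: ifP => _; last by rewrite big1.
    by rewrite -big_mkcond big_nat1_eq j0m.
  rewrite [X in _ = _ - X]E -sumrB; cbv beta.
  by apply: eq_bigr => i _; rewrite -sumrB.
apply: tend0_sum => i; apply: tend0_sum => j; rewrite /u.
have [/andP[/eqP -> /eqP ->]|ne] := boolP ((i == i0) && (j == j0)).
  apply: eq_tend0 tend0_0 => n; rewrite !eqxx s0 mul1r; apply/esym/eqP; rewrite subr_eq0; apply/eqP.
  rewrite /omega /cellsum /sqsum !rsum_shift.
  have c0 : (dl / 2)%:C != 0 :> R[i] by rewrite -N_gt0 N_real normr_gt0 gt_eqF.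
  by congr (_ + _ - _ - _); rewrite -[RHS](rsum_inv_scale _ _ _ c0); congr (rsum _ _ _ _);
     rewrite /z' /center; ceq => /=; field.
have E n : (if i == i0 then if j == j0 then omega n else 0 else 0) = 0.
  by move: ne; case: (i == i0) => //=; case: (j == j0).
apply: (@eq_tend0 _ (fun n => (sel G i j)%:R * cellsum n (fun w => (w - z')^-1) (px G i) (py G j) dl)).
  by move=> n; rewrite E subr0.
have [sij|_] := boolP (sel G i j); last by apply: eq_tend0 tend0_0 => n; rewrite mul0r.
apply: tend0Z.
have nz w : cell (px G i) (py G j) dl w -> w - z' != 0.
  move=> cw; rewrite subr_eq0; apply/eqP => wz; rewrite wz in cw.
  have [h1 h2] := center_strict i0 j0.
  by have [e1 e2] := strict_cell h1 h2 cw; move: ne; rewrite -e1 -e2 !eqxx.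
apply: (@cellsum_cvg0 _ _ z') => // [w /nz w0 _|/nz].
  by have := cderV (cderB (cder_id w) (cder_cst z' w)) w0; exists (- (w - z') ^- 2 * (1 - 0)).
by rewrite subrr eqxx.
Qed.

Lemma bint_inv z : inner G z -> tend0 (fun n => bint G n (fun w => (w - z)^-1) - omega n).
Proof.
move=> iz; have [i0 [j0 [i0m j0m cz]]] := box_cell iz.1.
have s0 := iz.2 i0 j0 i0m j0m cz.
apply: eq_tend0 (tend0D (bint_inv_shift s0 cz iz) (bint_inv_center s0)) => n.
by rewrite bintB; ring.
Qed.

(** The difference quotient of [F] at [z], completed by the derivative, is continuous at [z] and
    holomorphic elsewhere: this is the use of the exceptional point in [cellsum_cvg0]. Splitting the
    quotient on the boundary leaves [bint_inv]. *)
Lemma cauchy_inner F z : (forall w, outer G w -> exists c, cder F w c) -> inner G z ->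
  tend0 (fun n => F z * omega n - bint G n (fun w => F w * (w - z)^-1)).
Proof.
move=> dF iz; have [c dFz] := dF z (inner_outer iz).
pose g w := if w == z then c else (F w - F z) * (w - z)^-1.
have g0 : tend0 (fun n => bint G n g).
  apply: bint_tend0 => i j s; apply: (@cellsum_cvg0 _ _ z) => // [w cw wz|_].
    have [b dFw] : exists c, cder F w c by apply: dF; exists i, j.
    have w0 : w - z != 0 by rewrite subr_eq0; apply/eqP.
    have := cderM (cderB dFw (cder_cst (F z) w)) (cderV (cderB (cder_id w) (cder_cst z w)) w0).
    move=> /(@cder_near _ _ g _ _ (N (w - z))) H; eexists; apply: H; first by rewrite N_gt0.
    move=> v vw; rewrite /g; case: eqVneq => // vz.
    by move: vw; rewrite vz distNC ltxx.
  move=> e e0; have [d d0 H] := dFz _ (divr_gt0 e0 (ltr0Sn _ 1)).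
  exists d => // w /H; rewrite /g eqxx; case: eqVneq => [_ _|wz h]; first by rewrite subrr N0.
  have w0 : w - z != 0 by rewrite subr_eq0.
  have -> : (F w - F z) * (w - z)^-1 - c = (F w - F z - c * (w - z)) / (w - z) by field.
  rewrite NM NV ltr_pdivrMr ?N_gt0//; apply: le_lt_trans h _.
  by rewrite ltr_pM2r ?N_gt0//; lra.
apply: eq_tend0 (tend0D (tend0Z (- F z) (bint_inv iz)) (tend0N g0)) => n.
have -> : bint G n g = bint G n (fun w => F w * (w - z)^-1 - F z * (w - z)^-1).
  apply: eq_bint => w nw _; rewrite /g; case: eqVneq => [wz|_]; last by rewrite mulrBl.
  by move: nw; rewrite wz.
by rewrite bintB bintZ; ring.
Qed.

End CauchyFormula.

(** * Compact parts of an open set *)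

Section Compactness.
Context {R : realType}.
Implicit Types (A : set R[i]) (z w : R[i]) (d e : R).

Lemma continuous_complex : continuous (fun p : R * R => p.1 +i* p.2).
Proof.
move=> p U /nbhsN[d d0 dU]; have d2 : 0 < d / 2 by rewrite divr_gt0.
exists (ball p.1 (d / 2), ball p.2 (d / 2)).
  by split => /=; apply: nbhsx_ballx.
move=> [x y]; rewrite /= -!ball_normE /ball_/= => -[px py]; apply: dU.
apply: le_lt_trans (N_ReIm _) _; rewrite ReB ImB /= distrC [`|y - _|]distrC; lra.
Qed.

Lemma compactN A (B : R) : (forall z, A z -> N z <= B) ->
  (forall z, ~ A z -> exists2 e, 0 < e & forall w, N (w - z) < e -> ~ A w) ->
  compact A.
Proof.
move=> AB cA; pose f (p : R * R) := p.1 +i* p.2.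
have cf : compact (f @` (`[- B, B] `*` `[- B, B])).
  apply: continuous_compact; last by apply: compact_setX; exact: segment_compact.
  exact/continuous_subspaceT/continuous_complex.
apply: (subclosed_compact _ cf).
  by rewrite -openC; apply/openN => z /cA.
move=> z /AB zB; exists (complex.Re z, complex.Im z); last by case: (z).
by split; rewrite /= in_itv /= -ler_norml; apply: le_trans zB; [exact: N_Re|exact: N_Im].
Qed.

(** The points at distance at least [d] from the complement. For a bounded open [A] these are
    compact sets exhausting [A], so they stand for all compact parts. *)
Definition depth A d := [set z | forall w, N (w - z) < d -> A w].

Lemma depth_sub A d : 0 < d -> depth A d `<=` A.
Proof. by move=> d0 z; apply; rewrite subrr N0. Qed.

Lemma depth_far A d z w : depth A d z -> ~ A w -> d <= N (z - w).
Proof. by move=> zA nw; rewrite leNgt; apply/negP => wz; apply/nw/zA; rewrite distNC. Qed.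

Lemma depth_le A d e : d <= e -> depth A e `<=` depth A d.
Proof. by move=> de z H w wz; apply/H/(lt_le_trans wz). Qed.

Lemma depth_mono A A' d : A `<=` A' -> depth A d `<=` depth A' d.
Proof. by move=> AA z H w /H/AA. Qed.

Definition bnd A := exists B : R, forall z, A z -> N z <= B.

Lemma compact_depth A d : bnd A -> 0 < d -> compact (depth A d).
Proof.
move=> [B AB] d0; apply: (@compactN _ B); first by move=> z /(depth_sub d0)/AB.
move=> z /existsNP[w /not_implyP[wz nw]]; exists (d - N (w - z)); first by rewrite subr_gt0.
move=> v vz /(_ w) H; apply/nw/H.
by have := ND (w - z) (z - v); rewrite addrA subrK [N (z - v)]distNC; lra.
Qed.

Lemma compact_in_open (K A : set R[i]) : compact K -> open A -> K `<=` A ->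
  exists2 d, 0 < d & K `<=` depth A d.
Proof.
move=> Kc /openN oA KA.
apply: (@compact_ind _ K (fun E => exists2 d, 0 < d & E `<=` depth A d)) => //.
- by exists 1.
- move=> E F [d d0 H] [e e0 H']; exists (Num.min d e); first by rewrite lt_min d0.
  move=> z [/H|/H']; apply: depth_le; by rewrite ge_min lexx ?orbT.
- by move=> E F EF [d d0 H]; exists d => // z /EF/H.
move=> z /KA/oA[d d0 H]; exists (d / 2); first by rewrite divr_gt0.
exists (d / 2); first by rewrite divr_gt0.
move=> w /= wz v vw; apply: H; have := ND (v - w) (w - z).
by rewrite addrA subrK; lra.
Qed.

Lemma compact_outer (G : grid R) : compact (outer G).
Proof.
pose B := `|ox G| + (dim G)%:R * mesh G + mesh G + (`|oy G| + (dim G)%:R * mesh G + mesh G).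
apply: (@compactN _ B) => z; last exact: open_outer_compl.
have co (o x : R) i : (i < dim G)%N -> o + i%:R * mesh G <= x <= o + i%:R * mesh G + mesh G ->
    `|x| <= `|o| + (dim G)%:R * mesh G + mesh G.
  move=> im /andP[x1 x2]; have g0 := mesh_gt0 G.
  have := ler_norm o; have := ler_norm (- o); rewrite normrN => o1 o2.
  have : i%:R * mesh G <= (dim G)%:R * mesh G by rewrite ler_pM2r// ler_nat ltnW.
  have : 0 <= i%:R * mesh G by rewrite mulr_ge0// ltW.
  by rewrite ler_norml => ? ?; apply/andP; split; lra.
move=> [i [j [s [cx cy]]]]; have [im jm] := sel_dim s.
by apply: le_trans (N_ReIm z) _; rewrite /B lerD//; [exact: co cx|exact: co cy].
Qed.

End Compactness.

(** * Polynomial approximation of 1/(z - p) *)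

Section PolynomialInverse.
Context {R : realType}.
Implicit Types (C A : set R[i]) (z w p q : R[i]) (T : {poly R[i]}) (d e : R).

(* A polynomial form of "[p] does not lie in a hole of [C]": powers of
   [1 - T.[z] * (z - p)] tend to 0 on [C], so (z - p)^-1 is a limit of polynomials. *)
Definition pinv C p := exists T, forall z, C z -> N (1 - T.[z] * (z - p)) <= 3 / 4.

Definition nice A := forall d p, 0 < d -> ~ A p -> pinv (depth A d) p.

(** The witness is [(1 - (1 - T (z - p))^k) / (z - p)], a polynomial because the numerator vanishes
    at [p]. Its size grows only linearly in [k], which turns niceness into a geometric rate per
    degree. *)
Lemma pinv_power T p M k : (size T <= M)%N -> exists Tk : {poly R[i]},
  (size Tk <= M * k)%N /\
  forall z, 1 - Tk.[z] * (z - p) = (1 - T.[z] * (z - p)) ^+ k.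
Proof.
move=> TM; elim: k => [|k [Tk [sT HT]]].
  by exists 0; rewrite size_poly0; split => // z; rewrite horner0 mul0r subr0.
exists (Tk + T * (1 - Tk * ('X - p%:P))); split; last first.
  by move=> z; rewrite exprS -HT !hornerE; ring.
have s2 : (size (1 - Tk * ('X - p%:P))%R <= (M * k).+1)%N.
  apply: leq_trans (size_polyD _ _) _; rewrite geq_max size_poly1 size_polyN /=.
  apply: leq_trans (size_polyMleq _ _) _; rewrite size_XsubC addn2 /=.
  by rewrite ltnS.
apply: leq_trans (size_polyD _ _) _; rewrite geq_max; apply/andP; split.
  by apply: leq_trans sT _; rewrite leq_mul2l leqnSn orbT.
apply: leq_trans (size_polyMleq _ _) _.
by rewrite mulnS; move: TM s2; set a := size T; set b := size (1 - Tk * ('X - p%:P))%R; lia.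
Qed.

(** The eighth power brings the error below 1/8. Moving the pole by at most half its distance to the
    points of [C] then adds at most 9/16, and the sum stays below 3/4. *)
Lemma pinv_near C p : pinv C p -> exists T, forall q,
  (forall z, C z -> N (q - p) <= N (z - p) / 2) ->
  forall z, C z -> N (1 - T.[z] * (z - q)) <= 3 / 4.
Proof.
move=> [T HT]; have [T8 [_ H8]] := @pinv_power T p (size T) 8 (leqnn _).
exists T8 => q qp z Cz.
have h1 : N (1 - T8.[z] * (z - p)) <= 1 / 8.
  rewrite H8 NX; have /= := @lerXn2r _ 8 _ _ _ _ (HT z Cz).
  rewrite !nnegrE => /(_ (N_ge0 _)).
  by move=> h; apply: le_trans (h _) _; lra.
have h2 : N T8.[z] * N (z - p) <= 9 / 8.
  have := NBB (T8.[z] * (z - p)) 1; rewrite distNC N1 NM; lra.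
have -> : 1 - T8.[z] * (z - q) = (1 - T8.[z] * (z - p)) + T8.[z] * (q - p) by ring.
apply: le_trans (ND _ _) _; rewrite NM.
have : N T8.[z] * N (q - p) <= N T8.[z] * (N (z - p) / 2) by rewrite ler_wpM2l ?N_ge0 ?qp.
lra.
Qed.

(** Pole pushing. A path outside [A] keeps distance [d] from [depth A d], so steps of length at most
    [d / 2] satisfy the condition of [pinv_near] each time. *)
Lemma pinv_push A d p q : 0 < d ->
  (forall t : R, 0 <= t <= 1 -> ~ A (p + t%:C * (q - p))) ->
  pinv (depth A d) p -> pinv (depth A d) q.
Proof.
move=> d0 H ip; pose n := (Num.trunc (2 * N (q - p) / d)).+1.
have n0 : 0 < n%:R :> R by rewrite ltr0n.
have nd : N (q - p) / n%:R <= d / 2.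
  have := truncnS_gt (2 * N (q - p) / d); rewrite -/n ltr_pdivrMr// ler_pdivrMr// => h.
  by lra.
have step k : (k <= n)%N -> pinv (depth A d) (p + (k%:R / n%:R)%:C * (q - p)).
  elim: k => [_|k IH kn]; first by rewrite mul0r rmorph0 mul0r addr0.
  have [T HT] := pinv_near (IH (ltnW kn)); exists T; apply: HT => z zA.
  have -> : p + (k.+1%:R / n%:R)%:C * (q - p) - (p + (k%:R / n%:R)%:C * (q - p)) =
     (n%:R^-1)%:C * (q - p).
    by rewrite mulrS mulrDl mul1r rmorphD; ring.
  rewrite NM N_real ger0_norm ?invr_ge0// mulrC.
  apply: le_trans nd _; rewrite ler_pM2r ?invr_gt0//; apply: depth_far zA _; apply: H.
  by rewrite divr_ge0//= ler_pdivrMr// mul1r ler_nat ltnW.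
have := step n (leqnn n); rewrite divff ?gt_eqF// rmorph1 mul1r addrC subrK//.
Qed.

Lemma exists_grid A d : bnd A -> 0 < d -> exists G : grid R, [/\ mesh G = d,
  A `<=` box G & forall i j, (i < dim G)%N -> (j < dim G)%N ->
    (sel G i j <-> gcell G i j `<=` A)].
Proof.
move=> [B0 AB0] d0; pose B := `|B0|.
have AB z : A z -> N z <= B by move=> /AB0 h; apply: le_trans h (ler_norm _).
have Bge : 0 <= B by exact: normr_ge0.
(* A margin of [2 * d] around the disc of radius [B], so that cells contained in [A] avoid the
   outermost layer, as [sel_inside] demands. *)
have [ o oE] : exists o, o = - (B + 2 * d) by exists (- (B + 2 * d)).
have [m mE] : exists m, m = (Num.trunc (2 * (B + 2 * d) / d)).+1 by eexists.
have mB : B + 2 * d < o + m%:R * d.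
  by have := truncnS_gt (2 * (B + 2 * d) / d); rewrite -mE ltr_pdivrMr//; lra.
pose S i j := [&& (i < m)%N, (j < m)%N & `[< cell (o + i%:R * d) (o + j%:R * d) d `<=` A >]].
have Sin i j : S i j -> [/\ 0 < i, i.+1 < m, 0 < j & j.+1 < m]%N.
  move=> /and3P[im jm /asboolP cA].
  have inA (s t : R) : 0 <= s <= d -> 0 <= t <= d ->
      `|o + i%:R * d + s| <= B /\ `|o + j%:R * d + t| <= B.
    move=> /andP[s0 s1] /andP[t0 t1].
    have /cA/AB h : cell (o + i%:R * d) (o + j%:R * d) d
        ((o + i%:R * d + s) +i* (o + j%:R * d + t)) by split; apply/andP; split => /=; lra.
    by split; [apply: le_trans (N_Re _) h|apply: le_trans (N_Im _) h].
  have [| |a1 a2] := inA 0 0; rewrite ?lexx ?ltW//.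
  have [| |a3 a4] := inA d d; rewrite ?lexx ?ltW//.
  move: a1 a2 a3 a4; rewrite !ler_norml !addr0.
  move=> /andP[a1 _] /andP[a2 _] /andP[_ a3] /andP[_ a4].
  split.
  - by rewrite lt0n; apply/eqP => i0; move: a1; rewrite i0 mul0r; lra.
  - rewrite ltnNge; apply/negP => mi; move: a3.
    have : m%:R * d <= i.+1%:R * d by rewrite ler_pM2r// ler_nat.
    by rewrite -[i.+1]addn1 natrD; lra.
  - by rewrite lt0n; apply/eqP => j0; move: a2; rewrite j0 mul0r; lra.
  - rewrite ltnNge; apply/negP => mi; move: a4.
    have : m%:R * d <= j.+1%:R * d by rewrite ler_pM2r// ler_nat.
    by rewrite -[j.+1]addn1 natrD; lra.
exists (@Grid R o o d m S d0 Sin); split => //.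
  move=> z /AB zB; rewrite /box /px /py /= mul0r addr0.
  have := le_trans (N_Re z) zB; have := le_trans (N_Im z) zB; rewrite !ler_norml.
  by move=> /andP[? ?] /andP[? ?]; split; apply/andP; split; lra.
move=> i j /= im jm; split; first by move=> /and3P[_ _ /asboolP].
by move=> h; apply/and3P; split => //; exact/asboolP.
Qed.

End PolynomialInverse.

(** * Quantitative Runge theorem *)

Section BernsteinWalsh.
Context {R : realType}.
Implicit Types (A : set R[i]) (F : R[i] -> R[i]) (z w p q : R[i]) (d e : R).

Definition grid_of A d (G : grid R) := [/\ mesh G = d,
  A `<=` box G & forall i j, (i < dim G)%N -> (j < dim G)%N ->
    (sel G i j <-> gcell G i j `<=` A)].

Lemma grid_outer A d G : grid_of A d G -> outer G `<=` A.
Proof.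
by move=> [_ _ H] z [i [j [s cz]]]; have [im jm] := sel_dim s; exact: (H i j im jm).1 s z cz.
Qed.

Lemma grid_inner A d G : grid_of A d G -> inner G `<=` A.
Proof. by move=> H z /inner_outer; exact: grid_outer H z. Qed.

Lemma grid_depth A d G : grid_of A d G -> 0 < d -> depth A (3 * d) `<=` inner G.
Proof.
move=> [md Ab H] d0 z zA; have d3 : 0 < 3 * d by lra.
split; first exact/Ab/(depth_sub d3 zA).
move=> i j im jm cz; apply/(H i j im jm) => w cw; apply: zA.
have := cell_diam (ltW (mesh_gt0 G)) cw cz; rewrite md; lra.
Qed.

Lemma cell_convex x y d (z w : R[i]) t : cell x y d z -> cell x y d w -> 0 <= t <= 1 ->
  cell x y d (z + t%:C * (w - z)).
Proof.
case: z => z1 z2; case: w => w1 w2 [/= /andP[a1 a2] /andP[a3 a4]].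
move=> [/= /andP[b1 b2] /andP[b3 b4]] /andP[t0 t1].
by split; apply/andP; split => /=; nra.
Qed.

(** A point of the box that is not inner lies in an unselected cell, and such a cell contains a
    point [p'] outside [A]. The segment from [p'] to [p] stays in that cell, hence outside
    [inner G], and the pole is pushed along it. *)
Lemma nice_inner A d G : nice A -> grid_of A d G -> nice (inner G).
Proof.
move=> nA GA e p e0 np.
have [pb|npb] := pselect (box G p); last first.
  have [|T HT] := nA e p e0; first by move=> /(let: And3 _ h _ := GA in h).
  by exists T => z /(depth_mono (grid_inner GA)); exact: HT.
have [i [j [im jm cp s]]] : exists i j, [/\ (i < dim G)%N, (j < dim G)%N, gcell G i j p & ~~ sel G i j].
  apply: contrapT => H; apply: np; split => // i j im jm cp.
  by apply: contrapT => /negP s; apply: H; exists i, j.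
have [p' cp' np'] : exists2 p', gcell G i j p' & ~ A p'.
  apply: contrapT => H; move/negP: s; apply.
  have [_ _ /(_ i j im jm) [_]] := GA; apply=> w cw.
  by apply: contrapT => nw; apply: H; exists w.
apply: (@pinv_push _ _ _ p') => // [t t01|].
  exact: gcell_notinner im jm (cell_convex cp' cp t01) s.
have [T HT] := nA e p' e0 np'.
by exists T => z /(depth_mono (grid_inner GA)); exact: HT.
Qed.

(** Midpoint sums formed in the polynomial ring, so that the approximant is a polynomial whose size
    does not grow with the number of nodes. *)
Fixpoint rsump n (P : R[i] -> {poly R[i]}) (a v : R[i]) : {poly R[i]} := if n is n.+1
  then rsump n P a (v / 2) + rsump n P (a + v / 2) (v / 2)
  else v *: P (a + v / 2).

Lemma horner_rsump n (P : R[i] -> {poly R[i]}) a v z : (rsump n P a v).[z] = rsum n (fun w => (P w).[z]) a v.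
Proof. by elim: n a v => [|n IH] a v /=; rewrite ?hornerD ?IH// hornerZ mulrC. Qed.

Lemma size_rsump n (P : R[i] -> {poly R[i]}) a v k : (forall w, (size (P w) <= k)%N) -> (size (rsump n P a v) <= k)%N.
Proof.
move=> Pk; elim: n a v => [|n IH] a v /=; first by apply: leq_trans (size_scale_leq _ _) _.
by apply: leq_trans (size_polyD _ _) _; rewrite geq_max !IH.
Qed.

(** [cauchy_inner] is pointwise. Since [C] keeps distance [e0] from the boundary, the boundary sums
    are Lipschitz in [z] with a constant [Q] independent of [n], and compactness makes the
    convergence uniform. *)
Lemma cauchy_uniform (G : grid R) (C : set R[i]) F e0 B : compact C -> 0 < e0 ->
  C `<=` depth (inner G) e0 -> (forall w, outer G w -> exists c, cder F w c) ->
  (forall w, outer G w -> N (F w) <= B) ->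
  forall e, 0 < e -> exists n, forall z, C z ->
    N (F z - (omega n)^-1 * bint G n (fun w => F w * (w - z)^-1)) <= e.
Proof.
move=> Cc e00 Cin dF FB e e_gt0.
have om0 n : omega n != 0 :> R[i] by rewrite -N_gt0 (lt_le_trans ltr01)// omega_ge1.
have om1 n : N (omega n : R[i])^-1 <= 1 by rewrite NV invf_le1 ?omega_ge1// N_gt0.
pose D n z := F z - (omega n)^-1 * bint G n (fun w => F w * (w - z)^-1).
have [[z0 Cz0]|/set0P/negP] := pselect (C !=set0); last first.
  by rewrite negbK => /eqP C0; exists 0 => z; rewrite C0.
have B0 : 0 <= B.
  by apply: le_trans (N_ge0 (F z0)) (FB _ _); apply/inner_outer/(depth_sub e00)/Cin.
pose Q := (2 * dim G * dim G)%N%:R * (B * (e0 ^- 2 * mesh G)).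
have dl0 := mesh_gt0 G.
have mN1 : mesh G = N (mesh G)%:C by rewrite N_real ger0_norm// ltW.
have mN2 : mesh G = N (0 +i* mesh G) by rewrite N_imag ger0_norm// ltW.
have Q0 : 0 <= Q by rewrite mulr_ge0// mulr_ge0// mulr_ge0 ?invr_ge0 ?exprn_ge0 ?ltW.
have lip n z z' : C z -> C z' -> N (D n z' - D n z) <= N (F z' - F z) + Q * N (z' - z).
  move=> Cz Cz'.
  have -> : D n z' - D n z = (F z' - F z) - (omega n)^-1 *
      bint G n (fun w => F w * (w - z')^-1 - F w * (w - z)^-1).
    by rewrite bintB /D; ring.
  apply: le_trans (NB _ _) _; rewrite lerD2l NM.
  rewrite -[X in _ <= X]mul1r; apply: ler_pM; rewrite ?N_ge0//.
  pose b := B * (e0 ^- 2 * N (z' - z)).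
  have bnd w : ~ inner G w -> outer G w -> N (F w * (w - z')^-1 - F w * (w - z)^-1) <= b.
    move=> nw ow.
    have h1 := depth_far (Cin z Cz) nw; have h2 := depth_far (Cin z' Cz') nw.
    have w1 : w - z != 0 by rewrite -N_gt0 distNC; lra.
    have w2 : w - z' != 0 by rewrite -N_gt0 distNC; lra.
    have -> : F w * (w - z')^-1 - F w * (w - z)^-1 = F w * ((z' - z) / ((w - z') * (w - z))).
      by field; rewrite w1.
    rewrite NM /b; apply: ler_pM; rewrite ?N_ge0 ?FB//.
    rewrite NM NV NM mulrC ler_wpM2r ?N_ge0// lef_pV2 ?posrE ?exprn_gt0 ?mulr_gt0 ?N_gt0//.
    by rewrite expr2 ![N (w - _)]distNC; apply: ler_pM; rewrite // ltW.
  have b0 : 0 <= b by rewrite mulr_ge0// mulr_ge0 ?N_ge0// invr_ge0 exprn_ge0// ltW.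
  have -> : Q * N (z' - z) = (2 * dim G * dim G)%N%:R * (b * mesh G) by rewrite /Q /b; ring.
  apply: bsum_bound; first by rewrite mulr_ge0// ltW.
    move=> i j k0; rewrite [X in _ <= _ * X]mN1.
    by apply: rsum_bound => t t01; have [h1 h2] := hedge_notinner k0 t01; exact: bnd.
  move=> i j k0; rewrite [X in _ <= _ * X]mN2.
  by apply: rsum_bound => t t01; have [h1 h2] := vedge_notinner k0 t01; exact: bnd.
have ptw z : C z -> tend0 (D^~ z).
  move=> Cz e1 e10; have iz : inner G z by apply/(depth_sub e00)/Cin.
  have [n0 Hn] := cauchy_inner dF iz e10; exists n0 => n /Hn.
  have -> : D n z = (omega n)^-1 * (F z * omega n - bint G n (fun w => F w * (w - z)^-1)).
    by rewrite /D; field.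
  move=> h; apply: le_trans h; rewrite NM -[X in _ <= X]mul1r; apply: ler_wpM2r; rewrite ?N_ge0//.
suff [n0 H] : exists n0, forall n, (n0 <= n)%N -> forall z, C z -> C z -> N (D n z) <= e.
  by exists n0 => z Cz; exact: H.
apply: (@compact_ind _ C (fun E => exists n0, forall n, (n0 <= n)%N ->
    forall z, E z -> C z -> N (D n z) <= e)) => //.
- by exists 0.
- move=> E E' [n H] [n' H']; exists (maxn n n') => k; rewrite geq_max => /andP[nk nk'] z [].
    exact: H.
  exact: H'.
- by move=> E E' EE [n H]; exists n => k nk z /EE; exact: H.
move=> z Cz; have e3 : 0 < e / 3 by rewrite divr_gt0.
have [c dFz] : exists c, cder F z c by apply/dF/inner_outer/(depth_sub e00)/Cin.
have [d d0 Hd] := cder_cont dFz e3.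
have [n0 Hn] := ptw z Cz _ e3.
have Q1 : 0 < Q + 1 by lra.
exists (Num.min d (e / 3 / (Q + 1))); first by rewrite lt_min d0 divr_gt0.
exists n0 => n /Hn h z' /=; rewrite lt_min => /andP[/Hd h1 h2] Cz'.
move: h2; rewrite ltr_pdivlMr// => h2; have := N_ge0 (z' - z).
rewrite -[D n z'](subrK (D n z)); have := ND (D n z' - D n z) (D n z).
have := lip n _ _ Cz Cz'; nra.
Qed.

(** In Cauchy's formula the kernel is replaced by a polynomial in [z] of size at most [M * k], with
    an error of order [(3 / 4) ^+ k]. [M] is uniform over the compact boundary, and [K] depends only
    on the grid and the margin [e], so neither depends on [F]; only the number of nodes does. *)
Lemma bernstein_walsh A d : bnd A -> nice A -> 0 < d ->
  exists L M (K : R), [/\ compact L, L `<=` A, depth A d `<=` L & 0 <= K /\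
    forall F B k, 0 < B -> (forall z, L z -> exists c, cder F z c) ->
      (forall z, L z -> N (F z) <= B) ->
      exists p : {poly R[i]}, (size p <= M * k)%N /\
        forall z, depth A d z -> N (F z - p.[z]) <= K * B * (3 / 4) ^+ k].
Proof.
move=> bA nA d0; have d6 : 0 < d / 6 by rewrite divr_gt0.
have [G GA] := exists_grid bA d6; have [md Ab H] := GA.
pose e := d / 2; have e0 : 0 < e by rewrite divr_gt0.
pose C := depth A d.
have Cin : C `<=` depth (inner G) e.
  move=> z zA w wz; apply: (grid_depth GA d6) => v vw; apply: zA.
  have := ND (v - w) (w - z); rewrite addrA subrK.
  by move: vw wz; rewrite /e; lra.
have nG := nice_inner nA GA.
have [M HM] : exists M, forall w, outer G w -> ~ inner G w -> exists T : {poly R[i]},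
    (size T <= M)%N /\ forall z, C z -> N (1 - T.[z] * (z - w)) <= 3 / 4.
  suff [M HM] : exists M, forall w, outer G w -> outer G w -> ~ inner G w -> exists T : {poly R[i]},
    (size T <= M)%N /\ forall z, C z -> N (1 - T.[z] * (z - w)) <= 3 / 4.
    by exists M => w ow; exact: HM.
  apply: (@compact_ind _ (outer G) (fun E => exists M, forall w, E w -> outer G w -> ~ inner G w ->
    exists T : {poly R[i]}, (size T <= M)%N /\ forall z, C z -> N (1 - T.[z] * (z - w)) <= 3 / 4)).
  - exact: compact_outer.
  - by exists 0.
  - move=> E E' [n Hn] [n' Hn']; exists (maxn n n') => w [Ew|Ew] ow iw.
      by have [T [sT HT]] := Hn w Ew ow iw; exists T; split => //; rewrite leq_max sT.
    by have [T [sT HT]] := Hn' w Ew ow iw; exists T; split => //; rewrite leq_max sT orbT.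
  - by move=> E E' EE [n Hn]; exists n => w /EE; exact: Hn.
  (* Near an inner [w] the condition is void. Near a boundary point one polynomial serves all close
     poles, by [pinv_near]. *)
  move=> w ow; have [iw|niw] := pselect (inner G w).
    have [r r0 Hr] := (openN _).1 (@open_inner _ G) w iw.
    by exists r => //; exists 0 => v /= /Hr ? _ /(_ _).
  have [T HT] := pinv_near (nG e w e0 niw).
  exists (e / 2); first by rewrite divr_gt0.
  exists (size T) => v /= vw _ _; exists T; split => // z /Cin zC.
  apply: HT => // u /depth_far /(_ niw) uw.
  by apply: le_trans (ltW vw) _; rewrite ler_pM2r.
have dl0 := mesh_gt0 G.
have mN1 : mesh G = N (mesh G)%:C by rewrite N_real ger0_norm// ltW.
have mN2 : mesh G = N (0 +i* mesh G) by rewrite N_imag ger0_norm// ltW.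
pose K := 1 + (2 * dim G * dim G)%N%:R * (e^-1 * mesh G).
exists (outer G), M, K; split.
- exact: compact_outer.
- exact: grid_outer GA.
- by move=> z /Cin/(depth_sub e0)/inner_outer.
have eg0 : 0 < e^-1 * mesh G by rewrite mulr_gt0 ?invr_gt0.
split; first by apply: addr_ge0 => //; apply: mulr_ge0 => //; exact: ltW.
move=> F B k B0 dF FB.
have q0 : 0 < (3 / 4) ^+ k :> R by rewrite exprn_gt0// divr_gt0.
have [n Hn] := cauchy_uniform (compact_depth bA d0) e0 Cin dF FB (mulr_gt0 B0 q0).
have [Tk HTk] : {Tk : R[i] -> {poly R[i]} & forall w, (size (Tk w) <= M * k)%N /\
   (outer G w -> ~ inner G w -> forall z, C z -> N (1 - (Tk w).[z] * (z - w)) <= (3 / 4) ^+ k)}.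
  apply: (@choice _ _ (fun w (T : {poly R[i]}) => (size T <= M * k)%N /\
   (outer G w -> ~ inner G w -> forall z, C z -> N (1 - T.[z] * (z - w)) <= (3 / 4) ^+ k))) => w.
  have [[ow niw]|nw] := pselect (outer G w /\ ~ inner G w); last first.
    by exists 0; rewrite size_poly0; split => // ow niw; exfalso; apply: nw.
  have [T [sT HT]] := HM w ow niw; have [S [sS HS]] := pinv_power w k sT.
  exists S; split => // _ _ z Cz; rewrite HS NX.
  by apply: lerXn2r; rewrite ?nnegrE ?N_ge0 ?HT.
(* [Tk w] approximates [1 / (z - w)], whence the minus sign. *)
pose P := bsum G (fun i j => rsump n (fun w => F w *: - Tk w) (pt G i j) (mesh G)%:C)
                 (fun i j => rsump n (fun w => F w *: - Tk w) (pt G i j) (0 +i* mesh G)).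
have sP : (size P <= M * k)%N.
  have s1 w : (size (F w *: - Tk w) <= M * k)%N.
    by apply: leq_trans (size_scale_leq _ _) _; rewrite size_polyN; have [] := HTk w.
  have s2 (b b' : bool) (u : {poly R[i]}) : (size u <= M * k)%N ->
      (size ((b%:R - b'%:R) * u)%R <= M * k)%N.
    have -> : (b%:R - b'%:R : {poly R[i]}) = (b%:R - b'%:R)%:P by rewrite polyCB !polyC_natr.
    by rewrite mul_polyC => su; apply: leq_trans (size_scale_leq _ _) _.
  apply: (leq_trans (size_sum _ _ _)); apply/bigmax_leqP_seq => i _ _.
  apply: (leq_trans (size_sum _ _ _)); apply/bigmax_leqP_seq => j _ _.
  by apply: leq_trans (size_polyD _ _) _; rewrite geq_max !s2// size_rsump.
exists ((omega n)^-1 *: P); split; first by apply: leq_trans (size_scale_leq _ _) _.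
move=> z Cz.
have hP : P.[z] = bint G n (fun w => F w * - (Tk w).[z]).
  have cE (b b' : bool) (u : {poly R[i]}) : ((b%:R - b'%:R) * u).[z] = (b%:R - b'%:R) * u.[z].
    have -> : (b%:R - b'%:R : {poly R[i]}) = (b%:R - b'%:R)%:P by rewrite polyCB !polyC_natr.
    by rewrite mul_polyC hornerZ.
  have rE a v : (rsump n (fun w => F w *: - Tk w) a v).[z] = rsum n (fun w => F w * - (Tk w).[z]) a v.
    by rewrite horner_rsump; apply: eq_rsum => t _; rewrite hornerZ hornerN.
  rewrite /P /bint /bsum horner_sum; apply: eq_bigr => i _.
  rewrite horner_sum; apply: eq_bigr => j _.
  by rewrite hornerD !cE !rE.
rewrite hornerZ hP.
have -> : F z - (omega n)^-1 * bint G n (fun w => F w * - (Tk w).[z]) =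
  (F z - (omega n)^-1 * bint G n (fun w => F w * (w - z)^-1)) +
  (omega n)^-1 * bint G n (fun w => F w * (w - z)^-1 - F w * - (Tk w).[z]).
  by rewrite bintB; ring.
have -> : K * B * (3 / 4) ^+ k = B * (3 / 4) ^+ k +
    (2 * dim G * dim G)%N%:R * (B * ((3 / 4) ^+ k / e) * mesh G) by rewrite /K; ring.
apply: le_trans (ND _ _) _; apply: lerD; first exact: Hn.
have om1 : N (omega n : R[i])^-1 <= 1.
  by rewrite NV invf_le1 ?omega_ge1// (lt_le_trans ltr01)// omega_ge1.
rewrite NM -[X in _ <= X]mul1r; apply: ler_pM; rewrite ?N_ge0//.
have b0 : 0 <= B * ((3 / 4) ^+ k / e) by rewrite mulr_ge0 ?divr_ge0 ?ltW.
have bw w : ~ inner G w -> outer G w ->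
    N (F w * (w - z)^-1 - F w * - (Tk w).[z]) <= B * ((3 / 4) ^+ k / e).
  move=> niw ow; have h1 := depth_far (Cin z Cz) niw.
  have w1 : w - z != 0 by rewrite -N_gt0 distNC; lra.
  have -> : F w * (w - z)^-1 - F w * - (Tk w).[z] =
     F w * ((1 - (Tk w).[z] * (z - w)) / (w - z)) by field.
  rewrite NM; apply: ler_pM; rewrite ?N_ge0 ?FB// NM NV.
  apply: ler_pM; rewrite ?invr_ge0 ?N_ge0//.
    by have [_ Hw] := HTk w; exact: Hw.
  by rewrite lef_pV2 ?posrE ?N_gt0// distNC.
apply: bsum_bound; first by rewrite mulr_ge0// ltW.
  move=> i j k0; rewrite [X in _ <= _ * X]mN1.
  by apply: rsum_bound => t t01; have [h1 h2] := hedge_notinner k0 t01; exact: bw.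
move=> i j k0; rewrite [X in _ <= _ * X]mN2.
by apply: rsum_bound => t t01; have [h1 h2] := vedge_notinner k0 t01; exact: bw.
Qed.

End BernsteinWalsh.

(** * Signed crossings of a gate *)

Section CrossingArithmetic.
Local Open Scope nat_scope.

Lemma row_cross (c d r : nat) : c <= d.+1 -> d <= c.+1 ->
  ~~ ((c <= r) && (d <= r)) -> ~~ ((r < c) && (r < d)) ->
  (c = r /\ d = r.+1) \/ (c = r.+1 /\ d = r).
Proof. lia. Qed.

Lemma row_cross_span (c d r : nat) : (c = r /\ d = r.+1) \/ (c = r.+1 /\ d = r) ->
  (minn c d <= r <= maxn c d) /\ (minn c d <= r.+1 <= maxn c d).
Proof. by case=> -[-> ->]; split; apply/andP; split; lia. Qed.

(** A discrete intermediate value argument: a range of columns that avoids [a.-1] and [b], and lies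
    neither wholly left nor wholly right of the gate, lies in it. *)
Lemma col_gate (a b c d : nat) : 0 < a ->
  ~~ (minn c d <= a.-1 <= maxn c d) -> ~~ (minn c d <= b <= maxn c d) ->
  ~~ ((c < a) && (d < a)) -> ~~ ((b <= c) && (b <= d)) ->
  (a <= c < b) /\ (a <= d < b).
Proof. lia. Qed.

Lemma no_cross_row (c d r : nat) :
  c = d \/ (c <= r /\ d <= r) \/ (r < c /\ r < d) ->
  (c == r) && (d == r.+1) = false /\ (c == r.+1) && (d == r) = false.
Proof. by move=> H; split; apply/negbTE/negP => /andP[/eqP h1 /eqP h2]; lia. Qed.

End CrossingArithmetic.

Section GateSeparation.
Context {R : realType} (G : grid R).
Implicit Types (z w u v : R[i]) (c : nat * nat).
Let dl := mesh G.
Let dl0 : 0 < dl := mesh_gt0 G.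

Lemma poly_primitive (T : {poly R[i]}) : exists P : {poly R[i]}, P^`() = T.
Proof.
exists (\sum_(i < size T) (T`_i / i.+1%:R) *: 'X^(i.+1)).
rewrite raddf_sum /= -[RHS]coefK poly_def; apply: eq_bigr => i _.
rewrite derivZ derivXn -[X in _ *: X]scaler_nat scalerA divfK// pnatr_eq0.
Qed.

(* Moebius map sending the gate between [p] and [q] to the negative reals *)
Lemma mobius_ReIm (x1 x2 y : R) z : z - (x2 +i* y) != 0 ->
  let n := (complex.Re z - x2) ^+ 2 + (complex.Im z - y) ^+ 2 in
  [/\ 0 < n,
   complex.Re ((z - (x1 +i* y)) / (z - (x2 +i* y))) =
     ((complex.Re z - x1) * (complex.Re z - x2) + (complex.Im z - y) ^+ 2) / n &
   complex.Im ((z - (x1 +i* y)) / (z - (x2 +i* y))) =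
     (complex.Im z - y) * (x1 - x2) / n].
Proof.
case: z => a b; set q := _ - _ => q0 n.
have qE : q = (a - x2) +i* (b - y) by [].
have n0 : 0 < n.
  rewrite lt_def addr_ge0 ?sqr_ge0// andbT; apply: contra q0.
  rewrite /n paddr_eq0 ?sqr_ge0// !sqrf_eq0 qE => /andP[/eqP h1 /eqP h2].
  by rewrite eq_complex; apply/andP; split; apply/eqP.
have iq : q^-1 = ((a - x2) / n) +i* (- ((b - y) / n)).
  apply: (mulIf q0); rewrite mulVf// qE; ceq => /=.
rewrite iq; have -> : (a +i* b) - (x1 +i* y) = (a - x1) +i* (b - y) by [].
by split => //=; ring.
Qed.

Definition span_full (c c' : nat * nat) := forall i j,
  (minn c.1 c'.1 <= i <= maxn c.1 c'.1)%N -> (minn c.2 c'.2 <= j <= maxn c.2 c'.2)%N -> sel G i j.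

(** Columns may jump, rows change by at most one: a step then crosses at most one horizontal grid
    line, and long horizontal moves count as one step. *)
Definition cell_adj (c c' : nat * nat) :=
  [/\ (c.2 <= c'.2.+1)%N, (c'.2 <= c.2.+1)%N & span_full c c'].

Definition center (c : nat * nat) : R[i] := (px G c.1 + dl / 2) +i* (py G c.2 + dl / 2).

Let pxM i j : (i <= j)%N -> px G i <= px G j.
Proof. by move=> ij; rewrite /px lerD2l ler_pM2r// ler_nat. Qed.
Let pyM i j : (i <= j)%N -> py G i <= py G j.
Proof. by move=> ij; rewrite /py lerD2l ler_pM2r// ler_nat. Qed.

Definition orect i1 i2 j1 j2 := [set z : R[i] | px G i1 < complex.Re z < px G i2.+1 /\
  py G j1 < complex.Im z < py G j2.+1].

Definition full i1 i2 j1 j2 := forall i j, (i1 <= i <= i2)%N -> (j1 <= j <= j2)%N -> sel G i j.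

Lemma px_lt i j : px G i < px G j -> (i < j)%N.
Proof. by move=> h; rewrite ltnNge; apply/negP => /pxM; lra. Qed.
Lemma py_lt i j : py G i < py G j -> (i < j)%N.
Proof. by move=> h; rewrite ltnNge; apply/negP => /pyM; lra. Qed.

Lemma orect_inner i1 i2 j1 j2 : full i1 i2 j1 j2 -> orect i1 i2 j1 j2 `<=` inner G.
Proof.
move=> F z [/andP[x1 x2] /andP[y1 y2]].
have i12 : (i1 <= i2)%N by rewrite -ltnS; apply: px_lt; lra.
have j12 : (j1 <= j2)%N by rewrite -ltnS; apply: py_lt; lra.
have [a1 _ a3 _] := sel_inside (F i1 j1 (introT andP (conj (leqnn _) i12)) (introT andP (conj (leqnn _) j12))).
have [_ a2 _ a4] := sel_inside (F i2 j2 (introT andP (conj i12 (leqnn _))) (introT andP (conj j12 (leqnn _)))).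
split.
  have b1 := pxM (leq0n i1); have b2 := pxM (ltnW a2).
  have b3 := pyM (leq0n j1); have b4 := pyM (ltnW a4).
  by split; apply/andP; split; lra.
move=> i j _ _ [/andP[u1 u2] /andP[v1 v2]]; rewrite -pxS in u2; rewrite -pyS in v2.
apply: F; apply/andP; split; rewrite -ltnS.
- by apply: px_lt; lra.
- by apply: px_lt; lra.
- by apply: py_lt; lra.
- by apply: py_lt; lra.
Qed.

Lemma center_orect c i1 i2 j1 j2 : (i1 <= c.1 <= i2)%N -> (j1 <= c.2 <= j2)%N ->
  orect i1 i2 j1 j2 (center c).
Proof.
move=> /andP[/pxM h1]; rewrite -ltnS => /pxM h2 /andP[/pyM h3]; rewrite -ltnS => /pyM h4.
rewrite pxS in h2; rewrite pyS in h4; have d2 := dl0.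
by rewrite -/dl in h2 h4; split; apply/andP; split => /=; lra.
Qed.

Let conv_gt (A x y t : R) : A < x -> A < y -> 0 <= t <= 1 -> A < x + t * (y - x).
Proof.
move=> Ax Ay /andP[t0 t1]; case: (leP x y) => xy.
  have : 0 <= t * (y - x) by apply: mulr_ge0; lra.
  lra.
have : 0 <= (1 - t) * (x - y) by apply: mulr_ge0; lra.
lra.
Qed.

Let conv_lt (A x y t : R) : x < A -> y < A -> 0 <= t <= 1 -> x + t * (y - x) < A.
Proof.
move=> xA yA t01; have xA' : - A < - x by lra.
have yA' : - A < - y by lra.
by have := conv_gt xA' yA' t01; lra.
Qed.

Lemma Re_segment z w (t : R) :
  complex.Re (z + t%:C * (w - z)) = complex.Re z + t * (complex.Re w - complex.Re z).
Proof. by case: z w => [? ?] [? ?] /=; ring. Qed.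

Lemma Im_segment z w (t : R) :
  complex.Im (z + t%:C * (w - z)) = complex.Im z + t * (complex.Im w - complex.Im z).
Proof. by case: z w => [? ?] [? ?] /=; ring. Qed.

Lemma orect_convex i1 i2 j1 j2 z w (t : R) : orect i1 i2 j1 j2 z -> orect i1 i2 j1 j2 w ->
  0 <= t <= 1 -> orect i1 i2 j1 j2 (z + t%:C * (w - z)).
Proof.
move=> [/andP[a1 a2] /andP[a3 a4]] [/andP[b1 b2] /andP[b3 b4]] t01.
by split; rewrite ?Re_segment ?Im_segment; apply/andP; split;
  (exact: conv_gt || exact: conv_lt).
Qed.

(** The uniform margin [dl / 2] is what lets one polynomial primitive serve every step of a walk. *)
Lemma center_segment_depth c c' (t : R) : span_full c c' -> 0 <= t <= 1 ->
  depth (inner G) (dl / 2) (center c + t%:C * (center c' - center c)).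
Proof.
move=> F /andP[t0 t1] w wz.
have F' : full (minn c.1 c'.1) (maxn c.1 c'.1) (minn c.2 c'.2) (maxn c.2 c'.2) by exact: F.
apply: (orect_inner F').
have := pxM (geq_minl c.1 c'.1); have := pxM (geq_minr c.1 c'.1).
have := pyM (geq_minl c.2 c'.2); have := pyM (geq_minr c.2 c'.2).
have := pxM (leq_maxl c.1 c'.1); have := pxM (leq_maxr c.1 c'.1).
have := pyM (leq_maxl c.2 c'.2); have := pyM (leq_maxr c.2 c'.2).
have := le_lt_trans (N_Re _) wz; have := le_lt_trans (N_Im _) wz.
rewrite ReB ImB Re_segment Im_segment !ltr_norml /orect /= !pxS !pyS -/dl.
set x1 := px G c.1; set x2 := px G c'.1; set y1 := py G c.2; set y2 := py G c'.2.
move=> /andP[w1 w2] /andP[w3 w4] h1 h2 h3 h4 h5 h6 h7 h8.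
have cv (a b m M : R) : m <= a -> m <= b -> a <= M -> b <= M ->
    m <= a + t * (b - a) <= M by move=> ? ? ? ?; apply/andP; split; nra.
have /andP[e1 e2] := cv _ _ _ _ h6 h5 h2 h1.
have /andP[e3 e4] := cv _ _ _ _ h8 h7 h4 h3.
by split; apply/andP; split; lra.
Qed.

Section Gate.
Context (a b r : nat).
Context (gate_full : forall x, (a <= x < b)%N -> sel G x r && sel G x r.+1)
  (gate_l : ~~ (sel G a.-1 r && sel G a.-1 r.+1))
  (gate_r : ~~ (sel G b r && sel G b r.+1)) (ab : (a < b)%N).

(* signed crossing of the gate formed by the cells [(i, r)], [(i, r.+1)], [a <= i < b] *)
Definition gsign (c c' : nat * nat) : R :=
  if (a <= c.1 < b)%N then
    if (c.2 == r) && (c'.2 == r.+1) then 1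
    else if (c.2 == r.+1) && (c'.2 == r) then -1 else 0
  else 0.

Let p : R[i] := px G a +i* py G r.+1.
Let q : R[i] := px G b +i* py G r.+1.

Let a_gt0 : (0 < a)%N.
Proof.
have /andP[s _] : sel G a r && sel G a r.+1 by apply: gate_full; rewrite leqnn ab.
by have [] := sel_inside s.
Qed.

Let selb : sel G b.-1 r && sel G b.-1 r.+1.
Proof. by apply: gate_full; lia. Qed.

(** Maximality of the gate: one of the two cells just beyond its left end is not selected, and that
    cell touches [p]. *)
Let p_out : ~ inner G p.
Proof.
have /andP[s s'] : sel G a r && sel G a r.+1 by apply: gate_full; rewrite leqnn ab.
have [am rm] := sel_dim s; have [_ r1m] := sel_dim s'.
have am' : (a.-1 < dim G)%N by lia.
have pa : px G a = px G a.-1 + dl by rewrite -[in LHS](prednK a_gt0) pxS.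
have d1 := dl0; case/nandP: gate_l => /negP ns [_ H]; apply: ns; apply: H => //.
  by split; rewrite /p /= ?pa ?pyS -/dl; apply/andP; split; lra.
by split; rewrite /p /= ?pa -/dl; apply/andP; split; lra.
Qed.

Let q_out : ~ inner G q.
Proof.
have /andP[s s'] := selb; have [_ b2 _ _] := sel_inside s.
have [_ rm] := sel_dim s; have [_ r1m] := sel_dim s'.
have bm : (b < dim G)%N by lia.
have d1 := dl0; case/nandP: gate_r => /negP ns [_ H]; apply: ns; apply: H => //.
  by split; rewrite /q /= ?pyS -/dl; apply/andP; split; lra.
by split; rewrite /q /= -?/dl; apply/andP; split; lra.
Qed.

Let W z := (z - p) / (z - q).
Let g z := (z - p)^-1 - (z - q)^-1.

Let cder_logW (s : R[i]) z : s != 0 -> z - p != 0 -> z - q != 0 -> slit_plane (s * W z) ->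
  cder (fun z => logC (s * W z)) z (g z).
Proof.
move=> s0 zp zq sl.
have dq := cderM (cder_cst s z) (cderM (cderB (cder_id z) (cder_cst p z))
     (cderV (cderB (cder_id z) (cder_cst q z)) zq)).
have := cder_comp dq (cder_logC sl).
congr cder; rewrite /g /W; field; by rewrite s0 zp zq.
Qed.

Let cont_g z : z - p != 0 -> z - q != 0 -> ccont g z.
Proof.
move=> zp zq; apply: cder_cont (cderB (cderV (cderB (cder_id z) (cder_cst p z)) zp)
     (cderV (cderB (cder_id z) (cder_cst q z)) zq)).
Qed.

Let pab : px G a < px G b.
Proof. by apply: lt_le_trans (pxM ab); rewrite pxS ltrDl. Qed.

Let y0 := py G r.+1.

(** [W] is real only on the line of the gate, and negative there exactly between [p] and [q]. So
    [logC (W z)] is regular off the gate, while [logC (- W z)], treated next, is regular off the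
    rest of the line. *)
Let slit_out z : z - q != 0 -> complex.Im z <> y0 \/ complex.Re z < px G a \/ px G b < complex.Re z ->
  slit_plane (1 * W z).
Proof.
move=> zq H; rewrite mul1r; apply/slit_planeE; have [n0 e1 e2] := mobius_ReIm (px G a) zq.
rewrite /W e1 e2; have [yz|yz] := eqVneq (complex.Im z) y0; last first.
  left; apply: mulf_neq0; last by rewrite invr_eq0 gt_eqF.
  by apply: mulf_neq0; rewrite subr_eq0 ?(lt_eqF pab).
right; rewrite divr_gt0// yz -/y0 subrr expr0n /= addr0; have := pab => ab'.
case: H => // -[h|h]; last by apply: mulr_gt0; lra.
by rewrite -mulrNN; apply: mulr_gt0; lra.
Qed.

Let slit_in z : z - q != 0 -> complex.Im z <> y0 \/ px G a < complex.Re z < px G b ->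
  slit_plane (-1 * W z).
Proof.
move=> zq H; rewrite mulN1r; apply/slit_planeE; have [n0 e1 e2] := mobius_ReIm (px G a) zq.
have ReN u : complex.Re (- u) = - complex.Re u :> R by case: u.
have ImN u : complex.Im (- u) = - complex.Im u :> R by case: u.
rewrite ReN ImN /W e1 e2; have [yz|yz] := eqVneq (complex.Im z) y0; last first.
  left; rewrite oppr_eq0; apply: mulf_neq0; last by rewrite invr_eq0 gt_eqF.
  by apply: mulf_neq0; rewrite subr_eq0 ?(lt_eqF pab).
right; rewrite -mulNr divr_gt0//; case: H => // /andP[h1 h2].
by rewrite yz -/y0 subrr expr0n /= addr0 -mulrN; apply: mulr_gt0; lra.
Qed.

Let poly_g e : nice (inner G) -> 0 < e -> exists P : {poly R[i]},
  forall z, depth (inner G) (dl / 2) z -> N (P.[z] - g z) <= e.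
Proof.
move=> nG e0; have d2 : 0 < dl / 2 by rewrite divr_gt0.
have app (s : R[i]) e1 : ~ inner G s -> 0 < e1 -> exists T : {poly R[i]},
    forall z, depth (inner G) (dl / 2) z -> N (T.[z] - (z - s)^-1) <= e1.
  move=> ns e10; have [T HT] := nG _ _ d2 ns.
  have [k Hk] : exists k, (3 / 4) ^+ k <= e1 * (dl / 2).
    have := @cvg_geometric R 1 (3 / 4).
    rewrite ger0_norm; last by rewrite divr_ge0.
    have -> : 3 / 4 < 1 :> R by lra.
    move=> /(_ isT) /cvgrPdist_lt /(_ _ (mulr_gt0 e10 d2))[n _ /(_ n (leqnn n))] /=.
    rewrite sub0r normrN /geometric /= mul1r => h; exists n.
    by apply: le_trans (ler_norm _) (ltW h).
  have [S [_ HS]] := @pinv_power _ T s (size T) k (leqnn _).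
  exists S => z zd; have zs := depth_far zd ns.
  have z0 : z - s != 0 by rewrite -N_gt0; lra.
  have -> : S.[z] - (z - s)^-1 = - ((1 - S.[z] * (z - s)) / (z - s)) by field.
  rewrite NN NM NV HS NX ler_pdivrMr ?N_gt0//.
  apply: (@le_trans _ _ ((3 / 4) ^+ k)).
    by apply: lerXn2r; rewrite ?nnegrE ?N_ge0 ?divr_ge0 ?HT.
  by apply: le_trans Hk _; rewrite ler_pM2l.
have e2 : 0 < e / 2 by rewrite divr_gt0.
have [T1 H1] := app p _ p_out e2; have [T2 H2] := app q _ q_out e2.
exists (T1 - T2) => z zd; rewrite hornerD hornerN /g.
have -> : T1.[z] - T2.[z] - ((z - p)^-1 - (z - q)^-1) =
  (T1.[z] - (z - p)^-1) - (T2.[z] - (z - q)^-1) by ring.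
by apply: le_trans (NB _ _) _; have := H1 z zd; have := H2 z zd; lra.
Qed.

Let lam z := logC (1 * W z).

Let depth_neq z : depth (inner G) (dl / 2) z -> z - p != 0 /\ z - q != 0.
Proof.
move=> zd; have d2 : 0 < dl / 2 by rewrite divr_gt0.
have := depth_far zd p_out; have := depth_far zd q_out.
by split; rewrite -N_gt0; lra.
Qed.

Let gap (s : R[i]) (P : {poly R[i]}) e z w : s != 0 ->
  (forall t : R, 0 <= t <= 1 -> let v := z + t%:C * (w - z) in
     [/\ depth (inner G) (dl / 2) v, slit_plane (s * W v) & N ((P^`()).[v] - g v) <= e]) ->
  N ((logC (s * W w) - P.[w]) - (logC (s * W z) - P.[z])) <= e * N (w - z).
Proof.
move=> s0 H; pose f v := logC (s * W v) - P.[v].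
have := @mean_value_le _ f (fun v => g v - (P^`()).[v]) z (w - z) e.
rewrite [X in f X]addrC subrK; apply=> t /H[vd sl h].
- have [vp vq] := depth_neq vd.
  exact: cderB (cder_logW s0 vp vq sl) (cder_horner _ _).
- have [vp vq] := depth_neq vd.
  have cP := cder_cont (cder_horner P^`() (z + t%:C * (w - z))).
  move=> e1 e10; have e12 : 0 < e1 / 2 by rewrite divr_gt0.
  have [d1 d10 h1] := cont_g vp vq e12; have [d2 d20 h2] := cP _ e12.
  exists (Num.min d1 d2); first by rewrite lt_min d10.
  move=> u; rewrite lt_min => /andP[/h1 a1 /h2 a2].
  set v := z + _ in a1 a2 *.
  have -> : g u - P^`().[u] - (g v - P^`().[v]) = (g u - g v) - (P^`().[u] - P^`().[v]) by ring.
  by apply: le_lt_trans (NB _ _) _; lra.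
- by rewrite distNC.
Qed.

(* A step through the gate changes the argument of [(z - p) / (z - q)] by a
   full turn relative to the (single valued) polynomial primitive. *)
Let step (P : {poly R[i]}) e c c' : 0 <= e ->
  (forall z, depth (inner G) (dl / 2) z -> N ((P^`()).[z] - g z) <= e) ->
  cell_adj c c' ->
  N ((lam (center c') - P.[center c']) - (lam (center c) - P.[center c])
     + (0 +i* (2 * pi)) * (gsign c c')%:C) <= e * N (center c' - center c).
Proof.
move=> e0 HP [r1 r2 F].
have T (t : R) : 0 <= t <= 1 -> depth (inner G) (dl / 2) (center c + t%:C * (center c' - center c)).
  exact: center_segment_depth.
have Im_c k : complex.Im (center k) = py G k.2 + dl / 2 by [].
have Re_c k : complex.Re (center k) = px G k.1 + dl / 2 by [].
have d1 := dl0.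
have below k : (k <= r)%N -> py G k + dl / 2 < y0.
  by rewrite -ltnS => /pyM; rewrite pyS -/y0 -/dl; lra.
have above k : (r < k)%N -> y0 < py G k + dl / 2 by move=> /pyM; rewrite -/y0; lra.
have left k : (k < a)%N -> px G k + dl / 2 < px G a.
  by move=> /pxM; rewrite pxS -/dl; lra.
have right k : (b <= k)%N -> px G b < px G k + dl / 2 by move=> /pxM; lra.
have gl k : (a <= k)%N -> px G a < px G k + dl / 2 by move=> /pxM; lra.
have gr k : (k < b)%N -> px G k + dl / 2 < px G b.
  by move=> /pxM; rewrite pxS -/dl; lra.
have out : (forall t : R, 0 <= t <= 1 -> let v := center c + t%:C * (center c' - center c) in
     complex.Im v <> y0 \/ complex.Re v < px G a \/ px G b < complex.Re v) ->
    N ((lam (center c') - P.[center c']) - (lam (center c) - P.[center c]))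
      <= e * N (center c' - center c).
  move=> H; apply: gap; first exact: oner_neq0.
  move=> t t01 v; have vd := T t t01; have [vp vq] := depth_neq vd.
  by split; [exact: vd|apply: slit_out vq (H t t01)|exact: HP].
have noc : c.2 = c'.2 \/ (c.2 <= r /\ c'.2 <= r)%N \/ (r < c.2 /\ r < c'.2)%N ->
    gsign c c' = 0.
  by move=> /no_cross_row[h1 h2]; rewrite /gsign h1 h2; case: ifP.
have [low|nlow] := boolP ((c.2 <= r) && (c'.2 <= r))%N.
  move/andP: low => [l1 l2]; rewrite noc; last by right; left.
  rewrite mulr0 addr0; apply: out => t t01 v; left.
  rewrite /v Im_segment; have := conv_lt (below _ l1) (below _ l2) t01; rewrite !Im_c => h1 h2.
  by move: h1; rewrite h2 ltxx.
have [up|nup] := boolP ((r < c.2) && (r < c'.2))%N.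
  move/andP: up => [l1 l2]; rewrite noc; last by right; right.
  rewrite mulr0 addr0; apply: out => t t01 v; left.
  rewrite /v Im_segment; have := conv_gt (above _ l1) (above _ l2) t01; rewrite !Im_c => h1 h2.
  by move: h1; rewrite h2 ltxx.
have cross : (c.2 = r /\ c'.2 = r.+1) \/ (c.2 = r.+1 /\ c'.2 = r).
  exact: row_cross r1 r2 nlow nup.
have Fb x : (minn c.1 c'.1 <= x <= maxn c.1 c'.1)%N -> sel G x r && sel G x r.+1.
  by have [h1 h2] := row_cross_span cross => xx; apply/andP; split; apply: F.
have [la|nla] := boolP ((c.1 < a) && (c'.1 < a))%N.
  move/andP: la => [l1 l2].
  have -> : gsign c c' = 0 by rewrite /gsign leqNgt l1.
  rewrite mulr0 addr0; apply: out => t t01 v; right; left.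
  by rewrite /v Re_segment !Re_c; exact: conv_lt (left _ l1) (left _ l2) t01.
have [lb|nlb] := boolP ((b <= c.1) && (b <= c'.1))%N.
  move/andP: lb => [l1 l2].
  have -> : gsign c c' = 0 by rewrite /gsign ltnNge l1 andbF.
  rewrite mulr0 addr0; apply: out => t t01 v; right; right.
  by rewrite /v Re_segment !Re_c; exact: conv_gt (right _ l1) (right _ l2) t01.
(* All columns spanned by a crossing step are selected in both rows, so by maximality the span
   avoids [a.-1] and [b]: the step passes through the gate. *)
have [ca cb] : (a <= c.1 < b)%N /\ (a <= c'.1 < b)%N.
  have na : ~~ (minn c.1 c'.1 <= a.-1 <= maxn c.1 c'.1)%N by apply: contra gate_l => /Fb.
  have nb : ~~ (minn c.1 c'.1 <= b <= maxn c.1 c'.1)%N by apply: contra gate_r => /Fb.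
  exact: col_gate a_gt0 na nb nla nlb.
have inn : N ((logC (-1 * W (center c')) - P.[center c']) - (logC (-1 * W (center c)) - P.[center c]))
      <= e * N (center c' - center c).
  apply: gap; first by rewrite oppr_eq0 oner_eq0.
  move=> t t01 v; have vd := T t t01; have [vp vq] := depth_neq vd.
  split; [exact: vd| |exact: HP]; apply: slit_in vq _; right.
  move/andP: ca => [ca1 ca2]; move/andP: cb => [cb1 cb2].
  rewrite /v Re_segment !Re_c; apply/andP; split.
    exact: conv_gt (gl _ ca1) (gl _ cb1) t01.
  exact: conv_lt (gr _ ca2) (gr _ cb2) t01.
have ImW k : k = c \/ k = c' -> complex.Im (W (center k)) =
   (complex.Im (center k) - y0) * (px G a - px G b) /
   ((complex.Re (center k) - px G b) ^+ 2 + (complex.Im (center k) - y0) ^+ 2) /\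
   0 < (complex.Re (center k) - px G b) ^+ 2 + (complex.Im (center k) - y0) ^+ 2.
  move=> kc; have kd : depth (inner G) (dl / 2) (center k).
    case: kc => ->; [have := T 0 (introT andP (conj (lexx _) ler01))|have := T 1 (introT andP (conj ler01 (lexx _)))].
      by rewrite rmorph0 mul0r addr0.
    by rewrite rmorph1 mul1r addrC subrK.
  have [_ kq] := depth_neq kd.
  by have [n0 _ e2] := mobius_ReIm (px G a) kq.
(* Inside the gate the estimate holds for the other branch [logC (- W)]. Converting back adds [i pi]
   below the line and subtracts it above, which makes up the full turn. *)
have Wlow k : k = c \/ k = c' -> k.2 = r -> lam (center k) = logC (-1 * W (center k)) + (0 +i* pi).
  move=> kc kr; have [e1 n0] := ImW k kc.
  have Ip : 0 < complex.Im (W (center k)).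
    rewrite e1 divr_gt0// nmulr_lgt0 ?subr_lt0 ?pab//.
    by rewrite Im_c kr; have := below r (leqnn _); lra.
  by rewrite /lam mul1r mulN1r logCN ?gt_eqF// Ip; ring.
have Wup k : k = c \/ k = c' -> k.2 = r.+1 -> lam (center k) = logC (-1 * W (center k)) - (0 +i* pi).
  move=> kc kr; have [e1 n0] := ImW k kc.
  have Ip : complex.Im (W (center k)) < 0.
    rewrite e1 -oppr_gt0 -mulNr divr_gt0// -mulrN pmulr_rgt0 ?oppr_gt0 ?subr_lt0 ?pab//.
    by rewrite Im_c kr; have := above r.+1 (leqnn _); lra.
  rewrite /lam mul1r mulN1r logCN ?lt_eqF// ltNge ltW//=.
  have -> : (0 +i* - pi) = - (0 +i* pi) :> R[i] by ceq => /=; ring.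
  by ring.
have pi2 : (0 +i* (2 * pi)) = 2 * (0 +i* pi) :> R[i] by rewrite mulr_natl mulr2n; ceq => /=; ring.
case: cross => -[k1 k2].
  have -> : gsign c c' = 1 by rewrite /gsign ca k1 k2 !eqxx.
  rewrite (Wlow c (or_introl erefl) k1) (Wup c' (or_intror erefl) k2) pi2 rmorph1.
  by apply: le_trans inn; rewrite le_eqVlt; apply/orP; left; apply/eqP; congr (N _); ring.
have -> : gsign c c' = -1.
  by rewrite /gsign ca k1 k2 !eqxx (gtn_eqF (ltnSn r)).
rewrite (Wlow c' (or_intror erefl) k2) (Wup c (or_introl erefl) k1) pi2 rmorphN1.
by apply: le_trans inn; rewrite le_eqVlt; apply/orP; left; apply/eqP; congr (N _); ring.
Qed.

(** Along the closed polygon [lam - P] returns to its start, while every step changes it by [2 pi i]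
    times minus its sign, up to [e] times its length. So [2 pi] times the modulus of the total sign
    is at most [e * Len] for every positive [e]. The closing segment stays in one row and has sign
    0. *)
Lemma gate_separates (wk : nat -> nat * nat) n : nice (inner G) ->
  (forall k, (k < n)%N -> cell_adj (wk k) (wk k.+1)) ->
  (wk 0).2 = (wk n).2 -> span_full (wk 0) (wk n) ->
  \sum_(0 <= k < n) gsign (wk k) (wk k.+1) = 0.
Proof.
move=> nG adj e2 F0; set s := \sum_(0 <= k < n) _.
pose V k := center (wk k).
pose Len := \sum_(0 <= k < n) N (V k.+1 - V k) + N (V n - V 0).
have Len0 : 0 <= Len by rewrite addr_ge0 ?N_ge0// sumr_ge0// => k _; exact: N_ge0.
have H e : 0 < e -> 2 * pi * `|s| <= e * Len.
  move=> e0; have [T HT] := poly_g nG e0; have [P dP] := poly_primitive T.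
  have HP z : depth (inner G) (dl / 2) z -> N ((P^`()).[z] - g z) <= e by rewrite dP; exact: HT.
  pose f k := lam (V k) - P.[V k].
  have partial m : (m <= n)%N -> N (f m - f 0%N + (0 +i* (2 * pi)) *
      (\sum_(0 <= k < m) gsign (wk k) (wk k.+1))%:C) <= e * \sum_(0 <= k < m) N (V k.+1 - V k).
    elim: m => [_|m IH mn]; first by rewrite !big_geq// subrr rmorph0 !mulr0 addr0 N0.
    rewrite !big_nat_recr//= rmorphD [X in _ <= X]mulrDr.
    apply: le_trans (lerD (IH (ltnW mn)) (step (ltW e0) HP (adj m mn))).
    apply: le_trans (ND _ _); rewrite le_eqVlt; apply/orP; left; apply/eqP; congr (N _).
    by rewrite /f /V; ring.
  have last : N (f n - f 0%N) <= e * N (V n - V 0).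
    have adj0 : cell_adj (wk 0) (wk n) by split; rewrite ?e2.
    have := step (ltW e0) HP adj0.
    have -> : gsign (wk 0) (wk n) = 0.
      by have [h1 h2] := @no_cross_row _ _ r (or_introl e2); rewrite /gsign h1 h2; case: ifP.
    by rewrite mulr0 addr0.
  have := partial n (leqnn n); rewrite -/s => h.
  have -> : 2 * pi * `|s| = N ((0 +i* (2 * pi)) * s%:C).
    by rewrite NM N_imag N_real [`|2 * pi|]ger0_norm// mulr_ge0// pi_ge0.
  have -> : (0 +i* (2 * pi)) * s%:C = (f n - f 0%N + (0 +i* (2 * pi)) * s%:C) - (f n - f 0%N) by ring.
  by apply: le_trans (NB _ _) _; rewrite /Len [X in _ <= X]mulrDr lerD.
apply/eqP; rewrite -normr_eq0 eq_le normr_ge0 andbT leNgt; apply/negP => s0.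
have ps : 0 < 2 * pi * `|s| by rewrite !mulr_gt0// pi_gt0.
have L1 : 0 < Len + 1 by lra.
set X := 2 * pi * `|s| in H ps *.
have := H (X / (Len + 1)) (divr_gt0 ps L1).
by rewrite mulrAC ler_pdivlMr// mulrDr mulr1; lra.
Qed.

End Gate.
End GateSeparation.

(** * Shortening closed walks of cells *)

Section SpanArithmetic.
Local Open Scope nat_scope.

Lemma between_trans (c d e x : nat) : minn c e <= x <= maxn c e ->
  (minn c d <= x <= maxn c d) \/ (minn d e <= x <= maxn d e).
Proof. lia. Qed.

Lemma between3 (c d e x : nat) : minn c (minn d e) <= x <= maxn c (maxn d e) ->
  (minn c d <= x <= maxn c d) \/ (minn d e <= x <= maxn d e).
Proof. lia. Qed.

Lemma between_interval (a b c d x : nat) : a <= c < b -> a <= d < b ->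
  minn c d <= x <= maxn c d -> a <= x < b.
Proof. lia. Qed.

Lemma between_same (r x : nat) : minn r r <= x <= maxn r r -> x = r.
Proof. lia. Qed.

Lemma between_l (c d : nat) : minn c d <= c <= maxn c d.
Proof. lia. Qed.

Lemma between_r (c d : nat) : minn c d <= d <= maxn c d.
Proof. lia. Qed.

Lemma min_max3 (c d e : nat) : let m := minn c (minn d e) in let M := maxn c (maxn d e) in
  [/\ m <= c <= M, m <= d <= M & m <= e <= M].
Proof. by split; lia. Qed.

End SpanArithmetic.

Section WalkReduction.
Context {R : realType} (G : grid R).
Implicit Types (wk : nat -> nat * nat) (c : nat * nat) (n : nat).

Lemma span_row_trans (c d e : nat * nat) : c.2 = d.2 -> d.2 = e.2 ->
  span_full G c d -> span_full G d e -> span_full G c e.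
Proof.
move=> cd de F1 F2 i j /between_trans hi; rewrite cd de => /between_same ->.
case: (hi d.1) => h; [apply: F1 => //|apply: F2 => //]; rewrite ?cd ?de; exact: between_l.
Qed.

Definition walk wk n := forall k, (k < n)%N -> cell_adj G (wk k) (wk k.+1).

Lemma walk_shift wk n p m : walk wk n -> (p + m <= n)%N -> walk (fun k => wk (p + k)%N) m.
Proof. by move=> W pm k km; rewrite addnS; apply: W; apply: leq_trans pm; rewrite ltn_add2l. Qed.

Lemma walk_row wk n p q : walk wk n -> (p <= q)%N -> (q < n)%N ->
  (forall k, (p <= k <= q)%N -> (wk k).2 = (wk p).2) -> span_full G (wk p) (wk q).
Proof.
move=> W pq qn; elim: q pq qn => [|q IH].
  rewrite leqn0 => /eqP -> n0 _; have [_ _ F] := W 0 n0 => i j /between_same -> /between_same ->.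
  by apply: F; exact: between_l.
rewrite leq_eqVlt => /predU1P[<-|].
  move=> n0 _; have [_ _ F] := W p n0 => i j /between_same -> /between_same ->.
  by apply: F; exact: between_l.
rewrite ltnS => pq qn H.
have [_ _ F] := W q (ltn_trans (ltnSn _) qn).
apply: (span_row_trans _ _ (IH pq (ltn_trans (ltnSn _) qn) _) F).
- by rewrite [RHS]H ?pq//= leqnSn.
- by rewrite H ?pq ?leqnSn// [RHS]H// leqnn leqW.
- by move=> k /andP[pk kq]; apply: H; rewrite pk leqW.
Qed.

Definition qgate r x := sel G x r && sel G x r.+1.

Lemma gate_exists r x : qgate r x -> exists a b : nat,
  [/\ (a <= x < b)%N, forall y, (a <= y < b)%N -> qgate r y, ~~ qgate r a.-1 & ~~ qgate r b].
Proof.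
move=> qx.
have exb : exists y, (x <= y)%N && ~~ qgate r y.
  exists (maxn x (dim G)); rewrite leq_maxl /=; apply/negP => /andP[/sel_dim[h _] _].
  by move: h; rewrite ltnNge leq_maxr.
have [b /andP[xb nqb] bmin] := ex_minnP exb.
have exa : exists y, (y <= x)%N && ~~ qgate r y.
  by exists 0; rewrite leq0n /=; apply/negP => /andP[/sel_inside[]].
have ub y : (y <= x)%N && ~~ qgate r y -> (y <= x)%N by case/andP.
have [a /andP[ax nqa] amax] := ex_maxnP exa ub.
have ax' : (a < x)%N by rewrite ltn_neqAle ax andbT; apply: contraNneq nqa => ->.
have xb' : (x < b)%N by rewrite ltn_neqAle xb andbT; apply: contraNneq nqb => <-.
exists a.+1, b; split => //; first by rewrite ax' xb'.
move=> y /andP[ay yb]; apply: contraT => nq.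
have [yx|xy] := leqP y x; first by have := amax y; rewrite yx nq leqNgt ay => /(_ isT).
by have := bmin y; rewrite (ltnW xy) nq leqNgt yb => /(_ isT).
Qed.

Lemma gsign_neq0 a b r (c d : nat * nat) : @gsign R a b r c d != 0 ->
  (a <= c.1 < b)%N /\ ((c.2 = r /\ d.2 = r.+1) \/ (c.2 = r.+1 /\ d.2 = r)).
Proof.
rewrite /gsign; case: ifP; last by rewrite eqxx.
move=> ca; case: ifP => [/andP[/eqP h1 /eqP h2] _|_]; first by split => //; left.
by case: ifP => [/andP[/eqP h1 /eqP h2] _|_]; [split => //; right|rewrite eqxx].
Qed.

Lemma gsign_cross a b r (c d : nat * nat) : (a <= c.1 < b)%N ->
  (c.2 = r /\ d.2 = r.+1) \/ (c.2 = r.+1 /\ d.2 = r) -> @gsign R a b r c d != 0.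
Proof.
rewrite /gsign => -> [[-> ->]|[-> ->]]; first by rewrite !eqxx oner_eq0.
by rewrite (gtn_eqF (ltnSn r)) !eqxx oppr_eq0 oner_eq0.
Qed.

Lemma gsign_row a b r (c d : nat * nat) : c.2 = d.2 -> @gsign R a b r c d = 0.
Proof.
by move=> e; have [h1 h2] := @no_cross_row _ _ r (or_introl e); rewrite /gsign h1 h2; case: ifP.
Qed.

(** An excursion into a neighbouring row that returns through the gate by which it left. All cells
    of the gate are selected in both rows, so the excursion can be pushed back. *)
Definition backtracks wk i j := [/\ (i < j)%N, (wk i).2 <> (wk i.+1).2, (wk j.+1).2 = (wk i).2,
  forall k, (i < k <= j)%N -> (wk k).2 = (wk i.+1).2 &
  exists a b, forall c, c \in [:: wk i; wk i.+1; wk j; wk j.+1] -> (a <= c.1 < b)%N /\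
    (forall x, (a <= x < b)%N -> sel G x (wk i).2 && sel G x (wk i.+1).2)].

(* By [gate_separates] a closed walk crosses each gate with total sign 0, hence in
   both directions; an innermost pair of opposite crossings is a backtrack. *)
Lemma exists_backtrack wk n : nice (inner G) -> walk wk n -> forall l p q,
  (q - p <= l)%N -> (p < q)%N -> (q <= n)%N ->
  (wk p).2 = (wk q).2 -> span_full G (wk p) (wk q) ->
  (exists k, (p <= k < q)%N /\ (wk k).2 <> (wk k.+1).2) ->
  exists i j, [/\ (p <= i)%N, (j < q)%N & backtracks wk i j].
Proof.
move=> nG W; elim=> [|l IH] p q.
  by rewrite leqn0 subn_eq0 leqNgt => /negPf->.
move=> ql pq qn rpq Fpq [k0 [/andP[pk0 k0q] /eqP nk0]].
have ex0 : exists k, (p <= k)%N && ((wk k).2 != (wk k.+1).2) by exists k0; rewrite pk0.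
have [i /andP[pi /eqP ni] imin] := ex_minnP ex0.
have iq : (i < q)%N by apply: leq_ltn_trans k0q; apply: imin; rewrite pk0.
have before k : (p <= k < i)%N -> (wk k).2 = (wk k.+1).2.
  by move=> /andP[pk ki]; apply: contraTeq ki => nk; rewrite -leqNgt; apply: imin; rewrite pk.
have [ar1 ar2 Fi] := W i (leq_trans iq qn).
pose r := minn (wk i).2 (wk i.+1).2.
have ci : ((wk i).2 = r /\ (wk i.+1).2 = r.+1) \/ ((wk i).2 = r.+1 /\ (wk i.+1).2 = r).
  by rewrite /r; move: ar1 ar2 ni; move: (wk i).2 (wk i.+1).2 => u v; clear; lia.
have [hr1 hr2] := row_cross_span ci.
have qg x : (minn (wk i).1 (wk i.+1).1 <= x <= maxn (wk i).1 (wk i.+1).1)%N -> qgate r x.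
  by move=> xx; apply/andP; split; apply: Fi.
have [a [b [ab_i gfull gl gr]]] := gate_exists (qg _ (between_l _ _)).
have ab : (a < b)%N by case/andP: ab_i; exact: leq_ltn_trans.
have inab (c : nat) : qgate r c -> (forall x, (minn (wk i).1 c <= x <= maxn (wk i).1 c)%N -> qgate r x) ->
    (a <= c < b)%N.
  move=> qc H; move/andP: ab_i => [h1 h2]; apply/andP; split; [rewrite leqNgt|rewrite ltnNge]; apply/negP => hc.
    have a0 : (0 < a)%N by apply: leq_ltn_trans hc.
    move/negP: gl; apply; apply: H.
    by clear -hc h1 h2 a0; lia.
  by move/negP: gr; apply; apply: H; clear -hc h1 h2; lia.
have ab_i1 : (a <= (wk i.+1).1 < b)%N by apply: inab => //; apply: qg; exact: between_r.
pose gs k : R := @gsign R a b r (wk k) (wk k.+1).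
have gsi : gs i != 0 by apply: gsign_cross.
have sep u v : (u <= v)%N -> (v <= n)%N -> (wk u).2 = (wk v).2 -> span_full G (wk u) (wk v) ->
    \sum_(u <= k < v) gs k = 0.
  move=> uv vn ruv Fuv.
  have Wu : walk (fun k => wk (u + k)%N) (v - u) by apply: walk_shift W _; rewrite subnKC.
  have := @gate_separates _ G a b r gfull gl gr ab (fun k => wk (u + k)%N) (v - u) nG Wu.
  rewrite addn0 subnKC// => /(_ ruv Fuv) h; rewrite -[RHS]h.
  have -> : \sum_(u <= k < v) gs k = \sum_(0 + u <= k < v) gs k by rewrite add0n.
  by rewrite big_addn; apply: eq_bigr => k _; rewrite /gs addnC addnS.
have single u v : (u <= i < v)%N -> (forall k, (u <= k < v)%N -> k != i -> gs k = 0) ->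
    \sum_(u <= k < v) gs k = gs i.
  move=> uiv H; rewrite (bigD1_seq i) ?iota_uniq ?mem_index_iota//= big_seq_cond big1 ?addr0//.
  by move=> k /andP[]; rewrite mem_index_iota => /H.
(* The gate must be crossed again after [i]: otherwise the total over [[p, q)] would be the single
   nonzero term [gs i]. *)
have ex1 : exists k, (i < k < q)%N && (gs k != 0).
  apply: contrapT => H; move/negP: gsi; apply; apply/eqP.
  rewrite -(@single p q); first exact: sep (ltnW pq) qn rpq Fpq.
    by rewrite pi iq.
  move=> k /andP[pk kq]; case: (ltngtP k i) => // [ki|ik] _.
    by apply: gsign_row; apply: before; rewrite pk.
  by apply/eqP/negP => /negP g0; apply: H; exists k; rewrite ik kq.
have [j /andP[/andP[ij jq] gj] jmin] := ex_minnP ex1.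
have [ab_j cj] := gsign_neq0 gj.
have jn : (j < n)%N by exact: leq_trans jq qn.
have [_ _ Fj] := W j jn.
have [hj1 hj2] := row_cross_span cj.
have qgj x : (minn (wk j).1 (wk j.+1).1 <= x <= maxn (wk j).1 (wk j.+1).1)%N -> qgate r x.
  by move=> xx; apply/andP; split; apply: Fj.
have ab_j1 : (a <= (wk j.+1).1 < b)%N.
  apply: inab; first by apply: qgj; exact: between_r.
  move=> x /(between_trans (wk j).1)[|/qgj//] h.
  by apply: gfull; apply: between_interval ab_i ab_j h.
have gspan (c d : nat * nat) : (a <= c.1 < b)%N -> (a <= d.1 < b)%N -> c.2 = d.2 ->
    c.2 = r \/ c.2 = r.+1 -> span_full G c d.
  move=> ca da cd cr x y xx; rewrite -cd => /between_same ->.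
  by have /andP[s1 s2] := gfull x (between_interval ca da xx); case: cr => ->.
(* The next crossing goes the opposite way: otherwise the piece from [i] to [j] would close up
   within the gate while containing only the crossing at [i]. *)
have rji : (wk j).2 <> (wk i).2.
  move=> rji; move/negP: gsi; apply; apply/eqP.
  rewrite -(@single i j); last 2 first.
  - by rewrite leqnn ij.
  - move=> k /andP[ik kj] ki; apply/eqP/negP => /negP g0.
    have : (j <= k)%N.
      by apply: jmin; rewrite g0 andbT ltn_neqAle eq_sym ki ik (ltn_trans kj jq).
    by rewrite leqNgt kj.
  apply: sep (ltnW ij) (ltnW jn) (esym rji) _; apply: gspan => //; case: ci => -[-> _]; by [left|right].
have rj1 : (wk j).2 = (wk i.+1).2.
  by case: ci cj rji => -[-> ->] [] [-> _].
have rj2 : (wk j.+1).2 = (wk i).2.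
  by case: ci cj rj1 => -[-> ->] [] [-> ->] //; clear; lia.
have Fij : span_full G (wk i.+1) (wk j).
  by apply: gspan => //; case: ci => -[_ ->]; [right|left].
have gatei : forall c, c \in [:: wk i; wk i.+1; wk j; wk j.+1] -> (a <= c.1 < b)%N /\
    (forall x, (a <= x < b)%N -> sel G x (wk i).2 && sel G x (wk i.+1).2).
  move=> c; rewrite !inE => /or4P[] /eqP ->; split => // x /gfull/andP[s1 s2];
    by apply/andP; case: ci => -[-> ->].
(* A further row change between the two crossings lies in the shorter closed piece from [i.+1] to
   [j], to which the induction applies. *)
have [[k [/andP[ik kj] nk]]|nc] := pselect (exists k, (i.+1 <= k < j)%N /\ (wk k).2 <> (wk k.+1).2).
  have [||||||i' [j' [h1 h2 h3]]] := IH i.+1 j.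
  - by move: ql pi jq; clear; lia.
  - by exact: leq_ltn_trans ik kj.
  - exact: ltnW.
  - by [].
  - exact: Fij.
  - by exists k; rewrite ik.
  - by exists i', j'; split => //; [exact: leq_trans (ltnW h1)|exact: ltn_trans h2 jq].
exists i, j; split => //; split => //; last by exists a, b.
move=> k; elim: k => [//|k IHk] /andP[ik kj].
move: ik; rewrite leq_eqVlt => /predU1P[[->//]|ik].
rewrite -(IHk _); last by rewrite ltnS in ik; rewrite ik ltnW.
apply/esym; apply: contrapT => nk; apply: nc; exists k; split => //.
by rewrite -ltnS ik kj.
Qed.

End WalkReduction.

Section NullWalk.
Context {R : realType} (G : grid R).
Implicit Types (wk : nat -> nat * nat) (n : nat).

(** For each [k] one full rectangle contains the [k]-th edges of both walks, so the straight-line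
    homotopy between the two polygons stays in the region. *)
Definition wstep n (w w' : nat -> nat * nat) := [/\ w' 0 = w 0, w' n = w n &
  forall k, (k < n)%N -> exists i1 i2 j1 j2, full G i1 i2 j1 j2 /\
    forall c : nat * nat, c \in [:: w k; w k.+1; w' k; w' k.+1] ->
      (i1 <= c.1 <= i2)%N /\ (j1 <= c.2 <= j2)%N].

Inductive wsteps n : (nat -> nat * nat) -> (nat -> nat * nat) -> Prop :=
| wsteps_refl w : wsteps n w w
| wsteps_step w w' w'' : wstep n w w' -> wsteps n w' w'' -> wsteps n w w''.

Lemma wsteps_trans n w w' w'' : wsteps n w w' -> wsteps n w' w'' -> wsteps n w w''.
Proof. by elim=> // u u' u'' s _ IH /IH; exact: wsteps_step. Qed.

Let rect2 (c d c' d' : nat * nat) : span_full G c d ->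
  c' \in [:: c; d] -> d' \in [:: c; d] -> exists i1 i2 j1 j2, full G i1 i2 j1 j2 /\
    forall e : nat * nat, e \in [:: c; d; c'; d'] -> (i1 <= e.1 <= i2)%N /\ (j1 <= e.2 <= j2)%N.
Proof.
move=> F hc hd; exists (minn c.1 d.1), (maxn c.1 d.1), (minn c.2 d.2), (maxn c.2 d.2).
split; first exact: F.
have H e : e \in [:: c; d] -> (minn c.1 d.1 <= e.1 <= maxn c.1 d.1)%N /\
    (minn c.2 d.2 <= e.2 <= maxn c.2 d.2)%N.
  by rewrite !inE => /orP[]/eqP ->; rewrite ?between_l ?between_r.
move=> e; rewrite !inE => /or4P[/eqP->|/eqP->|/eqP->|/eqP->]; apply: H => //;
  by rewrite !inE eqxx ?orbT.
Qed.

Let rect3 (b c d c' d' : nat * nat) : b.2 = c.2 -> c.2 = d.2 ->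
  span_full G b c -> span_full G c d ->
  c' \in [:: b; c; d] -> d' \in [:: b; c; d] -> exists i1 i2 j1 j2, full G i1 i2 j1 j2 /\
    forall e : nat * nat, e \in [:: c; d; c'; d'] -> (i1 <= e.1 <= i2)%N /\ (j1 <= e.2 <= j2)%N.
Proof.
move=> bc cd F1 F2 hc hd.
exists (minn b.1 (minn c.1 d.1)), (maxn b.1 (maxn c.1 d.1)), c.2, c.2; split.
  move=> x y /between3 hx hy; have -> : y = c.2 by apply/eqP; rewrite eqn_leq andbC.
  case: hx => hx; [apply: F1 => //|apply: F2 => //]; rewrite ?bc -?cd; exact: between_l.
have H e : e \in [:: b; c; d] -> (minn b.1 (minn c.1 d.1) <= e.1 <= maxn b.1 (maxn c.1 d.1))%N /\
    (c.2 <= e.2 <= c.2)%N.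
  have [m1 m2 m3] := min_max3 b.1 c.1 d.1.
  by rewrite !inE => /or3P[]/eqP ->; split; rewrite ?bc -?cd ?leqnn.
move=> e; rewrite !inE => /or4P[/eqP->|/eqP->|/eqP->|/eqP->]; apply: H => //;
  by rewrite !inE eqxx ?orbT.
Qed.

Let rect_gate (c d c' d' : nat * nat) a b r r' :
  (r' <= r.+1)%N -> (r <= r'.+1)%N ->
  (forall x, (a <= x < b)%N -> sel G x r && sel G x r') ->
  (forall e : nat * nat, e \in [:: c; d; c'; d'] -> (a <= e.1 < b)%N /\ (e.2 = r \/ e.2 = r')) ->
  exists i1 i2 j1 j2, full G i1 i2 j1 j2 /\
    forall e : nat * nat, e \in [:: c; d; c'; d'] -> (i1 <= e.1 <= i2)%N /\ (j1 <= e.2 <= j2)%N.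
Proof.
move=> h1 h2 gf H; exists a, b.-1, (minn r r'), (maxn r r'); split.
  move=> x y hx hy; have /gf/andP[s1 s2] : (a <= x < b)%N.
    have [/andP[c1 c2] _] := H c (mem_head _ _).
    by clear -hx c1 c2; lia.
  have [->|->] // : y = r \/ y = r' by clear -h1 h2 hy; lia.
move=> e /H[ab er]; split; first by clear -ab; lia.
by clear -er; case: er => ->; lia.
Qed.

Definition crossings wk n := (\sum_(k < n) ((wk k).2 != (wk k.+1).2))%N.

(** Induction on the number of row changes, each round flattening one backtrack. The length [n] is
    kept fixed and cells are repeated instead of deleted, so that walks remain comparable index by
    index. *)
Lemma walk_reduce m wk n : nice (inner G) -> (crossings wk n <= m)%N -> walk G wk n -> wk 0 = wk n ->
  exists w', [/\ wsteps n wk w', walk G w' n, w' 0 = wk 0, w' n = wk n &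
    forall k, (k <= n)%N -> (w' k).2 = (wk 0).2].
Proof.
move=> nG; elim: m wk => [|m IH] wk cr W w0n.
  exists wk; split => //; first exact: wsteps_refl.
  elim=> [//|k IHk] kn; rewrite -(IHk (ltnW kn)).
  move: cr; rewrite /crossings leqn0 sum_nat_eq0 => /forallP /(_ (Ordinal kn)) /=.
  by rewrite eqb0 negbK => /eqP.
have [ex|nex] := pselect (exists k, (0 <= k < n)%N /\ (wk k).2 <> (wk k.+1).2); last first.
  exists wk; split => //; first exact: wsteps_refl.
  elim=> [//|k IHk] kn; rewrite -(IHk (ltnW kn)).
  by apply/esym; apply: contrapT => nk; apply: nex; exists k.
have n0 : (0 < n)%N by case: ex => k [/andP[_ kn] _]; apply: leq_ltn_trans kn.
have F0 : span_full G (wk 0) (wk n).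
  rewrite -w0n; have [_ _ F] := W 0 n0 => i j /between_same -> /between_same ->.
  by apply: F; exact: between_l.
have r0n : (wk 0).2 = (wk n).2 by rewrite w0n.
have [i [j [_ jn [ij ni rj rk [a [b gf]]]]]] :=
  exists_backtrack nG W (leqnn _) n0 (leqnn n) r0n F0 ex.
have iN : (i < n)%N by exact: ltn_trans ij jn.
(* Two moves: the excursion is first collapsed to its initial cell [wk i.+1] in the neighbouring
   row, and then carried through the gate to [wk i]. *)
pose w1 k := if (i < k <= j)%N then wk i.+1 else wk k.
pose w2 k := if (i < k <= j)%N then wk i else wk k.
have [ar1 ar2 Fi] := W i iN.
have rj' : (wk j).2 = (wk i.+1).2 by apply: rk; rewrite ij leqnn.
have gm c : c \in [:: wk i; wk i.+1; wk j; wk j.+1] -> (a <= c.1 < b)%N by move=> /gf[].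
have [_ gfull] := gf (wk i) (mem_head _ _).
have gi : (a <= (wk i).1 < b)%N by apply: gm; rewrite !inE eqxx.
have gi1 : (a <= (wk i.+1).1 < b)%N by apply: gm; rewrite !inE eqxx orbT.
have gj : (a <= (wk j).1 < b)%N by apply: gm; rewrite !inE eqxx !orbT.
have gj1 : (a <= (wk j.+1).1 < b)%N by apply: gm; rewrite !inE eqxx !orbT.
have ii : span_full G (wk i) (wk i).
  move=> x y /between_same -> /between_same ->.
  by apply: Fi; exact: between_l.
have row k : (i < k)%N -> (k <= j)%N -> span_full G (wk i.+1) (wk k).
  move=> ik kj; apply: (walk_row W) => //; first exact: leq_ltn_trans kj jn.
  move=> l /andP[il lk]; rewrite rk ?il ?(leq_trans lk)//.
have s01 : wstep n wk w1.
  split.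
  - by rewrite /w1 ltn0.
  - by rewrite /w1 [(n <= j)%N]leqNgt jn andbF.
  move=> k kn; rewrite /w1; have [_ _ Fk] := W k kn.
  have [ki|ik|->] := ltngtP k i.
  - have -> : (i < k.+1)%N = false by rewrite ltnNge ki.
    by apply: rect2 Fk _ _; rewrite !inE eqxx ?orbT.
  - rewrite ltnS (ltnW ik) /=; have [kj|jk|kj] := ltngtP k j.
    + apply: (rect3 _ _ (row k ik (ltnW kj)) Fk); rewrite ?inE ?eqxx//.
        by rewrite [RHS]rk ?ik ?(ltnW kj).
      by rewrite !rk ?ik ?(ltnW kj)//= ltnS ltnW.
    + by apply: rect2 Fk _ _; rewrite !inE eqxx ?orbT.
    rewrite kj; apply: (@rect_gate _ _ _ _ a b (wk i).2 (wk i.+1).2) => //.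
    move=> e; rewrite !inE => /or4P[]/eqP ->; split => //; by [right|left|rewrite rj'; right].
  rewrite ltnSn ij /=; by apply: rect2 Fi _ _; rewrite !inE eqxx ?orbT.
have s12 : wstep n w1 w2.
  split.
  - by rewrite /w1 /w2 ltn0.
  - by rewrite /w1 /w2 [(n <= j)%N]leqNgt jn andbF.
  move=> k kn; rewrite /w1 /w2; have [_ _ Fk] := W k kn.
  have [ki|ik|->] := ltngtP k i.
  - have -> : (i < k.+1)%N = false by rewrite ltnNge ki.
    by apply: rect2 Fk _ _; rewrite !inE eqxx ?orbT.
  - rewrite ltnS (ltnW ik) /=; have [kj|jk|kj] := ltngtP k j.
    + have [i1 [i2 [j1 [j2 [H1 H2]]]]] := rect2 (c' := wk i) (d' := wk i) Fi
         (mem_head _ _) (mem_head _ _).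
      exists i1, i2, j1, j2; split => // e He; apply: H2; move: He; rewrite !inE.
      by case/or4P => ->; rewrite ?orbT.
    + by apply: rect2 Fk _ _; rewrite !inE eqxx ?orbT.
    rewrite ?kj ?ltnn; apply: (@rect_gate _ _ _ _ a b (wk i).2 (wk i.+1).2) => //.
    move=> e; rewrite !inE => /or4P[]/eqP ->; split => //; by [right|left].
  by rewrite ltnSn ij /=; apply: rect2 Fi _ _; rewrite !inE eqxx ?orbT.
have W2 : walk G w2 n.
  move=> k kn; rewrite /w2; have Wk := W k kn.
  have [ki|ik|->] := ltngtP k i.
  - by have -> : (i < k.+1)%N = false by rewrite ltnNge ki.
  - rewrite ltnS (ltnW ik) /=; have [kj|jk|kj] := ltngtP k j => //.
    rewrite kj; split; rewrite ?rj// => x y /(between_interval gi gj1) /gfull/andP[s1 _].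
    by rewrite rj => /between_same ->.
  by rewrite ltnSn ij.
(* The row change at [i] disappears and no new one arises, since [wk i] and [wk j.+1] are in the
   same row. *)
have cr2 : (crossings w2 n <= m)%N.
  rewrite -ltnS; apply: leq_trans cr; rewrite /crossings.
  rewrite (bigD1 (Ordinal iN)) //= [X in (_ < X)%N](bigD1 (Ordinal iN)) //=.
  have -> : ((w2 i).2 != (w2 i.+1).2) = false by rewrite /w2 ltnn ltnSn ij eqxx.
  have -> : ((wk i).2 != (wk i.+1).2) by apply/eqP.
  rewrite add0n add1n ltnS; apply: leq_sum => k ki.
  have {}ki : (k : nat) != i by apply: contra ki => /eqP ki; apply/eqP/val_inj.
  rewrite /w2; case: (ltngtP k i) ki => // [ki|ik] _.
    by have -> : (i < k.+1)%N = false by rewrite ltnNge ki.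
  rewrite ltnS (ltnW ik) /=; have [kj|jk|kj] := ltngtP k j => //.
    by rewrite eqxx.
  by rewrite kj rj eqxx.
have w20 : w2 0 = wk 0 by rewrite /w2 ltn0.
have w2n : w2 n = wk n by rewrite /w2 [(n <= j)%N]leqNgt jn andbF.
have [|w' [h1 h2 h3 h4 h5]] := IH w2 cr2 W2; first by rewrite w20 w2n.
exists w'; split => //; rewrite ?h3 ?h4 ?w20 ?w2n//.
exact: wsteps_step s01 (wsteps_step s12 h1).
Qed.

(** Once all cells share a row, each is joined to the first by selected cells of that row, and one
    more move collapses the walk. *)
Lemma walk_null wk n : nice (inner G) -> walk G wk n -> wk 0 = wk n ->
  wsteps n wk (fun=> wk 0).
Proof.
move=> nG W w0n; have [w' [h1 h2 h3 h4 h5]] := walk_reduce nG (leqnn _) W w0n.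
apply: (wsteps_trans h1); apply: wsteps_step (wsteps_refl _ _); split => //.
  by rewrite h4.
move=> k kn; have [_ _ Fk] := h2 k kn.
apply: (rect3 (b := wk 0) _ _ _ Fk); rewrite ?inE ?eqxx//.
- by rewrite h5// ltnW.
- by rewrite !h5// ltnW.
rewrite -h3; apply: (walk_row h2) => // l /andP[_ lk].
by rewrite !h5// (leq_trans lk)// ltnW.
Qed.

End NullWalk.

(** * Homotopies through chains of loops *)

Section Homotopy.
Context {R : realType}.
Implicit Types (f g : R -> R[i]) (s t u d e : R).

Definition rcont f := forall t e, 0 < e -> exists2 d, 0 < d &
  forall s, `|s - t| < d -> N (f s - f t) < e.

Definition hcont (h : R * R -> R[i]) := forall p e, 0 < e -> exists2 d, 0 < d &
  forall q, `|q.1 - p.1| < d -> `|q.2 - p.2| < d -> N (h q - h p) < e.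

Definition clamp t := Num.max 0 (Num.min 1 t).

Lemma clamp_itv t : 0 <= clamp t <= 1.
Proof. by rewrite /clamp le_max lexx ge_max ler01 ge_min lexx. Qed.

Lemma clamp_id t : 0 <= t <= 1 -> clamp t = t.
Proof. by move=> /andP[t0 t1]; rewrite /clamp min_r// max_r. Qed.

Lemma clamp0 t : t <= 0 -> clamp t = 0.
Proof. by move=> t0; rewrite /clamp max_l// ge_min t0 orbT. Qed.

Lemma clamp1 t : 1 <= t -> clamp t = 1.
Proof. by move=> t1; rewrite /clamp min_l// max_r. Qed.

Lemma clamp_lip s t : `|clamp s - clamp t| <= `|s - t|.
Proof.
have C x : [\/ x <= 0 /\ clamp x = 0, (0 <= x /\ x <= 1) /\ clamp x = x | 1 <= x /\ clamp x = 1].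
  have [x0|x0] := leP x 0; first by constructor 1; rewrite clamp0.
  have [x1|x1] := leP x 1; first by constructor 2; rewrite clamp_id ?x1 ?ltW.
  by constructor 3; rewrite clamp1 ltW.
have := ler_norm (s - t); have := ler_norm (t - s); rewrite [`|t - s|]distrC => h1 h2.
rewrite ler_norml; have := normr_ge0 (s - t).
by case: (C s) => -[? ->]; case: (C t) => -[? ->] ?; apply/andP; split; lra.
Qed.

Lemma hcont_cst (c : R[i]) : hcont (fun=> c).
Proof. by move=> p e e0; exists 1 => // q _ _; rewrite subrr N0. Qed.

Lemma hcontD h h' : hcont h -> hcont h' -> hcont (fun p => h p + h' p).
Proof.
move=> H H' p e e0; have e2 : 0 < e / 2 by rewrite divr_gt0.
have [d d0 Hd] := H p _ e2; have [d' d'0 Hd'] := H' p _ e2.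
exists (Num.min d d'); first by rewrite lt_min d0.
move=> q; rewrite !lt_min => /andP[a1 a2] /andP[b1 b2].
have -> : h q + h' q - (h p + h' p) = (h q - h p) + (h' q - h' p) by ring.
by apply: le_lt_trans (ND _ _) _; have := Hd q a1 b1; have := Hd' q a2 b2; lra.
Qed.

Lemma hcontM h h' : hcont h -> hcont h' -> hcont (fun p => h p * h' p).
Proof.
move=> H H' p e e0.
pose B := 1 + N (h p) + N (h' p).
have B0 : 0 < B by rewrite /B; have := N_ge0 (h p); have := N_ge0 (h' p); lra.
pose e1 := Num.min 1 (e / (2 * B)).
have e10 : 0 < e1 by rewrite lt_min ltr01 divr_gt0// mulr_gt0.
have e11 : e1 <= 1 by rewrite ge_min lexx.
have e1B : e1 * B <= e / 2.
  have : e1 <= e / (2 * B) by rewrite ge_min lexx orbT.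
  rewrite ler_pdivlMr ?mulr_gt0// mulrCA; set x := e1 * B; lra.
have [d d0 Hd] := H p _ e10; have [d' d'0 Hd'] := H' p _ e10.
exists (Num.min d d'); first by rewrite lt_min d0.
move=> q; rewrite !lt_min => /andP[a1 a2] /andP[b1 b2].
have -> : h q * h' q - h p * h' p =
  (h q - h p) * (h' q - h' p) + (h p * (h' q - h' p) + (h q - h p) * h' p) by ring.
apply: le_lt_trans (ND _ _) _; apply: le_lt_trans (lerD (lexx _) (ND _ _)) _.
rewrite !NM; have k1 := Hd q a1 b1; have k2 := Hd' q a2 b2.
have t1 := ler_pM (N_ge0 _) (N_ge0 _) (ltW k1) (ltW k2).
have t2 : N (h p) * N (h' q - h' p) <= N (h p) * e1 by rewrite ler_wpM2l ?N_ge0 ?ltW.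
have t3 : N (h q - h p) * N (h' p) <= e1 * N (h' p) by rewrite ler_wpM2r ?N_ge0 ?ltW.
have t4 : e1 * e1 <= e1 * 1 by rewrite ler_pM2l.
move: e1B; rewrite /B !mulrDr mulr1 => e1B; lra.
Qed.

Lemma hcont_sum (h : nat -> R * R -> R[i]) n : (forall k, hcont (h k)) ->
  hcont (fun p => \sum_(0 <= k < n) h k p).
Proof.
move=> H; elim: n => [|n IH] p e e0.
  by exists 1 => // q _ _; rewrite !big_geq// subrr N0.
have [d d0 Hd] := hcontD IH (H n) p e0; exists d => // q q1 q2.
by rewrite !big_nat_recr//=; exact: Hd.
Qed.

Lemma hcont_clamp (a c : R) : hcont (fun p => (clamp (a * p.1 - c))%:C).
Proof.
move=> p e e0; have a0 : 0 < 1 + `|a| by have := normr_ge0 a; lra.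
exists (e / (1 + `|a|)); first by rewrite divr_gt0.
move=> q q1 _; rewrite -rmorphB N_real; apply: le_lt_trans (clamp_lip _ _) _.
have -> : a * q.1 - c - (a * p.1 - c) = a * (q.1 - p.1) by ring.
move: q1; rewrite normrM ltr_pdivlMr//; have := normr_ge0 (q.1 - p.1); lra.
Qed.

Lemma hcont_snd f : rcont f -> hcont (fun p => f p.2).
Proof. by move=> H p e e0; have [d d0 Hd] := H p.2 e e0; exists d => // q _; exact: Hd. Qed.

(** Piecewise linear interpolation of [v 0], ..., [v n]: the [k]-th clamp switches on the [k]-th
    increment during the [k]-th subinterval. One closed formula gives continuity without gluing. *)
Definition plin (v : nat -> R[i]) n t :=
  v 0%N + \sum_(0 <= k < n) (clamp (n%:R * t - k%:R))%:C * (v k.+1 - v k).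

Lemma rcont_plin v n : rcont (plin v n).
Proof.
move=> t e e0.
have H : hcont (fun p => plin v n p.1).
  apply: hcontD (hcont_cst _) _; apply: hcont_sum => k.
  by apply: hcontM (hcont_clamp _ _) (hcont_cst _).
have [d d0 Hd] := H (t, 0) e e0; exists d => // s st.
by apply: (Hd (s, 0)) => //=; rewrite subrr normr0.
Qed.

(** The index and the parameter depend on [t] alone, so different interpolations can be compared at
    the same time [t]. *)
Lemma plin_at n t : (0 < n)%N -> 0 <= t <= 1 -> exists k u, [/\ (k < n)%N, 0 <= u <= 1,
  n%:R * t = k%:R + u & forall v, plin v n t = v k + u%:C * (v k.+1 - v k)].
Proof.
move=> n0 /andP[t0 t1]; have nR : 0 < n%:R :> R by rewrite ltr0n.
have tn : 0 <= n%:R * t <= n%:R by apply/andP; split; nra.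
have [k [kn ku]] : exists k, (k < n)%N /\ k%:R <= n%:R * t <= k%:R + 1.
  move: tn => /andP[h0]; move: (n%:R * t) h0 => x x0.
  elim: n n0 {nR} => // -[_ _ x1|n IH _ xn]; first by exists 0; rewrite x0 add0r.
  have [xn'|xn'] := leP x n.+1%:R.
    by have [//|//|k [kn kx]] := IH; exists k; rewrite ltnW.
  by exists n.+1; rewrite ltnSn ltW//= natr1.
exists k, (n%:R * t - k%:R); split => //; [lra|lra|move=> v].
have kl : (0 <= k)%N by []. have kl1 : (k <= n)%N by exact: ltnW.
rewrite /plin (big_cat_nat kl kl1)/= [X in _ + (_ + X)]big_ltn//.
have -> : \sum_(k.+1 <= i < n) (clamp (n%:R * t - i%:R))%:C * (v i.+1 - v i) = 0.
  rewrite big_nat big1// => l /andP[kl' _]; rewrite clamp0 ?mul0r//.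
  have : k.+1%:R <= l%:R :> R by rewrite ler_nat.
  by rewrite -natr1; lra.
rewrite addr0.
rewrite clamp_id; last lra.
rewrite addrA; congr (_ + _).
rewrite big_nat (eq_bigr (fun l => v l.+1 - v l)); last first.
  move=> l /andP[_ lk]; rewrite clamp1 ?mul1r//.
  have : l.+1%:R <= k%:R :> R by rewrite ler_nat.
  by rewrite -natr1; lra.
by rewrite -big_nat telescope_sumr// addrC subrK.
Qed.

(** The formula of [plin] is applied in the homotopy parameter, with the loops [F k] as vertices. *)
Lemma chain_homotopy (X : set R[i]) (b : R[i]) (F : nat -> R -> R[i]) r : (0 < r)%N ->
  (forall k, rcont (F k)) -> (forall k, F k 0 = b /\ F k 1 = b) ->
  (forall k t u, (k < r)%N -> 0 <= t <= 1 -> 0 <= u <= 1 ->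
    X (F k t + u%:C * (F k.+1 t - F k t))) ->
  exists h, [/\ hcont h, forall s t, 0 <= s <= 1 -> 0 <= t <= 1 -> X (h (s, t)),
    forall t, h (0, t) = F 0%N t /\ h (1, t) = F r t &
    forall s, 0 <= s <= 1 -> h (s, 0) = b /\ h (s, 1) = b].
Proof.
move=> r0 Fc Fb FX; exists (fun p => plin (fun k => F k p.2) r p.1); split.
- apply: hcontD (hcont_snd (Fc 0%N)) _; apply: hcont_sum => k.
  apply: hcontM (hcont_clamp _ _) _.
  have := hcontD (hcont_snd (Fc k.+1)) (hcontM (hcont_cst (-1)) (hcont_snd (Fc k))).
  move=> H p e e0; have [d d0 Hd] := H p e e0; exists d => // q q1 q2.
  by have := Hd q q1 q2; rewrite !mulN1r.
- move=> s t s01 t01 /=; have [k [u [kr u01 _ ->]]] := plin_at r0 s01.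
  exact: FX.
- move=> t; split => /=.
    have [|k [u [kr /andP[u0 u1] ku ->]]] := @plin_at r 0 r0; first by rewrite lexx ler01.
    have k0 : 0 <= k%:R :> R by [].
    have u00 : u = 0 by move: ku; rewrite mulr0; lra.
    have /eqP : k%:R = 0 :> R by move: ku; rewrite mulr0; lra.
    by rewrite pnatr_eq0 => /eqP ->; rewrite u00 rmorph0 mul0r addr0.
  have [|k [u [kr /andP[u0 u1] ku ->]]] := @plin_at r 1 r0; first by rewrite lexx ler01.
  have kr' : k.+1%:R <= r%:R :> R by rewrite ler_nat.
  rewrite -natr1 in kr'; rewrite mulr1 in ku.
  have u11 : u = 1 by lra.
  have /eqP : r%:R = k.+1%:R :> R by rewrite -natr1 ku u11.
  by rewrite eqr_nat => /eqP ->; rewrite u11 rmorph1 mul1r addrC subrK.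
move=> s s01 /=; have [k [u [_ _ _ H]]] := plin_at r0 s01.
have [a1 a2] := Fb k; have [b1 b2] := Fb k.+1.
by rewrite !H a1 a2 b1 b2 subrr mulr0 addr0.
Qed.

Definition hstep (X : set R[i]) (b : R[i]) f g := [/\ rcont f, rcont g,
  (f 0 = b /\ f 1 = b) /\ (g 0 = b /\ g 1 = b) &
  forall t u, 0 <= t <= 1 -> 0 <= u <= 1 -> X (f t + u%:C * (g t - f t))].

Inductive hsteps X b : (R -> R[i]) -> (R -> R[i]) -> Prop :=
| hsteps_one f g : hstep X b f g -> hsteps X b f g
| hsteps_cons f g h : hstep X b f g -> hsteps X b g h -> hsteps X b f h.

Lemma hsteps_homotopy X b f g : hsteps X b f g ->
  exists h, [/\ hcont h, forall s t, 0 <= s <= 1 -> 0 <= t <= 1 -> X (h (s, t)),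
    forall t, h (0, t) = f t /\ h (1, t) = g t &
    forall s, 0 <= s <= 1 -> h (s, 0) = b /\ h (s, 1) = b].
Proof.
move=> H; suff [F [r [r0 [F0 Fr [Fc [Fb FX]]]]]] : exists F r, (0 < r)%N /\
    [/\ F 0%N = f, F r = g & (forall k, rcont (F k)) /\
      (forall k, F k 0 = b /\ F k 1 = b) /\
      forall k t u, (k < r)%N -> 0 <= t <= 1 -> 0 <= u <= 1 ->
        X (F k t + u%:C * (F k.+1 t - F k t))].
  by rewrite -F0 -Fr; exact: chain_homotopy.
elim: H => [f' g' [fc gc [fb gb] fX]|f' g' h' [fc gc [fb gb] fX] _ [F [r [r0 [F0 Fr [Fc [Fb FX]]]]]]].
  exists (fun k => if k is 0%N then f' else g'), 1%N; split => //; split => //.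
  split; first by case.
  split; first by case.
  by case=> [|//] t u _; exact: fX.
exists (fun k => if k is k.+1 then F k else f'), r.+1; split => //; split => //.
split; first by case.
split; first by case.
case=> [|k] t u /=; first by move=> _; rewrite F0; exact: fX.
by rewrite ltnS; exact: FX.
Qed.

End Homotopy.

(** * Simple connectedness of a grid region *)

Section InnerSimplyConnected.
Context {R : realType} (G : grid R).
Implicit Types (z : R[i]) (s t u d e : R).

Let real_block (o x : R) n : o < x < o + n%:R * mesh G -> exists i1 i2, [/\ (i1 <= i2 <= i1.+1)%N,
   (i2 < n)%N, o + i1%:R * mesh G < x < o + i2.+1%:R * mesh G &
   forall k, (i1 <= k <= i2)%N -> o + k%:R * mesh G <= x <= o + k%:R * mesh G + mesh G].
Proof.
have g0 := mesh_gt0 G.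
move=> /andP[ox xn].
have [i [xi imin]] : exists i : nat, x < o + i.+1%:R * mesh G /\ (forall k, x < o + k.+1%:R * mesh G -> (i <= k)%N).
  have ex : exists i : nat, x < o + i.+1%:R * mesh G.
    exists n; apply: lt_trans xn _; rewrite ltrD2l ltr_pM2r// ltr_nat//.
  by have [i h1 h2] := ex_minnP ex; exists i.
have il : o + i%:R * mesh G <= x.
  case: i imin {xi} => [|i] imin; first by rewrite mul0r addr0 ltW.
  by rewrite leNgt; apply/negP => /imin; rewrite ltnn.
have i_n : (i < n)%N.
  case: n xn => [|n xn]; first by rewrite mul0r addr0; lra.
  by rewrite ltnS; apply: imin.
have S k : k.+1%:R * mesh G = k%:R * mesh G + mesh G by rewrite -natr1 mulrDl mul1r.
have [e|ne] := eqVneq (o + i%:R * mesh G) x.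
  case: i imin xi il i_n e => [|i] imin xi il i_n e.
    by exfalso; move: e; rewrite mul0r addr0; lra.
  exists i, i.+1; split => //; first by rewrite leqnn leqW.
    by rewrite xi andbT -e S; lra.
  move=> k /andP[h1 h2]; have [->|->] : k = i \/ k = i.+1 by clear -h1 h2; lia.
    by rewrite -e S; lra.
  by rewrite -e; lra.
exists i, i; split => //; first by rewrite leqnn leqnSn.
  by rewrite xi andbT lt_neqAle ne il.
rewrite S in xi; move=> k.
move=> h; have -> : k = i by clear -h; lia.
by rewrite il ltW//; lra.
Qed.

(** Two columns or rows of cells are taken when [z] lies on a grid line, so that [z] is always
    inside an open full rectangle. *)
Lemma inner_block z : inner G z -> exists i1 i2 j1 j2,
  [/\ full G i1 i2 j1 j2, (i1 <= i2)%N, (j1 <= j2 <= j1.+1)%N & orect G i1 i2 j1 j2 z].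
Proof.
move=> [[hx hy] H]; rewrite /px /py !mul0r !addr0 in hx hy.
have [i1 [i2 [/andP[hi _] im h1 h2]]] := real_block hx.
have [j1 [j2 [hj jm h3 h4]]] := real_block hy.
exists i1, i2, j1, j2; split => //.
move=> i j hii hjj; apply: H.
- by case/andP: hii => _ h; exact: leq_ltn_trans im.
- by case/andP: hjj => _ h; exact: leq_ltn_trans jm.
by split; [exact: h2|exact: h4].
Qed.

Let orect_open i1 i2 j1 j2 z : orect G i1 i2 j1 j2 z ->
  exists2 d, 0 < d & forall w, N (w - z) < d -> orect G i1 i2 j1 j2 w.
Proof.
move=> [/andP[x1 x2] /andP[y1 y2]].
pose d := Num.min (Num.min (complex.Re z - px G i1) (px G i2.+1 - complex.Re z))
                  (Num.min (complex.Im z - py G j1) (py G j2.+1 - complex.Im z)).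
exists d; first by rewrite /d !lt_min !subr_gt0 x1 x2 y1.
move=> w; rewrite /d !lt_min => /andP[/andP[h1 h2] /andP[h3 h4]].
have := N_Re (w - z); have := N_Im (w - z); rewrite !ler_norml ReB ImB.
by move=> /andP[? ?] /andP[? ?]; split; apply/andP; split; lra.
Qed.

Definition block := (nat * nat * nat * nat)%type.
Definition brect (B : block) := orect G B.1.1.1 B.1.1.2 B.1.2 B.2.
Definition bfull (B : block) := [/\ full G B.1.1.1 B.1.1.2 B.1.2 B.2, (B.1.1.1 <= B.1.1.2)%N &
  (B.1.2 <= B.2 <= B.1.2.+1)%N].
Definition inb (B : block) (c : nat * nat) :=
  (B.1.1.1 <= c.1 <= B.1.1.2)%N && (B.1.2 <= c.2 <= B.2)%N.

Let block_at z : inner G z -> exists B, bfull B /\ brect B z.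
Proof.
by move=> /inner_block[i1 [i2 [j1 [j2 [h1 h2 h3 h4]]]]]; exists (i1, i2, j1, j2).
Qed.

Let common_cell (B B' : block) z : bfull B -> bfull B' -> brect B z -> brect B' z ->
  exists c, inb B c && inb B' c.
Proof.
case: B => [[[i1 i2] j1] j2]; case: B' => [[[k1 k2] l1] l2].
move=> [/= _ a1 /andP[a2 _]] [/= _ b1 /andP[b2 _]] [/andP[x1 x2] /andP[y1 y2]] [/andP[x3 x4] /andP[y3 y4]].
have h1 : (i1 < k2.+1)%N by apply: (@px_lt _ G); exact: lt_trans x1 x4.
have h2 : (k1 < i2.+1)%N by apply: (@px_lt _ G); exact: lt_trans x3 x2.
have h3 : (j1 < l2.+1)%N by apply: (@py_lt _ G); exact: lt_trans y1 y4.
have h4 : (l1 < j2.+1)%N by apply: (@py_lt _ G); exact: lt_trans y3 y2.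
exists (maxn i1 k1, maxn j1 l1); rewrite /inb /=.
by clear -h1 h2 h3 h4 a1 a2 b1 b2; lia.
Qed.

Let center_in B c : inb B c -> brect B (center G c).
Proof. by move=> /andP[h1 h2]; exact: center_orect. Qed.

Let adj_in B c c' : bfull B -> inb B c -> inb B c' -> cell_adj G c c'.
Proof.
case: B => [[[i1 i2] j1] j2] [/= F _ jj] /andP[/= c1 c2] /andP[/= d1 d2].
split; [by clear -c2 d2 jj; lia|by clear -c2 d2 jj; lia|].
by move=> i j hi hj; apply: F; [clear -c1 d1 hi|clear -c2 d2 hj]; lia.
Qed.

Let rect_inner B z w u : bfull B -> brect B z -> brect B w -> 0 <= u <= 1 ->
  inner G (z + u%:C * (w - z)).
Proof. by move=> [F _ _] Bz Bw u01; apply: (orect_inner F); exact: orect_convex. Qed.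

Lemma lebesgue_blocks (f : R -> R[i]) : rcont f -> (forall t, 0 <= t <= 1 -> inner G (f t)) ->
  exists2 e, 0 < e & forall t, 0 <= t <= 1 -> exists B, bfull B /\
    forall s, `|s - t| <= e -> brect B (f s).
Proof.
move=> fc fG.
suff [e e0 H] : exists2 e, 0 < e & forall t, 0 <= t <= 0 + 1 -> exists B, bfull B /\
    forall s, `|s - t| <= e -> brect B (f s).
  by exists e => // t; have := H t; rewrite add0r.
apply: (@bisection _ (fun x _ d => exists2 e, 0 < e & forall t, x <= t <= x + d -> exists B, bfull B /\
    forall s, `|s - t| <= e -> brect B (f s)) 0 0 1) => //.
  move=> x _ d d0 [e e0 He] [e' e'0 He'] _ _.
  exists (Num.min e e'); first by rewrite lt_min e0.
  move=> t /andP[xt td]; have [tm|tm] := leP t (x + d / 2).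
    have [|B [h1 h2]] := He t; first by rewrite xt.
    by exists B; split => // s; rewrite le_min => /andP[/h2].
  have [|B [h1 h2]] := He' t; first by apply/andP; split; lra.
  by exists B; split => // s; rewrite le_min => /andP[_ /h2].
move=> t1 y1; rewrite add0r => t01 _; have [B [FB Bt]] := block_at (fG t1 t01).
have [d d0 Hd] := orect_open Bt; have [r r0 Hr] := fc t1 d d0.
exists (r / 2); first by rewrite divr_gt0.
move=> x y l /andP[l0 lr] /andP[h1 h2] _ _ _ _ _; exists (r / 2); first by rewrite divr_gt0.
move=> t /andP[h3 h4]; exists B; split => // s st; apply/Hd/Hr.
have h5 : `|t - t1| <= l by rewrite ler_norml; apply/andP; split; lra.
have := ler_normD (s - t) (t - t1); rewrite addrA subrK; lra.
Qed.

(** Straight-line moves in three stages: from the loop to the polygon through the centres of a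
    closed cell walk, from walk to walk along [wsteps], and from the constant walk to the base
    point. Corresponding points always share a full rectangle, which is convex. *)
Lemma loop_null (f : R -> R[i]) b : nice (inner G) -> rcont f ->
  (forall t, 0 <= t <= 1 -> inner G (f t)) -> f 0 = b -> f 1 = b ->
  hsteps (inner G) b f (fun=> b).
Proof.
move=> nG fc fG f0 f1; have [e e0 He] := lebesgue_blocks fc fG.
have t01 : 0 <= (0 : R) <= 1 by rewrite lexx ler01.
have [B0 [FB0 HB0]] := He 0 t01.
have B0b : brect B0 b by rewrite -f0; apply: HB0; rewrite subrr normr0 ltW.
have [d d0 Hd] := orect_open B0b; have [r r0 Hr] := fc 1 d d0.
(* Three pieces of length [1 / m] fit within the Lebesgue number [e] and within the continuity
   radius [r] at time 1. *)
pose m := (Num.trunc (3 / e + 3 / r)).+4.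
have m0 : 0 < m%:R :> R by rewrite ltr0n.
have [me mr] : 3 / m%:R <= e /\ 3 / m%:R < r.
  have h : 3 / e + 3 / r < m%:R.
    by apply: lt_trans (truncnS_gt _) _; rewrite ltr_nat /m !ltnS; exact: leqW (leqnSn _).
  have h1 : 0 < 3 / e by rewrite divr_gt0.
  have h2 : 0 < 3 / r by rewrite divr_gt0.
  split.
    by rewrite ler_pdivrMr// mulrC -ler_pdivrMr//; lra.
  by rewrite ltr_pdivrMr// mulrC -ltr_pdivrMr//; lra.
have div01 k : (k <= m)%N -> 0 <= (k%:R / m%:R : R) <= 1.
  by move=> km; rewrite divr_ge0//= ler_pdivrMr// mul1r ler_nat.
have [Bk HBk] : {Bk : nat -> block & forall k, (k <= m)%N -> bfull (Bk k) /\
    forall s, `|s - k%:R / m%:R| <= e -> brect (Bk k) (f s)}.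
  apply: (@choice _ _ (fun k B => (k <= m)%N -> bfull B /\
    forall s, `|s - k%:R / m%:R| <= e -> brect B (f s))) => k.
  have [km|_] := leqP k m; last by exists B0.
  by have [B HB] := He _ (div01 k km); exists B.
(* The first two and the last two pieces get the block [B0] of the base point, so that the walk can
   start and end in the same cell [c0]. *)
pose be k := if (k <= 1)%N || (m <= k.+2)%N then B0 else Bk k.
have Fbe k : (k <= m)%N -> bfull (be k).
  by move=> km; rewrite /be; case: ifP => // _; have [] := HBk k km.
have step_m t k : k%:R <= m%:R * t <= k%:R + 1 -> k%:R / m%:R <= t <= k%:R / m%:R + 1 / m%:R.
  by move=> /andP[h1 h2]; rewrite -mulrDl ler_pdivrMr// ler_pdivlMr// [t * _]mulrC h1.
have P1 k t : (k < m)%N -> k%:R <= m%:R * t <= k%:R + 1 -> brect (be k) (f t).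
  move=> km /step_m /andP[h1 h2]; rewrite /be; have m30 : 0 <= 1 / m%:R :> R by rewrite divr_ge0.
  have m3 : 3 / m%:R = 1 / m%:R + 1 / m%:R + 1 / m%:R :> R by field; rewrite gt_eqF.
  case: ifP => [/orP[k1|k2]|_].
  - apply: HB0; rewrite subr0 ger0_norm; last by apply: le_trans h1; rewrite divr_ge0.
    have : k%:R / m%:R <= 1 / m%:R :> R by rewrite ler_pM2r ?invr_gt0// lern1.
    lra.
  - apply: Hd; rewrite -f1; apply: Hr.
    have : m%:R <= k.+2%:R :> R by rewrite ler_nat.
    rewrite -addn2 natrD => mk.
    have mk' : 1 <= k%:R / m%:R + 2 / m%:R :> R by rewrite -mulrDl ler_pdivlMr// mul1r.
    have : k.+1%:R / m%:R <= 1 :> R by rewrite ler_pdivrMr// mul1r ler_nat.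
    rewrite -natr1 mulrDl => kk.
    have m2 : 2 / m%:R = 1 / m%:R + 1 / m%:R :> R by field; rewrite gt_eqF.
    apply: le_lt_trans mr; rewrite ler_norml; apply/andP; split; lra.
  have [_ H] := HBk k (ltnW km); apply: H; rewrite ler_norml; apply/andP; split; lra.
have cellk k : (0 < k)%N -> (k < m)%N -> exists c, inb (be k.-1) c && inb (be k) c.
  move=> k0 km; have k1m : (k.-1 < m)%N by apply: leq_ltn_trans (leq_pred _) km.
  have mk : m%:R * (k%:R / m%:R) = k%:R :> R by rewrite mulrC divfK ?gt_eqF.
  apply: (@common_cell _ _ (f (k%:R / m%:R))); [exact/Fbe/ltnW|exact/Fbe/ltnW| |].
    by apply: P1 => //; rewrite mk -[in X in _ <= X <= _](prednK k0) -[in X in _ && (X <= _)](prednK k0) -natr1; lra.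
  by apply: P1 => //; rewrite mk lexx; lra.
pose c0 : nat * nat := (B0.1.1.1, B0.1.2).
have c0in : inb B0 c0 by case: FB0 => _ h1 /andP[h2 _]; rewrite /inb /= !leqnn h1 h2.
(* [c k] is common to the consecutive blocks [k.-1] and [k]. At [k = 1] and [k.+1 = m] both blocks
   are [B0] and the choice [c0] is imposed. *)
have [c Hc] : {c : nat -> nat * nat & forall k, (0 < k)%N -> (k < m)%N ->
    [/\ inb (be k.-1) (c k), inb (be k) (c k) & (k == 1)%N || (k.+1 == m)%N -> c k = c0]}.
  apply: (@choice _ _ (fun k c => (0 < k)%N -> (k < m)%N ->
    [/\ inb (be k.-1) c, inb (be k) c & (k == 1)%N || (k.+1 == m)%N -> c = c0])) => k.
  have [k1|nk] := boolP ((k == 1)%N || (k.+1 == m)%N).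
    exists c0 => k0 km; rewrite /be.
    have -> : (k.-1 <= 1)%N || (m <= k.-1.+2)%N.
      by case/orP: k1 => /eqP h; apply/orP; [left; rewrite h|right; rewrite prednK ?h].
    have -> : (k <= 1)%N || (m <= k.+2)%N.
      by case/orP: k1 => /eqP h; apply/orP; [left; rewrite h|right; rewrite h].
    by [].
  have [k0|] := ltnP 0 k; last by exists c0.
  have [km|] := ltnP k m; last by exists c0.
  by have [c /andP[h1 h2]] := cellk k k0 km; exists c.
pose n := m.-2.
have m4 : m = n.+2 by [].
pose wk k := c k.+1.
have W : walk G wk n.
  move=> k kn; have k1 : (k.+1 < m)%N by rewrite m4 !ltnS ltnW.
  have k2 : (k.+2 < m)%N by rewrite m4 !ltnS.
  have [_ h1 _] := Hc k.+1 isT k1; have [h2 _ _] := Hc k.+2 isT k2.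
  exact: adj_in (Fbe k.+1 (ltnW k1)) h1 h2.
have wk0 : wk 0 = c0 by have [_ _] := Hc 1%N isT isT; apply.
have wkn : wk n = c0.
  have [_ _] := Hc n.+1 isT (ltnSn _); apply; by rewrite eqxx orbT.
pose V (w : nat -> nat * nat) k := if (k == 0)%N || (m <= k)%N then b else center G (w k.-1).
have V0 w : V w 0%N = b by [].
have Vm w : V w m = b by rewrite /V leqnn orbT.
have pl0 v : v 0%N = b -> v m = b -> plin v m 0 = b /\ plin v m 1 = b.
  move=> v0 vm; split.
    have [|k [u [kr /andP[u0 u1] ku ->]]] := @plin_at R m 0 isT; first by rewrite lexx ler01.
    have k0 : 0 <= k%:R :> R by [].
    have u00 : u = 0 by move: ku; rewrite mulr0; lra.
    have /eqP : k%:R = 0 :> R by move: ku; rewrite mulr0; lra.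
    by rewrite pnatr_eq0 => /eqP ->; rewrite u00 rmorph0 mul0r addr0.
  have [|k [u [kr /andP[u0 u1] ku ->]]] := @plin_at R m 1 isT; first by rewrite lexx ler01.
  have kr' : k.+1%:R <= m%:R :> R by rewrite ler_nat.
  rewrite -natr1 in kr'; rewrite mulr1 in ku.
  have u11 : u = 1 by lra.
  have /eqP : m%:R = k.+1%:R :> R by rewrite -natr1 ku u11.
  by rewrite eqr_nat => /eqP km; rewrite u11 rmorph1 mul1r addrC subrK -km.
have first : hstep (inner G) b f (plin (V wk) m).
  split; [exact: fc|exact: rcont_plin|by split => //; exact: pl0|].
  move=> t u t_01 u01; have [k [v [km v01 ku ->]]] := @plin_at R m t isT t_01.
  have ft : brect (be k) (f t).
    by apply: P1 => //; rewrite ku; case/andP: v01 => ? ?; apply/andP; split; lra.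
  have Bkk j : (j = k \/ j = k.+1)%N -> brect (be k) (V wk j).
    rewrite /V; case: eqVneq => [->|j0] /=.
      by case=> // <-.
    have [mj|jm] := leqP m j.
      case=> jk; first by move: km; rewrite -jk ltnNge mj.
      rewrite /be; have -> : (m <= k.+2)%N by rewrite (leq_trans mj)// jk.
      by rewrite orbT.
    have jp : (0 < j)%N by rewrite lt0n.
    have [h1 h2 _] := Hc j jp jm; rewrite /wk prednK// => -[jk|jk]; apply: center_in.
      by rewrite -jk.
    by move: h1; rewrite jk.
  apply: (rect_inner (Fbe k (ltnW km)) ft _ u01).
  by apply: orect_convex v01; [apply: Bkk; left|apply: Bkk; right].
have moves w w' : w 0 = c0 -> w n = c0 -> wstep G n w w' ->
    hstep (inner G) b (plin (V w) m) (plin (V w') m).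
  move=> w0 wn [w'0 w'n H]; have w'00 : w' 0 = c0 by rewrite w'0.
  have w'nn : w' n = c0 by rewrite w'n.
  split; [exact: rcont_plin|exact: rcont_plin|by split; exact: pl0|].
  move=> t u t_01 u01; have [k [v [km v01 ku E]]] := @plin_at R m t isT t_01.
  have [B [FB HB]] : exists B, (full G B.1.1.1 B.1.1.2 B.1.2 B.2) /\ forall x, x \in [:: V w k; V w k.+1; V w' k; V w' k.+1] -> brect B x.
    have c0B : brect B0 (center G c0) by exact: center_in.
    case: k km ku E => [|k] km ku E.
      exists B0; split; first by case: FB0.
      have V1 x : x 0 = c0 -> V x 1%N = center G c0 by move=> x0; rewrite /V /= x0.
      by move=> x; rewrite !V0 (V1 w w0) (V1 w' w'00) !inE => /or4P[]/eqP ->.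
    have [kn|kn] := ltnP k n; last first.
      have kn' : k = n by apply/eqP; rewrite eqn_leq kn andbT -2!ltnS -m4.
      exists B0; split; first by case: FB0.
      have V1 x : x n = c0 -> V x n.+1 = center G c0 by move=> xn; rewrite /V m4 ltnn /= xn.
      by move=> x; rewrite kn' -m4 !Vm (V1 w wn) (V1 w' w'nn) !inE => /or4P[]/eqP ->.
    have [i1 [i2 [j1 [j2 [F HF]]]]] := H k kn; exists (i1, i2, j1, j2); split => //.
    have VV x l : (l <= n)%N -> V x l.+1 = center G (x l) by move=> ln; rewrite /V m4 ltnS ltnNge ln.
    have cc (l : nat * nat) : l \in [:: w k; w k.+1; w' k; w' k.+1] -> brect (i1, i2, j1, j2) (center G l).
      by move=> /HF[h1 h2]; exact: center_orect.
    rewrite (VV w k (ltnW kn)) (VV w k.+1 kn) (VV w' k (ltnW kn)) (VV w' k.+1 kn) => x; rewrite !inE => /or4P[]/eqP ->; apply: cc;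
      by rewrite !inE eqxx ?orbT.
  rewrite !E; apply: (orect_inner FB); apply: orect_convex u01.
    by apply: orect_convex v01; apply: HB; rewrite !inE eqxx ?orbT.
  by apply: orect_convex v01; apply: HB; rewrite !inE eqxx ?orbT.
have final : hstep (inner G) b (plin (V (fun=> c0)) m) (fun=> b).
  split; [exact: rcont_plin|by move=> t e1 e10; exists 1 => // s _; rewrite subrr N0|by split => //; exact: pl0|].
  move=> t u t_01 u01; have [k [v [km v01 ku E]]] := @plin_at R m t isT t_01.
  have VB j : brect B0 (V (fun=> c0) j) by rewrite /V; case: ifP => // _; exact: center_in.
  rewrite E; apply: (rect_inner FB0 _ B0b u01); exact: (orect_convex (VB k) (VB k.+1) v01).
have ws : wsteps G n wk (fun=> wk 0) by apply: walk_null => //; rewrite wk0 wkn.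
apply: hsteps_cons first _; rewrite wk0 in ws.
have : wk 0 = c0 /\ wk n = c0 by [].
elim: ws final => [w fin _|w w' w'' s _ IH fin [h1 h2]]; first exact: hsteps_one.
have [w0 wn _] := s.
by apply: hsteps_cons (moves _ _ h1 h2 s) (IH fin _); rewrite w0 wn.
Qed.

Theorem inner_simply_connected : nice (inner G) -> simply_connected (inner G).
Proof.
move=> nG g [gc gG g01]; pose f t := g (clamp t).
have fc : rcont f.
  move=> t e e0; have := ((subspace_continuousP _ g).1 gc) (clamp t).
  have ct : (`[0, 1]%classic : set R) (clamp t) by rewrite /= in_itv /= clamp_itv.
  move=> /(_ ct) H.
  have : nbhs (g (clamp t)) [set w | N (w - g (clamp t)) < e] by apply/nbhsN; exists e.
  move=> /H; rewrite /nbhs /= /within /= => /nbhs_ballP[d d0 Hd]; exists d => // s st.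
  apply: Hd; last by rewrite in_itv /= clamp_itv.
  by rewrite -?ball_normE /ball_/= distrC; apply: le_lt_trans st; exact: clamp_lip.
have fG t : 0 <= t <= 1 -> inner G (f t).
  by move=> t01; apply: gG; exists (clamp t) => //; rewrite /= in_itv /= clamp_itv.
have f0 : f 0 = g 0 by rewrite /f clamp_id// lexx ler01.
have f1 : f 1 = g 0 by rewrite /f clamp_id ?lexx ?ler01.
have [h [hc hG h01 hb]] := hsteps_homotopy (loop_null nG fc fG f0 f1).
exists h; split.
- apply: continuous_subspaceT => p U /nbhsN[e e0 eU].
  have [d d0 Hd] := hc p e e0.
  exists (ball p.1 d, ball p.2 d); first by split => /=; apply: nbhsx_ballx.
  move=> [x y]; rewrite /= -!ball_normE /ball_/= => -[px py]; apply/eU/Hd => /=;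
    by rewrite distrC.
- by move=> _ [[s t] [/= s01 t01] <-]; apply: hG; [move: s01|move: t01]; rewrite in_itv.
- move=> t; rewrite in_itv /= => t01; have [-> ->] := h01 t.
  by rewrite /f clamp_id.
- by move=> s; rewrite in_itv /= => s01; exact: hb.
Qed.

End InnerSimplyConnected.

(** * Components and connected hulls *)

Section Connectedness.
Context {R : realType}.
Implicit Types (A K : set R[i]) (z w p : R[i]) (d e t : R).

Definition seg z w : set R[i] := [set z + t%:C * (w - z) | t in `[0, 1]%classic].

Lemma rcont_continuous (f : R -> R[i]) : rcont f -> continuous f.
Proof.
move=> fc t U /nbhsN[e e0 eU]; have [d d0 Hd] := fc t e e0.
apply/nbhs_ballP; exists d => // s; rewrite -ball_normE /ball_/= distrC => /Hd.
exact: eU.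
Qed.

Lemma seg_connected z w : connected (seg z w).
Proof.
apply: connected_continuous_connected; first exact: segment_connected.
apply: continuous_subspaceT; apply: rcont_continuous => t e e0.
have v0 : 0 < 1 + N (w - z) by have := N_ge0 (w - z); lra.
exists (e / (1 + N (w - z))); first by rewrite divr_gt0.
move=> s; rewrite ltr_pdivlMr// => st.
have -> : z + s%:C * (w - z) - (z + t%:C * (w - z)) = (s - t)%:C * (w - z).
  by rewrite rmorphB; ring.
by rewrite NM N_real; have := normr_ge0 (s - t); lra.
Qed.

Lemma seg_l z w : seg z w z.
Proof. by exists 0; rewrite ?rmorph0 ?mul0r ?addr0//= in_itv /= lexx ler01. Qed.

Lemma seg_r z w : seg z w w.
Proof. by exists 1; rewrite ?rmorph1 ?mul1r ?[z + _]addrC ?subrK//= in_itv /= lexx ler01. Qed.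

Lemma star_connected A z : (forall w, A w -> seg z w `<=` A) -> connected A.
Proof.
move=> H; have -> : A = \bigcup_(w in A) seg z w.
  by apply/seteqP; split=> [w Aw|w [v Av] /(H v Av)//]; exists w => //; exact: seg_r.
apply: bigcup_connected; last by move=> w _; exact: seg_connected.
by exists z => w _; exact: seg_l.
Qed.

Lemma seg_ball z w v d : N (w - z) < d -> seg z w v -> N (v - z) < d.
Proof.
move=> wz [t]; rewrite /= in_itv /= => /andP[t0 t1] <-.
rewrite addrAC subrr add0r NM N_real ger0_norm//.
by apply: le_lt_trans wz; have := N_ge0 (w - z); nra.
Qed.

Section Component.
Context (X : set R[i]) (z0 : R[i]) (oX : open X).
Let Y := connected_component X z0.

Let joined z B : Y z -> B z -> B `<=` X -> connected B -> B `<=` Y.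
Proof.
move=> Yz Bz BX cB w Bw.
apply: (connected_component_trans Yz).
exact: (connected_component_max Bz BX cB).
Qed.

Lemma component_nbhs z : Y z -> exists2 d, 0 < d & forall w, N (w - z) < d -> Y w.
Proof.
move=> Yz; have [d d0 Hd] := (openN _).1 oX z (connected_component_sub Yz).
exists d => // w wz; have S : seg z w `<=` Y; last exact: S (seg_r z w).
apply: (@joined z (seg z w)) => //; [exact: seg_l| |exact: seg_connected].
by move=> v /(seg_ball wz)/Hd.
Qed.

Lemma component_open : open Y.
Proof. by apply/openN; exact: component_nbhs. Qed.

Lemma component_compl_nbhs z : X z -> ~ Y z ->
  exists2 d, 0 < d & forall w, N (w - z) < d -> X w /\ ~ Y w.
Proof.
move=> Xz nYz; have [d d0 Hd] := (openN _).1 oX z Xz.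
exists d => // w wz; split; first exact: Hd.
move=> Yw; apply: nYz; have S : seg z w `<=` Y; last exact: S (seg_l z w).
apply: (@joined w (seg z w)) => //; [exact: seg_r| |exact: seg_connected].
by move=> v /(seg_ball wz)/Hd.
Qed.

(** A homotopy in [X] stays in the component: each curve [H (s, _)] is connected and starts at the
    base point. *)
Lemma component_simply_connected : simply_connected X -> simply_connected Y.
Proof.
move=> sX g [gc gY g01].
have [|H [Hc HX H01 Hb]] := sX g; first by split => // z /gY; exact: connected_component_sub.
exists H; split => // _ [[s t] [/= s01 t01] <-].
have g0 : Y (g 0) by apply: gY; exists 0 => //=; rewrite in_itv /= lexx ler01.
have [Hs0 _] := Hb s s01.
apply: (@joined (g 0) (H @` [set p | p.1 = s /\ `[0, 1]%classic p.2])) => //.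
- by exists (s, 0) => //; split => //=; rewrite in_itv /= lexx ler01.
- by move=> _ [[s' t'] [/= -> t'01] <-]; apply: HX; exists (s, t').
- have -> : H @` [set p | p.1 = s /\ `[0, 1]%classic p.2] = (fun t => H (s, t)) @` `[0, 1]%classic.
    apply/seteqP; split; first by move=> _ [[s' t'] [/= -> t'01] <-]; exists t'.
    by move=> _ [t' t'01 <-]; exists (s, t').
  apply: connected_continuous_connected; first exact: segment_connected.
  apply/subspace_continuousP => t1 t101 U /((subspace_continuousP _ H).1 Hc (s, t1)).
  rewrite {1}/nbhs /= /within /= => /(_ (conj s01 t101)) [[P1 P2] [/= n1 n2] P].
  rewrite /nbhs /= /within /=; apply: filterS n2 => t2 P2t t201.
  apply: (P (s, t2)); last by split.
  by split => //=; exact: nbhs_singleton n1.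
by exists (s, t).
Qed.

End Component.

Definition hull_in A z0 K := exists D : set R[i],
  [/\ compact D, connected D, D `<=` A, D z0 & K `<=` D].

Lemma square_near z d : 0 < d -> exists2 S : set R[i], [/\ compact S, connected S, S z &
    S `<=` [set w | N (w - z) < d]] & exists2 e, 0 < e & forall w, N (w - z) < e -> S w.
Proof.
move=> d0; pose r := d / 8; have r0 : 0 < r by rewrite divr_gt0.
pose S := cell (complex.Re z - r) (complex.Im z - r) (2 * r).
have Sz : S z by split; apply/andP; split; lra.
have r2 : 0 <= 2 * r by lra.
exists S; last first.
  exists r => // w wz; have := N_Re (w - z); have := N_Im (w - z).
  rewrite ReB ImB !ler_norml => /andP[h1 h2] /andP[h3 h4].
  by split; apply/andP; split; lra.
split => //.
- apply: (@compactN _ _ (N z + 2 * (2 * r))) => w; last exact: open_cell_compl.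
  move=> Sw; have := cell_diam r2 Sw Sz; have := ND (w - z) z; rewrite subrK; lra.
- apply: (@star_connected _ z) => w Sw v [t]; rewrite /= in_itv /= => t01 <-.
  exact: cell_convex.
- by move=> w Sw /=; have := cell_diam r2 Sw Sz; rewrite /r; lra.
Qed.

Lemma hullU A z0 K K' : hull_in A z0 K -> hull_in A z0 K' -> hull_in A z0 (K `|` K').
Proof.
move=> [D [cD kD DA Dz KD]] [D' [cD' kD' DA' Dz' KD']]; exists (D `|` D'); split.
- exact: compactU.
- by apply: connectedU => //; exists z0.
- by move=> z [/DA|/DA'].
- by left.
- by move=> z [/KD|/KD']; [left|right].
Qed.

Lemma hull_extend A z0 z S : hull_in A z0 [set z] -> compact S -> connected S -> S z -> S `<=` A ->
  hull_in A z0 S.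
Proof.
move=> [D [cD kD DA Dz KD]] cS kS Sz SA; exists (D `|` S); split.
- exact: compactU.
- by apply: connectedU => //; exists z; split => //; exact: KD.
- by move=> w [/DA|/SA].
- by left.
- by right.
Qed.

Lemma hull_sub A z0 K K' : K `<=` K' -> hull_in A z0 K' -> hull_in A z0 K.
Proof. by move=> KK [D [? ? ? ? H]]; exists D; split => // z /KK/H. Qed.

(** The points reached from [z0] by compact connected subsets form a relatively open and closed part
    of [A], hence all of [A]. The hull is what places [K] in a single component of a grid region. *)
Lemma connected_hull A z0 K : open A -> connected A -> A z0 -> compact K -> K `<=` A ->
  hull_in A z0 K.
Proof.
move=> oA cA Az0 cK KA.
pose U := [set z | A z /\ hull_in A z0 [set z]].
have grow z d : 0 < d -> (forall w, N (w - z) < d -> A w) -> hull_in A z0 [set z] ->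
    exists2 e, 0 < e & hull_in A z0 [set w | N (w - z) < e].
  move=> d0 Hd hz; have [S [cS kS Sz Sd] [e e0 He]] := square_near z d0.
  exists e => //; apply: (hull_sub (K' := S)); first by move=> w; exact: He.
  by apply: (hull_extend hz) => // w /Sd/Hd.
have UA : U = A.
  apply: cA.
  - exists z0; split => //; exists [set z0]; split => //.
      exact: compact_set1.
    exact: connected1.
    by move=> z ->.
  - exists U; last by apply/seteqP; split=> [z [Az h]|z [Az []]]; split.
    apply/openN => z [Az hz]; have [d d0 Hd] := (openN _).1 oA z Az.
    have [e e0 He] := grow z d d0 Hd hz.
    exists (Num.min d e); first by rewrite lt_min d0.
    move=> w; rewrite lt_min => /andP[/Hd Aw we]; split => //.
    by apply: hull_sub He => v ->.
  exists (~` [set z | A z /\ ~ hull_in A z0 [set z]]).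
    rewrite closedC; apply/openN => z [Az nz]; have [d d0 Hd] := (openN _).1 oA z Az.
    have [S [cS kS Sz Sd] [e e0 He]] := square_near z d0.
    exists e => // w /He Sw; split; first exact/Hd/Sd.
    move=> hw; apply: nz; apply: (hull_sub (K' := S)); first by move=> v ->.
    by apply: (hull_extend hw) => // v /Sd/Hd.
  apply/seteqP; split=> [z [Az h]|z [Az h]]; split => //.
    by case=> _; apply.
  by apply: contrapT => nh; apply: h; split.
apply: (@compact_ind _ K (hull_in A z0)) => //.
- exists [set z0]; split => //; first exact: compact_set1.
    exact: connected1.
  by move=> z ->.
- exact: hullU.
- by move=> E F; exact: hull_sub.
move=> z Kz; have Az := KA z Kz; have [d d0 Hd] := (openN _).1 oA z Az.
have hz : hull_in A z0 [set z] by move: Az; rewrite -[in A z]UA => -[].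
exact: grow d0 Hd hz.
Qed.

Lemma bounded_setP A : bounded_set A <-> bnd A.
Proof.
split=> [[M [Mr H]]|[B HB]].
  exists (complex.Re (M + 1)) => z Az.
  have M1 : M < M + 1 by rewrite ltrDl.
  by have := H _ M1 z Az; rewrite /= normE lecE /= => /andP[].
exists B%:C; split; first by rewrite complex_real.
move=> x Bx z Az; apply: le_trans (ltW Bx); rewrite normE lecR; exact: HB.
Qed.

Lemma locally_uniformP A (F : nat -> R[i] -> R[i]) f : open A ->
  locally_uniform_cvg A F f <->
  forall z, A z -> exists2 d, 0 < d & forall e, 0 < e -> exists n0, forall n, (n0 <= n)%N ->
    forall w, N (w - z) < d -> A w -> N (F n w - f w) < e.
Proof.
move=> oA; split=> H z Az.
  have [U /nbhsN[d d0 dU] HU] := H z Az; exists d => // e e0.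
  have : nbhs (f : {uniform` U `&` A -> R[i]}) [set h | forall y, (U `&` A) y -> N (h y - f y) < e].
    apply/uniform_nbhs; exists [set p | N (p.2 - p.1) < e]; split => //.
    rewrite -entourage_ballE; exists e%:C; first by rewrite /= ltcR.
    by move=> [x y]; rewrite /= -ball_normE /ball_/= N_lt_norm distNC.
  move=> /HU [n0 _ Hn]; exists n0 => n /Hn /= h w /dU Uw Aw; exact: h.
have [d d0 Hd] := H z Az.
exists [set w | N (w - z) < d]; first by apply/nbhsN; exists d.
move=> P /uniform_nbhs[E [+ EP]]; rewrite -entourage_ballE => -[e e0 He].
have er : e = (complex.Re e)%:C.
  by move: e0; rewrite /= ltcE => /andP[/= /eqP ei _]; case: e {He} ei => ? ? /= ->.
have re0 : 0 < complex.Re e by move: e0; rewrite /= er ltcR.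
have [n0 Hn] := Hd _ re0; exists n0 => // n /= /Hn h; apply: EP => w [/= wz Aw].
by apply: He; rewrite /= -ball_normE /ball_/= er N_lt_norm distNC; exact: h.
Qed.

End Connectedness.

(** * Weighted polynomial approximation *)

Section Approximation.
Context {R : realType}.
Implicit Types (A K : set R[i]) (F f : R[i] -> R[i]) (z w p : R[i]) (d e s a : R).

Lemma pow_small (q e : R) : 0 <= q -> q < 1 -> 0 < e ->
  exists n0, forall n, (n0 <= n)%N -> q ^+ n <= e.
Proof.
move=> q0 q1 e0; have := @cvg_geometric R 1 q.
rewrite ger0_norm// => /(_ q1) /cvgrPdist_lt /(_ _ e0)[n _ Hn]; exists n => k /Hn /=.
rewrite sub0r normrN /geometric /= mul1r => h.
by apply: le_trans (ler_norm _) (ltW h).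
Qed.

Lemma compact_bounded (L : set R[i]) F : compact L -> (forall z, L z -> ccont F z) ->
  exists2 B, 0 < B & forall z, L z -> N (F z) <= B.
Proof.
move=> cL cF.
have [B B0 H] : exists2 B, 0 < B & forall z, L z -> L z -> N (F z) <= B.
  apply: (@compact_ind _ L (fun E => exists2 B, 0 < B & forall z, E z -> L z -> N (F z) <= B)) => //.
  - by exists 1.
  - move=> E E' [B B0 H] [B' B'0 H']; exists (Num.max B B'); first by rewrite lt_max B0.
    move=> z [Ez|Ez] Lz; rewrite le_max; first by rewrite H.
    by rewrite H' ?orbT.
  - by move=> E E' EE [B B0 H]; exists B => // z /EE; exact: H.
  move=> z Lz; have [d d0 Hd] := cF z Lz 1 ltr01; exists d => //.
  exists (N (F z) + 1); first by have := N_ge0 (F z); lra.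
  move=> w /Hd h _; have := ND (F w - F z) (F z); rewrite subrK; lra.
by exists B => // z Lz; exact: H.
Qed.

Lemma holoP A f : holomorphic_on A f <-> forall z, A z -> exists c, cder f z c.
Proof. by split=> H z /H/derivableP. Qed.

Lemma runge A F d e : bnd A -> nice A -> (forall z, A z -> exists c, cder F z c) ->
  0 < d -> 0 < e -> exists q : {poly R[i]}, forall z, depth A d z -> N (F z - q.[z]) <= e.
Proof.
move=> bA nA dF d0 e0; have [L [M [K0 [cL LA _ [K00 H]]]]] := bernstein_walsh bA nA d0.
have cF z : L z -> ccont F z by move=> /LA/dF[c]; exact: cder_cont.
have [B B0 FB] := compact_bounded cL cF.
have dFL z : L z -> exists c, cder F z c by move=> /LA/dF.
have KB : 0 < e / (K0 * B + 1) by rewrite divr_gt0//; have := mulr_ge0 K00 (ltW B0); lra.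
have [k Hk] : exists k, (3 / 4) ^+ k <= e / (K0 * B + 1).
  have [||n Hn] := @pow_small (3 / 4) _ _ _ KB; [lra|lra|by exists n; exact: Hn].
have [p [_ Hp]] := H F B k B0 dFL FB; exists p => z /Hp h; apply: le_trans h _.
have KB0 : 0 <= K0 * B by rewrite mulr_ge0// ltW.
move: Hk; rewrite ler_pdivlMr; last lra.
have : 0 <= (3 / 4) ^+ k :> R by rewrite exprn_ge0// divr_ge0.
by set x := (3 / 4) ^+ k; set y := K0 * B => x0 h; lra.
Qed.

Lemma uniform_on_compact A L (F : nat -> R[i] -> R[i]) f : open A -> compact L -> L `<=` A ->
  locally_uniform_cvg A F f -> forall e, 0 < e ->
  exists n0, forall n, (n0 <= n)%N -> forall z, L z -> N (F n z - f z) < e.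
Proof.
move=> oA cL LA /(locally_uniformP _ _ oA) H e e0.
have [n0 Hn] : exists n0, forall n, (n0 <= n)%N -> forall z, L z -> A z -> N (F n z - f z) < e.
  apply: (@compact_ind _ L (fun E => exists n0, forall n, (n0 <= n)%N -> forall z, E z -> A z -> N (F n z - f z) < e)) => //.
  - by exists 0.
  - move=> E E' [n Hn] [n' Hn']; exists (maxn n n') => k; rewrite geq_max => /andP[k1 k2] z [].
      exact: Hn.
    exact: Hn'.
  - by move=> E E' EE [n Hn]; exists n => k kn z /EE; exact: Hn.
  move=> z /LA/H[d d0 Hd]; exists d => //; have [n0 Hn] := Hd e e0.
  by exists n0 => n /Hn h w; exact: h.
by exists n0 => n /Hn h z Lz; apply: h => //; exact: LA.
Qed.

Definition slit_disc (B : R) := [set z : R[i] | N z < B /\ slit_plane z].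

Lemma open_slit : open (@slit_plane R).
Proof.
apply/openN => z /slit_planeE[iz|rz].
  exists `|complex.Im z|; first by rewrite normr_gt0.
  move=> w wz; apply/slit_planeE; left; apply/eqP => iw.
  by have := le_lt_trans (N_Im _) wz; rewrite ImB iw sub0r normrN ltxx.
exists (complex.Re z) => // w wz; apply/slit_planeE; right.
by have := le_lt_trans (N_Re _) wz; rewrite ReB ltr_norml; lra.
Qed.

Lemma open_slit_disc B : open (slit_disc B).
Proof.
apply/openN => z [zB zs]; have [d d0 Hd] := (openN _).1 open_slit z zs.
exists (Num.min d (B - N z)); first by rewrite lt_min d0 subr_gt0.
move=> w; rewrite lt_min => /andP[/Hd ws wz]; split => //.
have := ND (w - z) z; rewrite subrK; lra.
Qed.

Lemma bnd_slit_disc B : bnd (slit_disc B).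
Proof. by exists B => z [/ltW]. Qed.

Lemma slit_disc_connected B : 1 < B -> connected (slit_disc B).
Proof.
move=> B1; apply: (@star_connected _ _ 1) => w [wB ws] v [t]; rewrite /= in_itv /= => /andP[t0 t1] <-.
have E : 1 + t%:C * (w - 1) = (1 - t)%:C + t%:C * w by rewrite rmorphB rmorph1; ring.
split.
  rewrite E; apply: le_lt_trans (ND _ _) _; rewrite NM !N_real !ger0_norm; [|lra|lra].
  have [->|tn] := eqVneq t 0; first by rewrite mul0r subr0 addr0.
  have : 0 < t * (B - N w) by rewrite mulr_gt0 ?subr_gt0// lt_def tn.
  have : 0 <= (1 - t) * (B - 1) by rewrite mulr_ge0; lra.
  lra.
rewrite E; apply/slit_planeE.
have -> : complex.Im ((1 - t)%:C + t%:C * w) = t * complex.Im w by case: w {wB ws E} => ? ? /=; ring.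
have -> : complex.Re ((1 - t)%:C + t%:C * w) = (1 - t) + t * complex.Re w.
  by case: w {wB ws E} => ? ? /=; ring.
have [->|tn] := eqVneq t 0; first by right; rewrite mul0r; lra.
move/slit_planeE: ws => [iw|rw]; first by left; rewrite mulf_neq0.
right; have : 0 < t * complex.Re w by rewrite mulr_gt0// lt_def tn.
lra.
Qed.

(** For a pole [q] outside the disc the constant polynomial [- q^-1] already works: it leaves
    [z / q], of modulus bounded below 1. A pole on the slit is reached from [- B] by pushing along
    the slit. *)
Lemma nice_slit_disc B : 0 < B -> nice (slit_disc B).
Proof.
move=> B0 d p d0 np.
have big q : B <= N q -> pinv (depth (slit_disc B) d) q.
  move=> Bq; have Nq : 0 < N q by lra.
  have q0 : q != 0 by rewrite -N_gt0.
  have zB z : depth (slit_disc B) d z -> N z <= B - d / 2.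
    move=> zd; have z0 : z != 0 by apply: slit_neq0; have [] := depth_sub d0 zd.
    have Nz : 0 < N z by rewrite N_gt0.
    have r0 : 0 <= d / 2 / N z by rewrite !divr_ge0 ?ltW.
    have [|h _] := zd (z + (d / 2 / N z)%:C * z).
      rewrite addrAC subrr add0r NM N_real ger0_norm// divfK ?gt_eqF//; lra.
    move: h; have -> : z + (d / 2 / N z)%:C * z = (1 + d / 2 / N z)%:C * z.
      by rewrite rmorphD rmorph1; ring.
    rewrite NM N_real ger0_norm; last by rewrite addr_ge0.
    by rewrite mulrDl mul1r divfK ?gt_eqF//; lra.
  (* The maximum with 0 covers the case where [B - d / 2] is negative. *)
  pose th := Num.max 0 ((B - d / 2) / B).
  have th0 : 0 <= th by rewrite le_max lexx.
  have th1 : th < 1 by rewrite /th gt_max ltr01 ltr_pdivrMr//; lra.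
  have [|n Hn] := pow_small th0 th1 (_ : 0 < 3 / 4); first by lra.
  have [T [_ HT]] := @pinv_power _ (- q^-1)%:P q 1 n (size_polyC_leq1 _).
  exists T => z zd; rewrite HT NX.
  apply: (@le_trans _ _ (th ^+ n)); last exact: Hn.
  apply: lerXn2r; rewrite ?nnegrE ?N_ge0// hornerC.
  have -> : 1 - - q^-1 * (z - q) = z / q by field.
  rewrite NM NV /th le_max; apply/orP; right.
  rewrite ler_pdivrMr// mulrAC ler_pdivlMr//.
  have := zB z zd; have := N_ge0 z => h1 h2.
  have h3 : N z * B <= (B - d / 2) * B by rewrite ler_pM2r.
  have h4 : (B - d / 2) * B <= (B - d / 2) * N q by rewrite ler_wpM2l//; lra.
  by lra.
have [Bp|pB] := leP B (N p); first exact: big.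
have nsp : ~ slit_plane p by move=> sp; apply: np.
have [ip rp] : complex.Im p = 0 /\ complex.Re p <= 0.
  split; first by apply/eqP; apply: contrapT => /negP h; apply/nsp/slit_planeE; left.
  by rewrite leNgt; apply/negP => h; apply/nsp/slit_planeE; right.
apply: (@pinv_push _ _ _ (- B)%:C) => //; last first.
  by apply: big; rewrite N_real normrN ger0_norm// ltW.
move=> t /andP[t0 t1] [_ /slit_planeE].
rewrite Im_segment Re_segment ip /= subrr mulr0 addr0 eqxx; case=> // h.
have : (1 - t) * B >= 0 by apply: mulr_ge0; [lra|exact: ltW].
have : t * complex.Re p <= 0 by rewrite mulr_ge0_le0.
lra.
Qed.

(** A Bernoulli inequality: it bounds [(1 + x)^j] by [1 / (1 - j x)] as long as [j x < 1]. *)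
Lemma weight_ratio (x : R) j : 0 <= x -> (1 + x) ^+ j * (1 - j%:R * x) <= 1.
Proof.
move=> x0; elim: j => [|j IH]; first by rewrite expr0 mul0r subr0 mulr1.
apply: le_trans IH; rewrite exprSr -mulrA; apply: ler_wpM2l; first by rewrite exprn_ge0; lra.
rewrite -natr1; have : 0 <= (j%:R + 1) * x ^+ 2 by rewrite mulr_ge0 ?sqr_ge0// addr_ge0.
by rewrite expr2; lra.
Qed.

(* [P] is Q^k p with k the integral part of a n / s and r = a n - k s, where p
   approximates q z^-r (z^s Q)^-k.  This function is bounded by C (1 - eps)^-k, which
   grows more slowly than the approximation error (3/4)^(k/M) decays. *)
Lemma weighted_polynomials A d : bnd A -> nice A -> 0 < d -> A `<=` slit_plane ->
  exists L eps, [/\ compact L, L `<=` A, 0 < eps & forall s a (Q : {poly R[i]}), 0 < s -> 0 < a ->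
    (forall z, L z -> N (powC z s * Q.[z] - 1) <= eps) -> a * (size Q)%:R <= s ->
    forall (q : {poly R[i]}) e, 0 < e -> exists n0, forall n, (n0 <= n)%N ->
      exists P : {poly R[i]}, (size P <= n.+1)%N /\
        forall z, depth A d z -> N (powC z (a * n%:R) * P.[z] - q.[z]) <= e].
Proof.
move=> bA nA d0 As; have [L [M [K0 [cL LA dL [K00 BW]]]]] := bernstein_walsh bA nA d0.
have M1 : 0 < (M.+1)%:R :> R by rewrite ltr0n.
(* [M.+1 * x = 1 / 7] gives [(1 + x) ^+ M.+1 <= 7 / 6]. Growth by 7/6 against decay by 3/4 leaves
   the ratio 7/8. *)
pose x : R := (7 * (M.+1)%:R)^-1.
have x0 : 0 < x by rewrite invr_gt0 mulr_gt0.
have x1 : x <= 1 / 7.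
  by rewrite /x mul1r lef_pV2 ?posrE ?mulr_gt0// ler_peMr// ler1n.
(* Then [(1 + eps) / (1 - eps) <= 1 + x]; this quotient bounds the oscillation of [N (h z)] on [L]
   and enters to the power [k]. *)
pose eps := x / 4; have eps0 : 0 < eps by rewrite divr_gt0.
have eps1 : eps <= 1 / 28 by rewrite /eps; lra.
exists L, eps; split => // s a Q s0 a0 HQ sQ q e e0.
have [[z1 Lz1]|/set0P/negP] := pselect (L !=set0); last first.
  rewrite negbK => /eqP LE; exists 0 => n _; exists 0; rewrite size_poly0; split => // z /dL.
  by rewrite LE.
have Ls z : L z -> slit_plane z by move=> /LA/As.
have [lam lam0 Hlam] := compact_bounded cL (fun z Lz => logC_cont (Ls z Lz)).
have [Bq Bq0 HBq] := compact_bounded cL (fun z _ => cder_cont (cder_horner q z)).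
pose E := expR (s * lam).
have E0 : 0 < E by exact: expR_gt0.
have powE z r : L z -> `|r| <= s -> N (powC z r) <= E.
  move=> Lz rs; rewrite N_powC /E ler_expR.
  have h : `|ln (N z)| <= lam by apply: le_trans (Hlam z Lz); exact: (N_Re (logC z)).
  by apply: le_trans (ler_norm _) _; rewrite normrM; exact: ler_pM.
pose h z := powC z s * Q.[z].
have h_le z : L z -> N (h z) <= 1 + eps.
  by move=> /HQ hh; have := ND (h z - 1) 1; rewrite subrK N1 /h; lra.
have h_ge z : L z -> 1 - eps <= N (h z).
  by move=> /HQ hh; have := NBB 1 (1 - h z); rewrite subKr N1 [N (1 - _)]distNC /h; lra.
have h_neq z : L z -> h z != 0 by move=> /h_ge hh; rewrite -N_gt0; lra.
have Q1 : (0 < size Q)%N.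
  rewrite size_poly_gt0; apply/eqP => Q0; move: (h_neq z1 Lz1).
  by rewrite /h Q0 horner0 mulr0 eqxx.
(* The factor 7/6 pays for rounding [k] up to a multiple of [M.+1]. *)
pose Cst := E * (K0 * (Bq * E)) * (7 / 6).
have Cst0 : 0 <= Cst by rewrite /Cst !mulr_ge0// ?divr_ge0// ltW.
have Cst1 : 0 < Cst + 1 by lra.
have [||k0 Hk0] := @pow_small (7 / 8) _ _ _ (divr_gt0 e0 Cst1); [lra|lra|].
pose m0 := (k0 * M.+1)%N.
exists (Num.trunc (m0%:R * s / a)).+1 => n nn.
pose k := Num.trunc (a * n%:R / s).
have an0 : 0 <= a * n%:R / s by rewrite divr_ge0 ?mulr_ge0// ltW.
have /andP[ks1 ks2] := truncn_itv an0.
rewrite -/k ler_pdivlMr// in ks1; rewrite -/k ltr_pdivrMr// in ks2.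
have mk : (m0 <= k)%N.
  rewrite truncn_ge_nat// ler_pdivlMr//.
  have := truncnS_gt (m0%:R * s / a); rewrite ltr_pdivrMr// => h1.
  apply: ltW; apply: lt_le_trans h1 _; rewrite mulrC ler_pM2l// ler_nat//.
(* The [k] factors [Q] leave [k] spare degrees, and an approximation of order [kap] uses at most
   [M * kap <= k]. *)
pose kap := (k %/ M.+1)%N.
have k0kap : (k0 <= kap)%N by rewrite leq_divRL.
pose r := a * n%:R - k%:R * s.
have r0 : 0 <= r by rewrite subr_ge0.
have rs : r <= s by move: ks2; rewrite -natr1 mulrDl mul1r /r; lra.
pose ie := (1 - eps)^-1.
have ie0 : 0 < ie by rewrite invr_gt0; lra.
pose F z := q.[z] * powC z (- r) * (h z ^+ k)^-1.
have dF z : L z -> exists c, cder F z c.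
  move=> Lz; have [c1 d1] := cder_powC (- r) (Ls z Lz).
  have [c2 d2] := cder_powC s (Ls z Lz).
  have [c3 d3] := cderX k (cderM d2 (cder_horner Q z)).
  have hk : h z ^+ k != 0 by rewrite expf_neq0// h_neq.
  eexists; exact: cderM (cderM (cder_horner q z) d1) (cderV d3 hk).
pose B := Bq * E * ie ^+ k.
have B0 : 0 < B by rewrite /B !mulr_gt0// exprn_gt0.
have FB z : L z -> N (F z) <= B.
  move=> Lz; rewrite /F NM [N (q.[z] * _)]NM NV NX /B.
  have u1 : N (powC z (- r)) <= E by apply: powE => //; rewrite normrN ger0_norm.
  have u2 := ler_pM (N_ge0 _) (N_ge0 _) (HBq z Lz) u1.
  apply: (ler_pM _ _ u2 _); rewrite ?mulr_ge0 ?invr_ge0 ?exprn_ge0 ?N_ge0//.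
  rewrite /ie exprVn lef_pV2 ?posrE ?exprn_gt0//; [|by rewrite N_gt0 h_neq|by lra].
  by apply: lerXn2r; rewrite ?nnegrE ?N_ge0 ?h_ge//; lra.
have [p [sp Hp]] := BW F B kap B0 dF FB.
exists (Q ^+ k * p); split.
  apply: leq_trans (size_polyMleq _ _) _.
  have s1 := size_poly_exp_leq Q k.
  have s2 : (k * size Q <= n)%N.
    rewrite -(@ler_nat R) natrM -(ler_pM2l a0); apply: le_trans ks1.
    by rewrite mulrCA ler_wpM2l.
  have s3 : (size p <= k)%N.
    by apply: leq_trans sp _; apply: leq_trans (leq_trunc_div k M.+1); rewrite mulnC leq_mul.
  move: s1 s2 s3 Q1; move: (size (Q ^+ k)) (size Q) (size p) => u v w.
  by case: v => // v; rewrite /= mulnS mulnC; clear; lia.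
move=> z zd; have Lz := dL z zd.
have -> : powC z (a * n%:R) * (Q ^+ k * p).[z] - q.[z] = h z ^+ k * powC z r * (p.[z] - F z).
  have -> : a * n%:R = s * k%:R + r by rewrite /r; ring.
  rewrite powCD -powCX hornerM horner_exp /F powCN.
  have hE : h z ^+ k = powC z s ^+ k * Q.[z] ^+ k by rewrite /h exprMn.
  have pr := powC_neq0 z r.
  have hk : h z ^+ k != 0 by rewrite expf_neq0// h_neq.
  rewrite mulrBr; congr (_ - _); first by rewrite hE; ring.
  by field; rewrite pr hk.
rewrite NM [N (h z ^+ k * _)]NM NX [N (p.[z] - _)]distNC.
have t1 : N (h z) ^+ k <= (1 + eps) ^+ k.
  by apply: lerXn2r; rewrite ?nnegrE ?N_ge0 ?h_le//; lra.
have t2 : N (powC z r) <= E by apply: powE => //; rewrite ger0_norm.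
have t12 := ler_pM (exprn_ge0 k (N_ge0 (h z))) (N_ge0 _) t1 t2.
have t123 := ler_pM (mulr_ge0 (exprn_ge0 k (N_ge0 (h z))) (N_ge0 _)) (N_ge0 _) t12 (Hp z zd).
apply: (le_trans t123).
have rat : (1 + eps) ^+ k * ie ^+ k <= (7 / 6) ^+ kap.+1.
  have -> : (1 + eps) ^+ k * ie ^+ k = ((1 + eps) * ie) ^+ k by rewrite exprMn.
  have rho : (1 + eps) * ie <= 1 + x.
    rewrite /ie ler_pdivrMr; last lra.
    have e4 : x = 4 * eps by rewrite /eps; field.
    by rewrite e4; nra.
  have rho0 : 0 <= (1 + eps) * ie by rewrite mulr_ge0 ?(ltW ie0)//; lra.
  apply: (@le_trans _ _ ((1 + x) ^+ k)); first by apply: lerXn2r; rewrite ?nnegrE//; lra.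
  apply: (@le_trans _ _ ((1 + x) ^+ (M.+1 * kap.+1))).
    by apply: ler_weXn2l; [lra|rewrite mulnC ltnW// ltn_ceil].
  rewrite exprM; apply: lerXn2r; rewrite ?nnegrE ?exprn_ge0 ?divr_ge0//; [lra|].
  have := @weight_ratio x M.+1 (ltW x0).
  have -> : M.+1%:R * x = 1 / 7 by rewrite /x; field; rewrite gt_eqF.
  lra.
have q0 : 0 <= (3 / 4) ^+ kap :> R by rewrite exprn_ge0// divr_ge0.
have -> : (1 + eps) ^+ k * E * (K0 * B * (3 / 4) ^+ kap) =
   E * (K0 * (Bq * E)) * (3 / 4) ^+ kap * ((1 + eps) ^+ k * ie ^+ k).
  have ringE (c1 c2 c3 u v w : R) :
    u * c1 * (c2 * (c3 * c1 * v) * w) = c1 * (c2 * (c3 * c1)) * w * (u * v) by ring.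
  exact: ringE.
have c0 : 0 <= E * (K0 * (Bq * E)) * (3 / 4) ^+ kap.
  by rewrite !mulr_ge0// ltW.
apply: (le_trans (ler_wpM2l c0 rat)).
have -> : E * (K0 * (Bq * E)) * (3 / 4) ^+ kap * (7 / 6) ^+ kap.+1 = Cst * (7 / 8) ^+ kap.
  have -> : 7 / 8 = (3 / 4) * (7 / 6) :> R by field.
  by rewrite (exprMn _ (3 / 4) (7 / 6)) (exprS (7 / 6)) /Cst mulrACA.
have := Hk0 kap k0kap; rewrite ler_pdivlMr// => hh.
have : 0 <= (7 / 8) ^+ kap :> R by rewrite exprn_ge0// divr_ge0.
by move: hh; set y := (7 / 8) ^+ kap => hh y0; lra.
Qed.

End Approximation.

(** * Construction of domains and the threshold exponent *)

Section Domains.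
Context {R : realType}.
Implicit Types (A K G X : set R[i]) (f : R[i] -> R[i]) (z w p : R[i]) (d e s a b : R).

(** For each [n] the polynomial serving the largest available [j <= n] is chosen. Some [j >= J] is
    enough, since the tolerances attached to [j] shrink. *)
Lemma diagonal_polynomials (good : nat -> nat -> {poly R[i]} -> Prop) :
  (forall j, exists n0, forall n, (n0 <= n)%N ->
     exists P : {poly R[i]}, (size P <= n.+1)%N /\ good n j P) ->
  exists P : nat -> {poly R[i]}, (forall n, (size (P n) <= n.+1)%N) /\
    forall J, exists n0, forall n, (n0 <= n)%N -> exists2 j, (J <= j)%N & good n j (P n).
Proof.
move=> H; pose S n j := exists P : {poly R[i]}, (size P <= n.+1)%N /\ good n j P.
have max n m : exists P : {poly R[i]}, (size P <= n.+1)%N /\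
    forall j, (j <= m)%N -> S n j -> exists2 j', (j <= j')%N & good n j' P.
  elim: m => [|m [P [sP HP]]].
    have [[P [sP gP]]|n0] := pselect (S n 0).
      by exists P; split => // j; rewrite leqn0 => /eqP -> _; exists 0.
    by exists 0; rewrite size_poly0; split => // j; rewrite leqn0 => /eqP ->.
  have [[P' [sP' gP']]|nS] := pselect (S n m.+1).
    by exists P'; split => // j jm _; exists m.+1.
  exists P; split => // j; rewrite leq_eqVlt => /predU1P[-> //|].
  by rewrite ltnS; exact: HP.
have [P HP] := choice (fun n => max n n); exists P; split => [n|J]; first by have [] := HP n.
have [n0 Hn] := H J; exists (maxn n0 J) => n; rewrite geq_max => /andP[n0n Jn].
by have [_] := HP n; apply => //; exact: Hn.
Qed.

Lemma small_inv e : 0 < e -> exists J, forall j, (J <= j)%N -> j.+1%:R^-1 <= e.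
Proof.
move=> e0; exists (Num.trunc e^-1) => j Jj; rewrite -[e]invrK lef_pV2 ?posrE ?invr_gt0//.
by apply: ltW; apply: lt_le_trans (truncnS_gt _) _; rewrite ler_nat.
Qed.

(** The domain, [L] and [eps] are fixed before [s], [a] and [Q], so a later approximation problem on
    the fixed compact [L] decides which exponents this one domain admits. *)
Lemma exists_domain A K z0 : open A -> connected A -> bnd A -> nice A -> A `<=` slit_plane ->
  A z0 -> compact K -> K `<=` A ->
  exists X L eps, [/\ domain X, simply_connected X, bounded_set X & K `<=` X] /\
    [/\ X `<=` A, compact L, L `<=` A & 0 < eps] /\
    forall s a (Q : {poly R[i]}), 0 < s -> 0 < a ->
      (forall z, L z -> N (powC z s * Q.[z] - 1) <= eps) -> a * (size Q)%:R <= s ->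
      pair_of_approximation X a.
Proof.
move=> oA cA bA nA As Az0 cK KA.
have [D [cD kD DA Dz KD]] := connected_hull oA cA Az0 cK KA.
have [d d0 Dd] := compact_in_open cD oA DA.
have d3 : 0 < d / 3 by rewrite divr_gt0.
have [Gr HG] := exists_grid bA d3.
pose X0 := inner Gr; pose X := connected_component X0 z0.
have DX0 : D `<=` X0.
  move=> z /Dd zd; apply: (grid_depth HG d3).
  by have -> : 3 * (d / 3) = d by field.
have oX0 : open X0 by exact: open_inner.
have nX0 : nice X0 := nice_inner nA HG.
have XX0 : X `<=` X0 by exact: connected_component_sub.
have X0A : X0 `<=` A := grid_inner HG.
have bX0 : bnd X0 by have [B HB] := bA; exists B => z /X0A/HB.
(* The closed squares form a compact subset of [A], so one margin [d2] covers all of [X0] and the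
   weighted approximation is uniform on the new domain. *)
have [d2 d20 Od2] := compact_in_open (@compact_outer _ Gr) oA (grid_outer HG).
have X0d2 : X0 `<=` depth A d2 by move=> z /inner_outer/Od2.
have [L [eps [cL LA eps0 HL]]] := weighted_polynomials bA nA d20 As.
exists X, L, eps; split; [|split].
- split.
  + split; [exact: component_open|exact: component_connected|].
    by exists z0; apply: connected_component_refl; apply: DX0.
  + exact: (component_simply_connected (inner_simply_connected nX0)).
  + by apply/bounded_setP; have [B HB] := bX0; exists B => z /XX0/HB.
  + by move=> z /KD Dz'; exact: (connected_component_max Dz DX0 kD).
- by split => // z /XX0/X0A.
move=> s a Q s0 a0 HQ sQ f /holoP df.
(* Niceness is known for [X0], not for its component [X]. The components are open, so [f] extended
   by 0 is holomorphic on [X0] and Runge's theorem applies there. *)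
pose F z := if `[< X z >] then f z else 0.
have dF z : X0 z -> exists c, cder F z c.
  move=> X0z; have [Xz|nXz] := pselect (X z).
    have [c dc] := df z Xz; have [r r0 Hr] := component_nbhs oX0 Xz.
    by exists c; apply: (cder_near r0 _ dc) => w /Hr Xw; rewrite /F asboolT.
  have [r r0 Hr] := component_compl_nbhs oX0 X0z nXz.
  by exists 0; apply: (cder_near r0 _ (cder_cst 0 z)) => w /Hr[_ nXw]; rewrite /F asboolF.
have i0 j : 0 < j.+1%:R^-1 :> R by rewrite invr_gt0.
have [q Hq] := choice (fun j => runge bX0 nX0 dF (i0 j) (i0 j)).
have [P [sP HP]] := diagonal_polynomials (fun j => HL s a Q s0 a0 HQ sQ (q j) _ (i0 j)).
exists P; split => //; apply/locally_uniformP; first exact: component_open.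
move=> z Xz; have [r r0 Hr] := (openN _).1 oX0 z (XX0 z Xz).
have r2 : 0 < r / 2 by rewrite divr_gt0.
exists (r / 2) => // e e0; have e2 : 0 < Num.min (r / 2) (e / 3).
  by rewrite lt_min r2 divr_gt0.
have [J HJ] := small_inv e2; have [n0 Hn] := HP J; exists n0 => n /Hn[j /HJ + gj] w wz Xw.
rewrite le_min => /andP[jr je].
have wd : depth X0 j.+1%:R^-1 w.
  move=> v /lt_le_trans/(_ jr) vw; apply: Hr.
  by have := ND (v - w) (w - z); rewrite addrA subrK; lra.
have := le_trans (Hq j w wd) je; rewrite /F asboolT// [N (f w - _)]distNC => h1.
have h2 := le_trans (gj w (X0d2 w (XX0 w Xw))) je.
have := ND (powC w (a * n%:R) * (P n).[w] - (q j).[w]) ((q j).[w] - f w).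
rewrite addrA subrK; lra.
Qed.

(** Some [z^(an) P_n] approximates 1/(z - p), and [z^(an)] is itself a limit of polynomials [T] on a
    slit disc, which is nice. The product [T * P n] is then the witness, each of the two errors
    costing at most 1/4. *)
Lemma nice_of_pair A a : open A -> bnd A -> A `<=` slit_plane -> pair_of_approximation A a ->
  nice A.
Proof.
move=> oA bA As pA d p d0 np; have [B0 AB0] := bA.
pose B := `|B0| + 1; have B1 : 0 < B by rewrite ltr_wpDl.
have AB : A `<=` slit_disc B.
  move=> z Az; split; last exact: As.
  by have := AB0 z Az; have := ler_norm B0; rewrite /B; lra.
have [|P [_ HP]] := pA (fun z => (z - p)^-1).
  apply/holoP => z Az; eexists; apply: cderV (cderB (cder_id z) (cder_cst p z)) _.
  by rewrite subr_eq0; apply/eqP => zp; apply: np; rewrite -zp.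
have cC := compact_depth bA d0; have CA := @depth_sub _ A d d0.
pose M := B + N p; have M0 : 0 < M by rewrite ltr_pwDl ?N_ge0.
have e0 : 0 < (4 * M)^-1 by rewrite invr_gt0 mulr_gt0.
have [n /(_ n (leqnn n)) Hn] := uniform_on_compact oA cC CA HP e0.
have [BP BP0 HBP] := compact_bounded cC (fun z _ => cder_cont (cder_horner (P n) z)).
have e1 : 0 < (4 * (M * BP))^-1 by rewrite invr_gt0 !mulr_gt0.
have dp z : slit_disc B z -> exists c, cder (fun w => powC w (a * n%:R)) z c.
  by move=> [_ sz]; exact: cder_powC.
have [T HT] := runge (bnd_slit_disc B) (nice_slit_disc B1) dp d0 e1.
exists (T * P n) => z zC.
have zM : N (z - p) <= M.
  by have := NB z p; have [zB _] := AB z (CA z zC); rewrite /M; lra.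
have zp : z - p != 0 by rewrite subr_eq0; apply/eqP => zp; apply: np; rewrite -zp; exact: CA.
have -> : 1 - (T * P n).[z] * (z - p) =
    (powC z (a * n%:R) - T.[z]) * ((z - p) * (P n).[z]) -
    (powC z (a * n%:R) * (P n).[z] - (z - p)^-1) * (z - p).
  by rewrite hornerM -{1}(mulVf zp); ring.
apply: le_trans (NB _ _) _; rewrite [N (_ * (_ * _))]NM [N ((z - p) * _)]NM [N (_ * (z - p))]NM.
have h1 := HT z (depth_mono AB zC).
have h2 := ler_pM (N_ge0 _) (N_ge0 _) zM (HBP z zC).
have h3 := ler_pM (N_ge0 _) (mulr_ge0 (N_ge0 _) (N_ge0 _)) h1 h2.
have h4 := ler_pM (N_ge0 _) (N_ge0 _) (ltW (Hn z zC)) zM.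
have E1 : (4 * (M * BP))^-1 * (M * BP) = 1 / 4 by field; rewrite !gt_eqF.
have E2 : (4 * M)^-1 * M = 1 / 4 by field; rewrite gt_eqF.
rewrite E1 in h3; rewrite E2 in h4; lra.
Qed.

Definition admits_domain K a := exists G : set R[i],
  [/\ domain G, simply_connected G & bounded_set G] /\
  [/\ G `<=` slit_plane, K `<=` G & pair_of_approximation G a].

(* Approximating z^(-2a) makes z^(a(n+2)) P_n close to 1 with [size (P n) <= n.+1],
   so every exponent up to a(n+2)/(n+1) is admitted. *)
Lemma admits_domain_open K a : compact K -> 0 < a -> admits_domain K a ->
  exists2 a', a < a' & forall b, 0 < b -> b <= a' -> admits_domain K b.
Proof.
move=> cK a0 [G [[[oG cG [z0 Gz0]] _ /bounded_setP bG] [Gs KG pG]]].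
have nG := nice_of_pair oG bG Gs pG.
have [X [L [eps [[dX sX bX KX] [[XG cL LG eps0] H]]]]] :=
  exists_domain oG cG bG nG Gs Gz0 cK KG.
have [|P [sP HP]] := pG (fun z => powC z (- (2 * a))).
  by apply/holoP => z /Gs; exact: cder_powC.
have cp z : L z -> ccont (fun w => powC w (2 * a)) z.
  by move=> /LG/Gs/(cder_powC (2 * a))[c]; exact: cder_cont.
have [B B0 HB] := compact_bounded cL cp.
have [n /(_ n (leqnn n)) Hn] := uniform_on_compact oG cL LG HP (divr_gt0 eps0 B0).
have n1 : 0 < n.+1%:R :> R by [].
pose s := a * n.+2%:R; have s0 : 0 < s by rewrite mulr_gt0.
exists (s / n.+1%:R); first by rewrite ltr_pdivlMr// ltr_pM2l// ltr_nat.
move=> b b0 bs; exists X; split => //; split; [by move=> z /XG/Gs|exact: KX|].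
apply: (H s b (P n) s0 b0) => [z Lz|]; last first.
  by rewrite ler_pdivlMr// in bs; apply: le_trans bs; rewrite ler_pM2l// ler_nat.
have -> : powC z s * (P n).[z] - 1 =
    powC z (2 * a) * (powC z (a * n%:R) * (P n).[z] - powC z (- (2 * a))).
  have -> : s = 2 * a + a * n%:R by rewrite /s -!natr1; ring.
  by rewrite powCD powCN mulrBr mulfV ?powC_neq0 ?mulrA.
have h := ler_pM (N_ge0 _) (N_ge0 _) (HB z Lz) (ltW (Hn z Lz)).
by rewrite NM; apply: le_trans h _; rewrite mulrCA divff ?mulr1// gt_eqF.
Qed.

(** In a slit disc a polynomial [q] close to 1/z makes [z q] close to 1; this is the criterion with
    [s = 1], satisfied by the exponent [(size q).+1%:R^-1]. *)
Lemma admits_domain_small K : K `<=` slit_plane -> compact K ->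
  exists2 a, 0 < a & admits_domain K a.
Proof.
move=> Ks cK; have [B0 B00 KB] := compact_bounded cK (fun z _ => cder_cont (cder_id z)).
pose B := B0 + 1; have B1 : 1 < B by rewrite /B; lra.
have B'0 : 0 < B by lra.
have sB : slit_disc B `<=` slit_plane by move=> z [].
have KD : K `<=` slit_disc B.
  by move=> z Kz; split; [have := KB z Kz; rewrite /B; lra|exact: Ks].
have D1 : slit_disc B 1 by split; [rewrite N1|apply/slit_planeE; right => /=].
have oD : open (slit_disc B) by exact: open_slit_disc.
have bD := bnd_slit_disc B; have nD := nice_slit_disc B'0.
have [X [L [eps [[dX sX bX KX] [[XD cL LD eps0] H]]]]] :=
  exists_domain oD (slit_disc_connected B1) bD nD sB D1 cK KD.
have [d d0 Ld] := compact_in_open cL oD LD.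
have dp z : slit_disc B z -> exists c, cder (fun w => powC w (-1)) z c.
  by move=> [_ sz]; exact: cder_powC.
have [q Hq] := runge bD nD dp d0 (divr_gt0 eps0 B'0).
exists (size q).+1%:R^-1; first by rewrite invr_gt0.
exists X; split => //; split; [by move=> z /XD/sB|exact: KX|].
apply: (H 1 _ q) => // [z Lz|]; last by rewrite mulrC ler_pdivrMr// mul1r ler_nat.
have [zB sz] := LD z Lz; have z0 := slit_neq0 sz.
have -> : powC z 1 * q.[z] - 1 = z * (q.[z] - powC z (-1)).
  by rewrite powCN powC1// mulrBr mulfV.
have h := ler_pM (N_ge0 _) (N_ge0 _) (ltW zB) (Hq z (Ld z Lz)).
by rewrite NM distNC; apply: le_trans h _; rewrite mulrCA divff ?mulr1// gt_eqF.
Qed.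

End Domains.

Theorem proposition2p5 (R : realType) (K : set R[i])
    (KS : K `<=` slit_plane) (Kcpt : compact K) (Kc : connected (~` K)) :
  exists alphaK : \bar R, (0 < alphaK)%E /\
    forall alpha : R, 0 < alpha ->
      ((alpha%:E < alphaK)%E ->
        exists G : set R[i],
          [/\ domain G, simply_connected G & bounded_set G] /\
          [/\ G `<=` slit_plane, K `<=` G & pair_of_approximation G alpha]) /\
      ((alphaK <= alpha%:E)%E ->
        ~ exists G : set R[i],
          [/\ domain G, simply_connected G & bounded_set G] /\
          [/\ G `<=` slit_plane, K `<=` G & pair_of_approximation G alpha]).
Proof.
pose S := [set a : R | 0 < a /\ admits_domain K a].
exists (ereal_sup (EFin @` S)); split.
  have [a a0 Ka] := admits_domain_small KS Kcpt.
  apply: (@lt_le_trans _ _ a%:E); first by rewrite lte_fin.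
  by apply: ereal_sup_ubound; exists a.
move=> a a0; split.
  move=> /ereal_sup_gt[_ [b [b0 Kb] <-]]; rewrite lte_fin => ab.
  have [b' bb' H] := admits_domain_open Kcpt b0 Kb.
  by apply: H => //; lra.
move=> supa Ka; have [b ab H] := admits_domain_open Kcpt a0 Ka.
have b0 : 0 < b by lra.
have : (b%:E <= a%:E)%E.
  by apply: le_trans supa; apply: ereal_sup_ubound; exists b => //; split => //; exact: H.
by rewrite lee_fin; lra.
Qed.
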